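(* Let $p>2$, let $\varphi:\mathbb{D}\to\mathbb{D}$ be analytic, and suppose that there is a neighborhood $U\subseteq\mathbb{D}$ of the origin such that $n_\varphi(w)=1$ for almost every $w\in U$ (with respect to area measure $A$). Then the composition operator $C_\varphi$ is an isometry on $B_p$ (with the norm $\|\cdot\|_{B_p}$) if and only if $\varphi$ is a rotation of the disk, i.e. $\varphi(z)=\lambda z$ for some $\lambda\in\mathbb{C}$ with $|\lambda|=1$.
   Context: $\mathbb{D}=\{z\in\mathbb{C}:|z|<1\}$, $H(\mathbb{D})$ is the set of analytic functions on $\mathbb{D}$, and $dA$ is Lebesgue area measure on $\mathbb{D}$ normalized so that $A(\mathbb{D})=1$. For $1<p<\infty$ and $f\in H(\mathbb{D})$ put $\|f\|_p^p=\int_{\mathbb{D}}|f'(z)|^p(1-|z|^2)^{p-2}\,dA(z)$; the analytic Besov space is $B_p=\{f\in H(\mathbb{D}):\|f\|_p<\infty\}$, a Banach space with norm $\|f\|_{B_p}=|f(0)|+\|f\|_p$. For an analytic $\varphi:\mathbb{D}\to\mathbb{D}$, $C_\varphi f=f\circ\varphi$. ''$C_\varphi$ is an isometry on $B_p$'' means that for every $f\in B_p$, $f\circ\varphi\in B_p$ and $\|f\circ\varphi\|_{B_p}=\|f\|_{B_p}$ (surjectivity is not required). For $w\in\mathbb{D}$, $n_\varphi(w)$ denotes the cardinality of the set $\varphi^{-1}(\{w\})=\{z\in\mathbb{D}:\varphi(z)=w\}$. *)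

(* Defs.v *)
From HB Require Import structures.
From mathcomp Require Import all_boot all_order all_algebra.
From mathcomp Require Import all_classical all_reals all_analysis.
From mathcomp Require Export complex.

Set Implicit Arguments.
Unset Strict Implicit.
Unset Printing Implicit Defensive.

Import Order.TTheory GRing.Theory Num.Theory.
Import ComplexField.Normc.
Import numFieldNormedType.Exports.
Local Open Scope classical_set_scope.
Local Open Scope ring_scope.
Local Open Scope complex_scope.

(* The library only gives the norm topology to the alias [R[i]^o]. *)
HB.instance Definition _ (R : realType) := NormedModule.copy R[i] R[i]^o.

Definition unit_disc (R : realType) : set R[i] := [set z | `|z| < 1].
Arguments unit_disc {R}.

(* Functions on the disc are represented by total functions on [R[i]]; only
   their values on the disc matter. As [R[i]] is seen as a normed module over
   itself, [derivable f z 1] is complex differentiability at [z] and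
   [derive1 f z] is the complex derivative. *)
Definition analytic (R : realType) (f : R[i] -> R[i]) : Prop :=
  forall z, unit_disc z -> derivable f z 1.

Definition cplx (R : realType) (w : R * R) : R[i] := w.1 +i* w.2.

Fact invpi_ge0 (R : realType) : 0 <= (pi : R)^-1.
Proof. by rewrite invr_ge0 pi_ge0. Qed.

(* Planar Lebesgue measure divided by pi: the unit disc has measure 1. *)
Definition area (R : realType) :
    {measure set (measurableTypeR R * measurableTypeR R) -> \bar R} :=
  mscale (NngNum (invpi_ge0 R))
    (@lebesgue_measure R \x @lebesgue_measure R)%E.
Arguments area {R}.

(* The modulus [`|z|] lives in [R[i]]; [normc z] is its value in [R]. *)
Definition besov_integral (R : realType) (p : R) (f : R[i] -> R[i]) : \bar R :=
  (\int[area]_(w in [set w : R * R | unit_disc (cplx w)])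
    (normc (derive1 f (cplx w)) `^ p
     * (1 - normc (cplx w) ^+ 2) `^ (p - 2))%:E)%E.

Definition besov (R : realType) (p : R) : set (R[i] -> R[i]) :=
  [set f | analytic f /\ (besov_integral p f < +oo)%E].

Definition besov_seminorm (R : realType) (p : R) (f : R[i] -> R[i]) : R :=
  fine (besov_integral p f) `^ p^-1.

Definition besov_norm (R : realType) (p : R) (f : R[i] -> R[i]) : R :=
  normc (f 0) + besov_seminorm p f.

Definition comp_op (R : realType) (phi f : R[i] -> R[i]) : R[i] -> R[i] :=
  f \o phi.

Definition besov_isometry (R : realType) (p : R)
    (T : (R[i] -> R[i]) -> (R[i] -> R[i])) : Prop :=
  forall f, besov p f -> besov p (T f) /\ besov_norm p (T f) = besov_norm p f.

(* [counting] is the number of elements of a set, [+oo] if it is infinite. *)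
Definition card_preimage (R : realType) (phi : R[i] -> R[i]) (w : R[i]) : \bar R :=
  counting (unit_disc `&` phi @^-1` [set w]).

Definition is_rotation (R : realType) (phi : R[i] -> R[i]) : Prop :=
  exists lambda : R[i],
    `|lambda| = 1 /\ forall z, unit_disc z -> phi z = lambda * z.

(* Main.v *)
Require Import Defs.
From mathcomp Require Import all_boot all_order all_algebra.
From mathcomp Require Import all_classical all_reals all_analysis.
From mathcomp Require Import measurable_realfun ring lra.
From mathcomp Require finmap.

(** Applying the isometry to [z + c] gives [phi 0 = 0]. Applying it to
    [z ^ (n + 1) / (n + 1)] shows that [|phi|^p] has the same moments under
    [|phi'|^p (1 - |z|^2)^(p-2) dA] as [|z|^p] has under [(1 - |z|^2)^(p-2) dA],
    so the second measure of [|z| < r] is at most the first measure of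
    [|phi| <= r]. Since almost every value near [0] is taken once, the open mapping
    theorem confines the points with [|phi z| <= r] and [phi' z <> 0] to a small
    disc around [0], and letting [r] tend to [0] gives [|phi' 0| >= 1], because
    [p > 2]. By the equality case of the Schwarz lemma [phi] is a rotation. The
    converse is the invariance of area under rotations. *)

Import Order.TTheory GRing.Theory Num.Theory.
Import ComplexField.Normc.
Import numFieldNormedType.Exports.
Set Implicit Arguments.
Unset Strict Implicit.
Unset Printing Implicit Defensive.
Local Open Scope classical_set_scope.
Local Open Scope ring_scope.
Local Open Scope complex_scope.
Local Notation Re := complex.Re.
Local Notation Im := complex.Im.

(** * Complex numbers *)

(** The condition [2 < p] acts through a comparison of exponents. If [phi] vanishes at [0] to order
    [m] with leading coefficient of modulus [a], the points near [0] with [|phi| <= r] fill about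
    the disc of radius [s] with [a * s ^ m = r], and there [|phi'|] is at most about
    [m * a * s ^ (m - 1)]. Up to factors tending to [1], the comparison of measures reads [r ^ 2 <=
    (m * a * s ^ (m - 1)) ^ p * s ^ 2]. For [m = 1] this is [1 <= a ^ (p - 2)], false when [a < 1];
    for [m > 1], division by [r ^ 2] leaves the factor [s ^ ((m - 1) * (p - 2))] on the right, which
    tends to [0]. Points far from [0] where [phi] is small and [phi'] vanishes cannot be excluded,
    but they carry no mass for the density [|phi'| ^ p]. Monomials give only the integer moments of
    [|phi| ^ p]. Polynomials approximating the indicator of [[0, 1 / k]] turn them into sublevel
    sets, which is why the radii satisfy [r ^ p = 1 / k]. The facts on analytic functions rest on
    Cauchy's formula, itself obtained by bisection in the coordinates of a homothety that shrinks
    the circle to [z]. *)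

Section ComplexNorm.
Context {R : realType}.
Implicit Types (z w : R[i]).

Lemma normr_normc z : `|z| = (normc z)%:C.
Proof. by case: z => a b. Qed.

Lemma normc_ge0 z : 0 <= normc z.
Proof. by case: z => a b; exact: sqrtr_ge0. Qed.

Lemma normc_eq0 z : (normc z == 0) = (z == 0).
Proof. by apply/eqP/eqP => [/eq0_normc|->]; last exact: normc0. Qed.

Lemma normc_gt0 z : (0 < normc z) = (z != 0).
Proof. by rewrite lt_def normc_eq0 normc_ge0 andbT. Qed.

Lemma normcR (x : R) : normc x%:C = `|x|.
Proof. by rewrite /normc /= expr0n addr0 sqrtr_sqr. Qed.

Lemma normcX z n : normc (z ^+ n) = normc z ^+ n.
Proof. by elim: n => [|n IH]; rewrite ?normc1// !exprS normcM IH. Qed.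

Lemma normcBC z w : normc (z - w) = normc (w - z).
Proof. by rewrite -normcN opprB. Qed.

Lemma normcD_le z w : normc (z + w) <= normc z + normc w.
Proof. exact: le_normcD. Qed.

Lemma normcB_le z w : normc (z - w) <= normc z + normc w.
Proof. by rewrite -(normcN w) normcD_le. Qed.

Lemma normcB_ge z w : normc z - normc w <= normc (z - w).
Proof. by rewrite lerBlDr -{1}(subrK w z) normcD_le. Qed.

Lemma normc_sqr z : normc z ^+ 2 = Re z ^+ 2 + Im z ^+ 2.
Proof. by case: z => a b /=; rewrite sqr_sqrtr ?addr_ge0 ?sqr_ge0. Qed.

Lemma normc_conj z : normc (conjc z) = normc z.
Proof. by case: z => a b; rewrite /normc /= sqrrN. Qed.

Lemma mul_conj z : z * conjc z = (normc z ^+ 2)%:C.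
Proof.
by rewrite normc_sqr; case: z => a b; apply/eqP; rewrite eq_complex /=; apply/andP; split; apply/eqP; ring.
Qed.

Lemma abs_Re_le z : `|Re z| <= normc z.
Proof. by rewrite -sqrtr_sqr -[normc z]ger0_norm ?normc_ge0// -sqrtr_sqr ler_wsqrtr// normc_sqr lerDl sqr_ge0. Qed.

Lemma abs_Im_le z : `|Im z| <= normc z.
Proof. by rewrite -sqrtr_sqr -[normc z]ger0_norm ?normc_ge0// -sqrtr_sqr ler_wsqrtr// normc_sqr lerDr sqr_ge0. Qed.

Lemma normc_le_ReIm z : normc z <= `|Re z| + `|Im z|.
Proof.
rewrite -(ler_pXn2r (ltn0Sn 1)) ?nnegrE ?normc_ge0 ?addr_ge0// normc_sqr sqrrD.
by rewrite !real_normK ?num_real// addrAC lerDl mulrn_wge0// mulr_ge0.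
Qed.

Lemma unit_discE z : unit_disc z <-> normc z < 1.
Proof. by rewrite /unit_disc /= normr_normc -[1]/(1%:C) ltcR. Qed.

Lemma nbhs_normcP z (A : set R[i]) :
  nbhs z A <-> exists2 e : R, 0 < e & forall y, normc (y - z) < e -> A y.
Proof.
split=> [/nbhs_ballP[e /= e0 eA]|[e e0 eA]].
  have [im re] : Im e = 0 /\ 0 < Re e.
    by move: e0; rewrite ltcE /= => /andP[/eqP].
  exists (Re e) => // y yz; apply: eA; rewrite -ball_normE /= distrC normr_normc.
  by rewrite (_ : e = (Re e)%:C) ?ltcR//; case: (e) im => ? ? /= ->.
apply/nbhs_ballP; exists e%:C => /=; first by rewrite -[0]/(0%:C) ltcR.
by move=> y; rewrite -ball_normE /= distrC normr_normc ltcR => /eA.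
Qed.

Lemma continuous_normcP (T : topologicalType) (f : T -> R[i]) (x : T) :
  {for x, continuous f} <->
  (forall e : R, 0 < e -> \forall y \near x, normc (f y - f x) < e).
Proof.
split=> [cf e e0|H A /nbhs_normcP[e e0 eA]].
  apply: (cf [set w | normc (w - f x) < e]).
  by apply/nbhs_normcP; exists e.
by move: (H _ e0); apply: filterS => y; exact: eA.
Qed.

(** The difference quotient cleared of its denominator: radii are real and the increment [0] is
    allowed. *)
Definition cderiv (f : R[i] -> R[i]) z d := forall e : R, 0 < e ->
  exists2 r : R, 0 < r & forall h, normc h < r ->
    normc (f (z + h) - f z - d * h) <= e * normc h.

Lemma cderivP f z d : is_derive z 1 f d <-> cderiv f z d.
Proof.
split=> [[df <-] e e0|H].
  move: df => /cvg_ex[l /= fl]; have -> : 'D_1 f z = l by apply/cvg_lim.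
  have /= := fl [set y | normc (y - l) < e].
  case; first by apply/nbhs_normcP; exists e.
  move=> /= r' r'0 Hr.
  have /nbhs_normcP[r r0 rH] : nbhs (0 : R[i]) (ball_ Num.norm 0 r').
    by apply/nbhs_ballP; exists r' => // y; rewrite -ball_normE.
  exists r => // h hr; have [->|h0] := eqVneq h 0.
    by rewrite addr0 subrr mulr0 subrr normc0 mulr0.
  have /= := Hr h (rH h _) h0; rewrite subr0 => /(_ hr).
  rewrite /shift/= => /ltW.
  rewrite -(ler_pM2r (x:=normc h)) ?normc_gt0// -normcM; congr (normc _ <= _).
  by rewrite [h *: 1]mulr1 [h + z]addrC /GRing.scale/=; field.
suff fl : h^-1 *: (f (h *: 1 + z) - f z) @[h --> (0:R[i])^'] --> d.
  by apply: DeriveDef; [apply/cvg_ex; exists d|apply/cvg_lim].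
move=> A /nbhs_normcP[e e0 eA].
(* Half of [e], because [cderiv] gives a non-strict bound and the neighbourhood asks for a strict
   one. *)
have [r r0 rH] := H (e / 2) (divr_gt0 e0 (ltr0Sn _ 1)).
have : nbhs (0:R[i]) [set y | normc y < r].
  by apply/nbhs_normcP; exists r => // y; rewrite subr0.
apply: filterS => h /= hr h0; apply: eA.
have n0 : 0 < normc h by rewrite normc_gt0.
have := rH h hr; rewrite -(ltr_pM2r n0) -normcM => hh.
apply: le_lt_trans (_ : e / 2 * normc h < _); last by rewrite ltr_pM2r// gtr_pMr// invf_lt1// ltr1n.
apply: le_trans hh; rewrite le_eqVlt; apply/orP; left; apply/eqP; congr normc.
by rewrite [h *: 1]mulr1 [h + z]addrC /GRing.scale/=; field.
Qed.

Lemma derive1_is (f : R[i] -> R[i]) z d : is_derive z 1 f d -> derive1 f z = d.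
Proof. by move=> H; rewrite derive1E derive_val. Qed.

Lemma derivable_is (f : R[i] -> R[i]) z : derivable f z 1 -> is_derive z 1 f (derive1 f z).
Proof. by move=> H; rewrite derive1E; apply/derivableP. Qed.

Lemma is_derive_continuous (f : R[i] -> R[i]) z d : is_derive z 1 f d -> {for z, continuous f}.
Proof. by case=> H _; apply/differentiable_continuous/derivable1_diffP. Qed.

Lemma is_derive_near (f g : R[i] -> R[i]) z d :
  (exists2 e : R, 0 < e & forall y, normc (y - z) < e -> f y = g y) ->
  is_derive z 1 f d -> is_derive z 1 g d.
Proof.
move=> [e e0 fg] /cderivP H; apply/cderivP => e1 /H[r r0 rH].
exists (Num.min e r); first by rewrite lt_min e0.
move=> h; rewrite lt_min => /andP[he hr]; rewrite -!fg ?subrr ?normc0//; first exact: rH.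
by rewrite [z + h]addrC addrK.
Qed.

Lemma is_derive_comp (f g : R[i] -> R[i]) z a b : is_derive z 1 g b ->
  is_derive (g z) 1 f a -> is_derive z 1 (f \o g) (a * b).
Proof.
move=> /cderivP dg /cderivP df; apply/cderivP => e e0.
pose M := normc a + normc b + 1.
have M1 : 1 <= M by rewrite lerDr addr_ge0// normc_ge0.
have M0 : 0 < M by exact: lt_le_trans M1.
(* [e1 <= 1] bounds the increment of [g] by [M * normc h]; then [e1 * (2 * M) <= e] absorbs the
   error of [f] and [normc a] times the error of [g]. *)
pose e1 := Num.min 1 (e / (2 * M)).
have e10 : 0 < e1 by rewrite lt_min ltr01 divr_gt0// mulr_gt0.
have e1M : e1 * (2 * M) <= e by rewrite -ler_pdivlMr ?mulr_gt0// ge_min lexx orbT.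
have e11 : e1 <= 1 by rewrite ge_min lexx.
have [r1 r10 H1] := dg e1 e10; have [r2 r20 H2] := df e1 e10.
exists (Num.min r1 (r2 / M)); first by rewrite lt_min r10 divr_gt0.
move=> h; rewrite lt_min => /andP[hr1]; rewrite ltr_pdivlMr// => hr2.
have {}H1 := H1 h hr1; set k := g (z + h) - g z in H1.
have nh := normc_ge0 h.
have kM : normc k <= normc h * M.
  rewrite -(subrK (b * h) k); apply: le_trans (normcD_le _ _) _; rewrite normcM.
  apply: le_trans (_ : 1 * normc h + normc b * normc h <= _).
    by rewrite lerD2r (le_trans H1)// ler_wpM2r.
  by rewrite -mulrDl mulrC ler_wpM2l// /M [1 + _]addrC lerD2r lerDr normc_ge0.
have := H2 k (le_lt_trans kM hr2); rewrite /k [g z + _]addrC subrK -/k => {}H2.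
rewrite /= (_ : _ - _ = (f (g (z + h)) - f (g z) - a * k) + a * (k - b * h)); last by ring.
apply: le_trans (normcD_le _ _) _; rewrite normcM.
apply: le_trans (_ : e1 * (normc h * M) + normc a * (e1 * normc h) <= _).
  by rewrite lerD// ?ler_wpM2l ?normc_ge0// (le_trans H2)// ler_wpM2l// ltW.
apply: le_trans (_ : e1 * (2 * M) * normc h <= _); last by rewrite ler_wpM2r.
rewrite -subr_ge0 (_ : _ - _ = e1 * normc h * (M - normc a)); last by ring.
rewrite (_ : M - normc a = normc b + 1); last by rewrite /M; ring.
by rewrite !mulr_ge0 ?(ltW e10)// addr_ge0 ?normc_ge0.
Qed.

End ComplexNorm.

(** * Continuity of complex-valued functions of a real variable *)

Section ContinuousComplex.
Context {R : realType}.
Implicit Types (f g : R -> R[i]).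

Lemma ccontM f g : continuous f -> continuous g -> continuous (fun t => f t * g t).
Proof. by move=> cf cg t; exact: (continuousM (cf t) (cg t)). Qed.

Lemma ccontD f g : continuous f -> continuous g -> continuous (fun t => f t + g t).
Proof. by move=> cf cg t; exact: (cvgD (cf t) (cg t)). Qed.

Lemma ccontB f g : continuous f -> continuous g -> continuous (fun t => f t - g t).
Proof. by move=> cf cg t; exact: (cvgB (cf t) (cg t)). Qed.

Lemma ccontV f : continuous f -> (forall t, f t != 0) -> continuous (fun t => (f t)^-1).
Proof. by move=> cf f0 t; exact: (cvgV (f0 t) (cf t)). Qed.

Lemma ccontC (k : R[i]) : continuous (fun _ : R => k).
Proof. by move=> t; exact: cvg_cst. Qed.

Lemma ccontR (f : R -> R) : continuous f -> continuous (fun t => (f t)%:C).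
Proof.
move=> cf t; apply/continuous_normcP => e e0.
move: (cf t) => /cvgrPdist_lt /(_ e e0); apply: filterS => s.
by rewrite distrC -normcR rmorphB.
Qed.

Lemma ccont_comp (f : R[i] -> R[i]) g : continuous g -> (forall t, {for g t, continuous f}) ->
  continuous (fun t => f (g t)).
Proof. by move=> cg cf t; apply: continuous_comp; [exact: cg|exact: cf]. Qed.

Lemma ccontX f n : continuous f -> continuous (fun t => f t ^+ n).
Proof.
move=> cf; elim: n => [|n IH]; first exact: ccontC.
rewrite (_ : (fun _ => _) = (fun t => f t * f t ^+ n)); first exact: ccontM.
by apply/funext => t; rewrite exprS.
Qed.
End ContinuousComplex.

(** * Integrals of continuous real functions *)

Section Primitive.
Context {R : realType}.
Implicit Types (g G : R -> R) (a b c t M : R).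

(* Based at [-1] so that the parameters [0 <= t] are interior points. *)
Definition prim g t : R :=
  (\int[lebesgue_measure]_(x in `[(-1), t] : set (measurableTypeR R)) g x)%R.

Lemma is_derive_prim g t : continuous g -> -1 < t ->
  is_derive t (1 : R) (prim g) (g t).
Proof.
move=> cg t1.
(* Integrability is taken up to [t + 1] so that [t] is an interior point. *)
have ig : (@lebesgue_measure R).-integrable `[(-1), t + 1] (EFin \o g).
  by apply: continuous_compact_integrable; [exact: segment_compact|exact: continuous_subspaceT].
have tt : t < t + 1 by rewrite ltrDl.
have [d <-] := continuous_FTC1_closed tt ig t1 (cg t).
by rewrite derive1E; exact/derivableP.
Qed.

Lemma is_derive_continuousR G t d : is_derive t (1 : R) G d -> {for t, continuous G}.
Proof. by case=> H _; apply/differentiable_continuous/derivable1_diffP. Qed.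

Lemma MVT_gtN1 G g a b : -1 < a -> a <= b ->
  (forall t, -1 < t -> is_derive t (1 : R) G (g t)) ->
  exists2 c, a <= c <= b & G b - G a = g c * (b - a).
Proof.
move=> a1 ab dG; have [|/=|c] := @MVT_segment R G g a b ab.
- by move=> x; rewrite in_itv/= => /andP[ax _]; apply: dG; exact: lt_trans ax.
- apply: continuous_in_subspaceT => x; rewrite inE/= in_itv/= => /andP[ax _].
  by apply: (@is_derive_continuousR _ _ (g x)); apply: dG; exact: lt_le_trans ax.
- by rewrite in_itv/= => cab E; exists c.
Qed.

(** Oriented: the endpoints may come in either order, and additivity over adjacent intervals is
    plain algebra. *)
Definition rint g a b := prim g b - prim g a.

(** Two primitives of [g] differ by a constant, by the mean value theorem. Linearity of the integral
    is then obtained by exhibiting a primitive. *)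
Lemma rintE g G a b : continuous g -> -1 < a -> -1 < b ->
  (forall t, -1 < t -> is_derive t (1 : R) G (g t)) ->
  rint g a b = G b - G a.
Proof.
move=> cg a1 b1 dG.
wlog ab : a b a1 b1 / a <= b.
  move=> H; case: (leP a b) => [ab|/ltW ba]; first exact: H.
  by apply: oppr_inj; have := H b a b1 a1 ba; rewrite /rint !opprB.
have dF t : -1 < t -> is_derive t (1 : R) (prim g - G) 0.
  by move=> t1; rewrite -(subrr (g t)); apply: is_deriveB; [exact: is_derive_prim|exact: dG].
have [c _] := MVT_gtN1 (g := fun=> 0) a1 ab dF.
rewrite mul0r /rint => /eqP; rewrite -[(prim g - G) b]/(prim g b - G b) -[(prim g - G) a]/(prim g a - G a).
by move=> /eqP H; apply/eqP; rewrite -subr_eq0; apply/eqP; rewrite -[RHS]H; ring.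
Qed.

Lemma rint_le g M a b : continuous g -> -1 < a -> a <= b ->
  (forall t, a <= t <= b -> g t <= M) -> rint g a b <= M * (b - a).
Proof.
move=> cg a1 ab gM; rewrite /rint; have [|c cab ->] := MVT_gtN1 (G := prim g) (g := g) a1 ab.
  by move=> t; exact: is_derive_prim.
by rewrite ler_wpM2r ?subr_ge0// gM.
Qed.

Lemma rintD g h a b : continuous g -> continuous h -> -1 < a -> -1 < b ->
  rint (fun t => g t + h t) a b = rint g a b + rint h a b.
Proof.
move=> cg ch a1 b1; transitivity ((prim g + prim h) b - (prim g + prim h) a); first apply: rintE => //.
- by move=> t; exact: (cvgD (cg t) (ch t)).
- by move=> t t1; apply: is_deriveD; exact: is_derive_prim.
- by rewrite /rint -[(_ + _) b]/(prim g b + prim h b) -[(_ + _) a]/(prim g a + prim h a); ring.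
Qed.

Lemma rintZ g k a b : continuous g -> -1 < a -> -1 < b ->
  rint (fun t => k * g t) a b = k * rint g a b.
Proof.
move=> cg a1 b1; transitivity ((k *: prim g) b - (k *: prim g) a); first apply: rintE => //.
- by move=> t; apply: (cvgM (cvg_cst k) (cg t)).
- move=> t t1; rewrite (_ : k * g t = k *: g t)//; apply: is_deriveZ; exact: is_derive_prim.
- by rewrite /rint -[(k *: prim g) b]/(k * prim g b) -[(k *: prim g) a]/(k * prim g a); ring.
Qed.

End Primitive.

(** * Complex-valued integrals *)

Section ComplexIntegral.
Context {R : realType}.
Implicit Types (g h G : R -> R[i]) (a b c t M : R) (k : R[i]).

Lemma continuous_ReIm g :
  continuous g <-> continuous (fun t => Re (g t)) /\ continuous (fun t => Im (g t)).
Proof.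
split=> [cg|[cr ci]].
  split=> t; apply/cvgrPdist_lt => e e0; move: (cg t) => /continuous_normcP /(_ e e0);
    apply: filterS => s; apply: le_lt_trans; rewrite distrC.
    by apply: le_trans (abs_Re_le _); case: (g s) (g t) => ? ? [? ?] /=.
  by apply: le_trans (abs_Im_le _); case: (g s) (g t) => ? ? [? ?] /=.
move=> t; apply/continuous_normcP => e e0.
have e2 : 0 < e / 2 by rewrite divr_gt0.
move: (cr t) (ci t) => /cvgrPdist_lt /(_ _ e2) H1 /cvgrPdist_lt /(_ _ e2) H2.
near=> s; apply: le_lt_trans (normc_le_ReIm _) _.
have -> : Re (g s - g t) = Re (g s) - Re (g t) by case: (g s) (g t) => ? ? [? ?].
have -> : Im (g s - g t) = Im (g s) - Im (g t) by case: (g s) (g t) => ? ? [? ?].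
rewrite (splitr e) distrC [X in _ + X]distrC ltrD//; by near: s.
Unshelve. all: by end_near. Qed.

Definition cint g a b : R[i] :=
  rint (fun t => Re (g t)) a b +i* rint (fun t => Im (g t)) a b.

Lemma cint_split g a b c : cint g a c = cint g a b + cint g b c.
Proof.
by apply/eqP; rewrite eq_complex /= /rint; apply/andP; split; apply/eqP; ring.
Qed.

Lemma cintE g G a b : continuous g -> -1 < a -> -1 < b ->
  (forall t, -1 < t -> is_derive t (1 : R) (fun t => Re (G t)) (Re (g t))) ->
  (forall t, -1 < t -> is_derive t (1 : R) (fun t => Im (G t)) (Im (g t))) ->
  cint g a b = G b - G a.
Proof.
move=> /continuous_ReIm[cr ci] a1 b1 dr di; rewrite /cint.
by rewrite (rintE cr a1 b1 dr) (rintE ci a1 b1 di); case: (G b) (G a) => ? ? [? ?].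
Qed.

Lemma cintD g h a b : continuous g -> continuous h -> -1 < a -> -1 < b ->
  cint (fun t => g t + h t) a b = cint g a b + cint h a b.
Proof.
move=> /continuous_ReIm[cr ci] /continuous_ReIm[dr di] a1 b1.
apply/eqP; rewrite eq_complex /= -!rintD//; apply/andP; split; apply/eqP; congr rint;
  by apply/funext => t; case: (g t) (h t) => ? ? [? ?].
Qed.

Lemma cintZ g k a b : continuous g -> -1 < a -> -1 < b ->
  cint (fun t => k * g t) a b = k * cint g a b.
Proof.
move=> /continuous_ReIm[cr ci] a1 b1.
have cZ l (u : R -> R) : continuous u -> continuous (fun t => l * u t).
  by move=> cu t; apply: (cvgM (cvg_cst l) (cu t)).
have -> : (fun t => k * g t) =
  (fun t => (Re k * Re (g t) + - Im k * Im (g t)) +i* (Re k * Im (g t) + Im k * Re (g t))).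
  by apply/funext => t; case: k (g t) => ? ? [? ?] /=; congr (_ +i* _); ring.
rewrite /cint /= !rintD ?rintZ//; try exact: cZ.
by case: k => x y /=; apply/eqP; rewrite eq_complex /=; apply/andP; split; apply/eqP; ring.
Qed.

Lemma cintB g h a b : continuous g -> continuous h -> -1 < a -> -1 < b ->
  cint (fun t => g t - h t) a b = cint g a b - cint h a b.
Proof.
move=> cg ch a1 b1.
have -> : - cint h a b = cint (fun t => -1 * h t) a b by rewrite cintZ// mulN1r.
have cNh : continuous (fun t => -1 * h t) by move=> t; apply: (cvgM (cvg_cst _) (ch t)).
rewrite -(cintD cg cNh a1 b1).
by congr (cint _ a b); apply/funext => t; rewrite mulN1r.
Qed.

Lemma cint_cst k a b : -1 < a -> -1 < b -> cint (fun=> k) a b = k * (b - a)%:C.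
Proof.
move=> a1 b1; transitivity (k * b%:C - k * a%:C); last by rewrite rmorphB /= mulrBr.
apply: (@cintE _ (fun t => k * t%:C)) => //.
- by move=> t; exact: cvg_cst.
- move=> t _; rewrite (_ : (fun _ => _) = (Re k \*: id)); last first.
    by apply/funext => s; case: (k) => x y /=; rewrite mulr0 subr0.
  by apply: is_derive_eq; rewrite [LHS]mulr1.
- move=> t _; rewrite (_ : (fun _ => _) = (Im k \*: id)); last first.
    by apply/funext => s; case: (k) => x y /=; rewrite mulr0 add0r.
  by apply: is_derive_eq; rewrite [LHS]mulr1.
Qed.

Lemma Re_cint_le g M a b : continuous g -> -1 < a -> a <= b ->
  (forall t, a <= t <= b -> Re (g t) <= M) -> Re (cint g a b) <= M * (b - a).
Proof. by move=> /continuous_ReIm[cr _] a1 ab gM; exact: rint_le. Qed.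

Lemma cint_conj g a b : continuous g -> -1 < a -> -1 < b ->
  cint (fun t => conjc (g t)) a b = conjc (cint g a b).
Proof.
move=> /continuous_ReIm[_ ci] a1 b1; rewrite /cint /=; congr (_ +i* _).
  by congr rint; apply/funext => t; case: (g t).
rewrite -mulN1r -rintZ//; congr rint.
by apply/funext => t; case: (g t) => x y /=; rewrite mulN1r.
Qed.

(** Multiplication by the conjugate [u] of the integral turns it into its squared modulus, which is
    real, so the bound for real parts applies with no loss in the constant. *)
Lemma normc_cint_le g M a b : continuous g -> -1 < a -> a <= b ->
  (forall t, a <= t <= b -> normc (g t) <= M) ->
  normc (cint g a b) <= M * (b - a).
Proof.
move=> cg a1 ab gM; have b1 := lt_le_trans a1 ab.
have [->|I0] := eqVneq (cint g a b) 0.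
  rewrite normc0 mulr_ge0 ?subr_ge0//; apply: le_trans (normc_ge0 (g a)) (gM a _).
  by rewrite lexx.
have n0 : 0 < normc (cint g a b) by rewrite normc_gt0.
rewrite -(ler_pM2l n0); set u := conjc (cint g a b).
have -> : normc (cint g a b) * normc (cint g a b) = Re (cint (fun t => u * g t) a b).
  by rewrite cintZ// [u * _]mulrC /u mul_conj expr2.
have cug : continuous (fun t => u * g t) by move=> t; apply: (cvgM (cvg_cst _) (cg t)).
rewrite mulrA; apply: (Re_cint_le cug a1 ab) => t /gM gtM; apply: le_trans (ler_norm _) _; apply: le_trans (abs_Re_le _) _.
by rewrite normcM normc_conj ler_wpM2l// ltW.
Qed.

End ComplexIntegral.

(** * Goursat's theorem *)

Section Goursat.
Context {R : realType}.
Implicit Types (a b c s t x y : R).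

(** Goursat's argument for any additive function of rectangles [[x, x'] x [y, y']]. One of the four
    quarters keeps at least a quarter of the modulus, and the chosen quarters shrink to a point
    [(s, t)]. After [n] steps the factor [4 ^ n] lost is exactly compensated by the squared size in
    the local bound, and the freedom in [e] gives the contradiction. *)
Lemma bisection_eq0 (I : R -> R -> R -> R -> R[i]) a b c d :
  (forall x m x' y y', I x x' y y' = I x m y y' + I m x' y y') ->
  (forall x x' y m y', I x x' y y' = I x x' y m + I x x' m y') ->
  a <= b -> c <= d ->
  (forall s t, a <= s <= b -> c <= t <= d -> forall e, 0 < e ->
    exists2 r, 0 < r & forall x x' y y', a <= x -> x <= s <= x' -> x' <= b ->
      c <= y -> y <= t <= y' -> y' <= d -> x' - x < r -> y' - y < r ->
      normc (I x x' y y') <= e * ((x' - x) + (y' - y)) ^+ 2) ->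
  I a b c d = 0.
Proof.
move=> add1 add2 ab cd loc; apply/eqP; rewrite -normc_eq0; apply/negPn/negP => I0.
set v := normc (I a b c d) in I0.
have v0 : 0 < v by rewrite lt_def I0 normc_ge0.
pose L n := (b - a) / 2 ^+ n; pose M n := (d - c) / 2 ^+ n.
have L0 n : 0 <= L n by rewrite divr_ge0 ?subr_ge0// exprn_ge0.
have M0 n : 0 <= M n by rewrite divr_ge0 ?subr_ge0// exprn_ge0.
have LS n : L n = L n.+1 + L n.+1.
  by rewrite /L exprS; field; rewrite expf_neq0.
have MS n : M n = M n.+1 + M n.+1.
  by rewrite /M exprS; field; rewrite expf_neq0.
pose V n (p : R * R) := normc (I p.1 (p.1 + L n) p.2 (p.2 + M n)).
(* [p] and [q] are lower left corners; the sides at stage [n] are [L n] and [M n]. *)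
have step n p : exists q : R * R,
    [/\ p.1 <= q.1, q.1 + L n.+1 <= p.1 + L n,
        p.2 <= q.2, q.2 + M n.+1 <= p.2 + M n & V n p <= 4 * V n.+1 q].
  case: p => x y; rewrite /V /=.
  set W := fun i j : bool => normc (I (x + L n.+1 *+ i) (x + L n.+1 *+ i + L n.+1)
                                      (y + M n.+1 *+ j) (y + M n.+1 *+ j + M n.+1)).
  have WV : normc (I x (x + L n) y (y + M n)) <= W false false + W false true + (W true false + W true true).
    rewrite LS MS (add1 _ (x + L n.+1)) (add2 _ _ _ (y + M n.+1)).
    rewrite [in X in _ + X](add2 _ _ _ (y + M n.+1)) /W !mulr0n !mulr1n !addr0 !addrA.
    by do 3 (apply: le_trans (normcD_le _ _) _; rewrite ?lerD2r).
  have [i [j Wij]] : exists i j, normc (I x (x + L n) y (y + M n)) <= 4 * W i j.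
    apply/not_existsP => H.
    have {}H i j : W i j < normc (I x (x + L n) y (y + M n)) / 4.
      have := H i => /forallNP /(_ j) /negP; rewrite -ltNge => H'.
      by rewrite ltr_pdivlMr// mulrC.
    have := H false false; have := H false true; have := H true false; have := H true true.
    by move: WV; lra.
  exists (x + L n.+1 *+ i, y + M n.+1 *+ j); split => //=.
  - by rewrite lerDl mulrn_wge0.
  - by rewrite -addrA lerD2l (LS n) lerD2r; case: i {Wij} => /=.
  - by rewrite lerDl mulrn_wge0.
  - by rewrite -addrA lerD2l (MS n) lerD2r; case: j {Wij} => /=.
pose f n := projT1 (choice (step n)); have fP n := projT2 (choice (step n)).
pose u := fix u n := if n is m.+1 then f m (u m) else (a, c).
have uS n : [/\ (u n).1 <= (u n.+1).1, (u n.+1).1 + L n.+1 <= (u n).1 + L n,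
        (u n).2 <= (u n.+1).2, (u n.+1).2 + M n.+1 <= (u n).2 + M n
        & V n (u n) <= 4 * V n.+1 (u n.+1)] by exact: fP.
have Vn n : v <= 4 ^+ n * V n (u n).
  elim: n => [|n IH]; first by rewrite expr0 mul1r /V /= /L /M expr0 !divr1 [a + _]addrC [c + _]addrC !subrK.
  by apply: le_trans IH _; rewrite exprSr -mulrA ler_pM2l ?exprn_gt0//; have [] := uS n.
(* Nested intervals: the supremum of the left endpoints lies in all of them. *)
have nested (p : nat -> R) (l : nat -> R) (p0 l0 : R) : p 0%N = p0 -> p 0%N + l 0%N = l0 ->
    (forall n, 0 <= l n) -> (forall n, p n <= p n.+1) ->
    (forall n, p n.+1 + l n.+1 <= p n + l n) ->
    exists s, forall n, [/\ p0 <= p n, p n <= s, s <= p n + l n & p n + l n <= l0].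
  move=> pp0 pl0 l_0 pS plS.
  have pm n m : p n <= p (n + m)%N.
    by elim: m => [|m IH]; rewrite ?addn0// addnS (le_trans IH).
  have plm n m : p (n + m)%N + l (n + m)%N <= p n + l n.
    by elim: m => [|m IH]; rewrite ?addn0// addnS (le_trans _ IH).
  have H n m : p n <= p m + l m.
    by apply: le_trans (pm n m) _; apply: le_trans (plm m n); rewrite addnC lerDl.
  exists (sup (range p)) => n; split.
  - by rewrite -pp0 -[n]add0n pm.
  - by apply: ub_le_sup; [exists (p 0%N + l 0%N) => _ [k _ <-]|exists n].
  - by apply: ge_sup; [exists (p n), n|move=> _ [k _ <-]].
  - by rewrite -pl0 -[n]add0n plm.
have [|||||s Hs] := nested (fun n => (u n).1) L a b => //.
- by rewrite /= /L expr0 divr1 addrC subrK.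
- by move=> n; have [] := uS n.
- by move=> n; have [] := uS n.
have [|||||t Ht] := nested (fun n => (u n).2) M c d => //.
- by rewrite /= /M expr0 divr1 addrC subrK.
- by move=> n; have [] := uS n.
- by move=> n; have [] := uS n.
have sab : a <= s <= b.
  by have [h1 h2 h3 h4] := Hs 0%N; rewrite (le_trans h1 h2) (le_trans h3 h4).
have tcd : c <= t <= d.
  by have [h1 h2 h3 h4] := Ht 0%N; rewrite (le_trans h1 h2) (le_trans h3 h4).
pose D := (b - a) + (d - c).
have D0 : 0 <= D by rewrite addr_ge0 ?subr_ge0.
(* The [+ 1] makes [v * D ^ 2 / (D ^ 2 + 1) < v] strict and covers the degenerate rectangle
   [D = 0]. *)
have e0 : 0 < v / (D ^+ 2 + 1) by rewrite divr_gt0// ltr_wpDl// sqr_ge0.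
have [r r0 rH] := loc s t sab tcd _ e0.
have [n nr] : exists n, D / 2 ^+ n < r.
  have := @cvg_geometric R D (2^-1); rewrite ger0_norm ?invr_ge0// => /(_ _)/cvgrPdist_lt.
  rewrite invf_lt1// ltr1n => /(_ isT _ r0) [n _ /(_ n (leqnn _))] /=.
  rewrite sub0r normrN => H; exists n; apply: le_lt_trans H.
  by rewrite /geometric /= exprVn ler_norm.
have LD : L n + M n = D / 2 ^+ n by rewrite /L /M -mulrDl.
have Lr : L n < r by apply: le_lt_trans nr; rewrite -LD lerDl.
have Mr : M n < r by apply: le_lt_trans nr; rewrite -LD lerDr.
have [h1 h2 h3 h4] := Hs n; have [k1 k2 k3 k4] := Ht n.
have := rH _ _ _ _ h1 _ h4 k1 _ k4; rewrite h2 h3 k2 k3 => /(_ isT isT).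
rewrite [X in X - _]addrC addrK [X in X - _]addrC addrK => /(_ Lr Mr) Vle.
have := Vn n; rewrite leNgt => /negP; apply.
apply: le_lt_trans (_ : 4 ^+ n * (v / (D ^+ 2 + 1) * (L n + M n) ^+ 2) < _).
  by rewrite ler_pM2l ?exprn_gt0.
have e4 : (4 : R) ^+ n = (2 ^+ n) ^+ 2.
  by rewrite -exprM mulnC exprM; congr (_ ^+ n); ring.
rewrite LD e4.
rewrite (_ : _ * _ = v / (D ^+ 2 + 1) * D ^+ 2); last first.
  by field; rewrite gt_eqF ?ltr_wpDl ?sqr_ge0//= expf_neq0.
by rewrite mulrAC ltr_pdivrMr ?ltr_wpDl ?sqr_ge0// ltr_pM2l// ltrDl.
Qed.

Variables (kap lam : R -> R[i]).
Hypotheses (ckap : continuous kap) (clam : continuous lam).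

(** Separate continuity is what integration along the sides of a rectangle asks for. *)
Definition cont2 (H : R -> R -> R[i]) :=
  (forall s, continuous (H s)) /\ (forall t, continuous (fun s => H s t)).

(* Boundary integral over the rectangle [[a, b] x [c, d]] of the one-form
   [H s t (kap t dt + lam s ds)]. *)
Definition bint (H : R -> R -> R[i]) a b c d :=
  (cint (fun t => H b t * kap t) c d - cint (fun t => H a t * kap t) c d) -
  (cint (fun s => H s d * lam s) a b - cint (fun s => H s c * lam s) a b).

Lemma bint_split1 H x m x' y y' : bint H x x' y y' = bint H x m y y' + bint H m x' y y'.
Proof.
rewrite /bint (cint_split (fun s => H s y' * lam s) x m x').
by rewrite (cint_split (fun s => H s y * lam s) x m x'); ring.
Qed.

Lemma bint_split2 H x x' y m y' : bint H x x' y y' = bint H x x' y m + bint H x x' m y'.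
Proof.
rewrite /bint (cint_split (fun t => H x' t * kap t) y m y').
by rewrite (cint_split (fun t => H x t * kap t) y m y'); ring.
Qed.

Lemma cont2_kap H s : cont2 H -> continuous (fun t => H s t * kap t).
Proof. by move=> [H1 _]; exact: (ccontM (H1 s) ckap). Qed.

Lemma cont2_lam H t : cont2 H -> continuous (fun s => H s t * lam s).
Proof. by move=> [_ H2]; exact: (ccontM (H2 t) clam). Qed.

Lemma bintB F G a b c d : cont2 F -> cont2 G ->
  -1 < a -> -1 < b -> -1 < c -> -1 < d ->
  bint (fun s t => F s t - G s t) a b c d = bint F a b c d - bint G a b c d.
Proof.
move=> cF cG a1 b1 c1 d1; rewrite /bint.
have E1 s : cint (fun t => (F s t - G s t) * kap t) c d =
    cint (fun t => F s t * kap t) c d - cint (fun t => G s t * kap t) c d.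
  rewrite -(cintB (@cont2_kap F s cF) (@cont2_kap G s cG) c1 d1).
  by congr (cint _ _ _); apply/funext => t; rewrite mulrBl.
have E2 t : cint (fun s => (F s t - G s t) * lam s) a b =
    cint (fun s => F s t * lam s) a b - cint (fun s => G s t * lam s) a b.
  rewrite -(cintB (@cont2_lam F t cF) (@cont2_lam G t cG) a1 b1).
  by congr (cint _ _ _); apply/funext => s; rewrite mulrBl.
by rewrite !E1 !E2; ring.
Qed.

Lemma bint_le H a b c d m K L : cont2 H -> -1 < a -> a <= b -> -1 < c -> c <= d ->
  0 <= m -> 
  (forall s t, a <= s <= b -> c <= t <= d -> normc (H s t) <= m) ->
  (forall t, c <= t <= d -> normc (kap t) <= K) ->
  (forall s, a <= s <= b -> normc (lam s) <= L) ->
  normc (bint H a b c d) <= 2 * m * (K * (d - c) + L * (b - a)).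
Proof.
move=> cH a1 ab c1 cd m0 Hm kK lL.
have E1 s : a <= s <= b -> normc (cint (fun t => H s t * kap t) c d) <= m * K * (d - c).
  move=> sab; apply: (normc_cint_le (@cont2_kap H s cH) c1 cd).
  by move=> t tcd; rewrite normcM ler_pM ?normc_ge0 ?Hm ?kK.
have E2 t : c <= t <= d -> normc (cint (fun s => H s t * lam s) a b) <= m * L * (b - a).
  move=> tcd; apply: (normc_cint_le (@cont2_lam H t cH) a1 ab).
  by move=> s sab; rewrite normcM ler_pM ?normc_ge0 ?Hm ?lL.
have := E1 a; have := E1 b; have := E2 c; have := E2 d; rewrite !lexx ab cd.
move=> /(_ isT) h1 /(_ isT) h2 /(_ isT) h3 /(_ isT) h4.
apply: le_trans (normcB_le _ _) _.
apply: le_trans (lerD (le_trans (normcB_le _ _) (lerD h3 h4))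
                      (le_trans (normcB_le _ _) (lerD h1 h2))) _.
by rewrite le_eqVlt; apply/orP; left; apply/eqP; ring.
Qed.

End Goursat.

(** * Cauchy's formula *)

Section Cauchy.
Context {R : realType}.
Implicit Types (s t x y rho : R) (z w : R[i]).

Definition ucirc t : R[i] := cos t +i* sin t.

Let I : R[i] := 0 +i* 1.

Lemma normc_ucirc t : normc (ucirc t) = 1.
Proof. by rewrite /normc /= cos2Dsin2 sqrtr1. Qed.

Lemma continuous_ucirc : continuous ucirc.
Proof. by apply/continuous_ReIm; split; [exact: continuous_cos|exact: continuous_sin]. Qed.

Lemma ucirc_2pi : ucirc (pi *+ 2) = ucirc 0.
Proof. by rewrite /ucirc cos2pi sin2pi cos0 sin0. Qed.

Lemma cint_ucirc x y : -1 < x -> -1 < y ->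
  cint (fun t => I * ucirc t) x y = ucirc y - ucirc x.
Proof.
move=> x1 y1; apply: cintE => //.
- exact: (ccontM (@ccontC _ _) continuous_ucirc).
- move=> t _ /=; rewrite (_ : _ - _ = - sin t); first exact: is_derive_cos.
  by rewrite mul0r mul1r add0r.
- move=> t _ /=; rewrite (_ : _ + _ = cos t); first exact: is_derive_sin.
  by rewrite mul0r mul1r add0r.
Qed.

Lemma normc_I : normc I = 1.
Proof. by rewrite /normc /= expr0n/= expr1n add0r sqrtr1. Qed.

Lemma ucirc_lip x y : -1 < x -> x <= y -> normc (ucirc y - ucirc x) <= y - x.
Proof.
move=> x1 xy; rewrite -cint_ucirc ?(lt_le_trans x1 xy)// -[y - x]mul1r.
apply: (normc_cint_le (ccontM (@ccontC _ _) continuous_ucirc) x1 xy) => t _.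
by rewrite normcM normc_I normc_ucirc mulr1.
Qed.

Variables (rho : R) (f : R[i] -> R[i]) (z : R[i]).
Hypotheses (rho0 : 0 < rho) (df : forall w, normc w <= rho -> derivable f w 1)
  (zrho : normc z < rho).

Let zeta t := rho%:C * ucirc t.

Let normc_zeta t : normc (zeta t) = rho.
Proof. by rewrite normcM normc_ucirc mulr1 normcR gtr0_norm. Qed.

Let zetaz t : rho - normc z <= normc (zeta t - z).
Proof. by rewrite -(normc_zeta t) normcB_ge. Qed.

Let zetaz_le t : normc (zeta t - z) <= 2 * rho.
Proof. by rewrite mulr2n mulrDl mul1r (le_trans (normcB_le _ _))// normc_zeta lerD2l ltW. Qed.

Let zetaz0 t : zeta t - z != 0.
Proof. by rewrite -normc_gt0; apply: lt_le_trans (zetaz t); rewrite subr_gt0. Qed.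

Let continuous_zeta : continuous zeta.
Proof. exact: (ccontM (@ccontC _ _) continuous_ucirc). Qed.

Let kap t := zeta t / (zeta t - z).

Let continuous_kap : continuous kap.
Proof.
exact: (ccontM continuous_zeta (ccontV (ccontB continuous_zeta (@ccontC _ _)) zetaz0)).
Qed.

Let K := rho / (rho - normc z).

Let normc_kap t : normc (kap t) <= K.
Proof.
have h : 0 < rho - normc z by rewrite subr_gt0.
rewrite normcM normcV normc_zeta ler_pM2l// lef_pV2 ?posrE//.
exact: lt_le_trans (zetaz t).
Qed.

(** Homothety of the circle towards [z]. Under [w = W s t] the form [dw / (w - z)] becomes
    [I * kap t dt + s^-1 ds], each coefficient depending on one variable only; this is the shape
    integrated by [bint]. *)
Let W s t := z + s%:C * (zeta t - z).

Let normc_W s t : 0 <= s <= 1 -> normc (W s t) <= rho.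
Proof.
move=> /andP[s0 s1]; have -> : W s t = (1 - s)%:C * z + s%:C * zeta t.
  by rewrite /W rmorphB rmorph1 /=; ring.
apply: le_trans (normcD_le _ _) _; rewrite normcM (normcM _ (zeta t)) !normcR normc_zeta.
rewrite !ger0_norm ?subr_ge0//.
apply: le_trans (_ : (1 - s) * rho + s * rho <= _).
  by rewrite lerD2r ler_wpM2l ?subr_ge0// ltW.
by rewrite -mulrDl subrK mul1r.
Qed.

Let ltN1 (u : R) : 0 <= u -> -1 < u.
Proof. by apply: lt_le_trans; rewrite ltrN10. Qed.

Section Annulus.
Variable e : R.
Hypotheses (e0 : 0 < e) (e1 : e <= 1).

(** Clamping [s] to [[e, 1]] makes the integrands continuous on the whole line, as the integrals
    require, keeps [W (c s) t] in the closed disc and [c s] away from [0]. *)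
Let c s := Num.max e (Num.min 1 s).

Let c01 s : 0 <= c s <= 1.
Proof. by rewrite le_max (ltW e0)/= ge_max e1 ge_min lexx. Qed.

Let c_gt0 s : 0 < c s.
Proof. by rewrite lt_max e0. Qed.

Let c_id s : e <= s <= 1 -> c s = s.
Proof. by move=> /andP[es s1]; rewrite /c min_r// max_r. Qed.

Let continuous_c : continuous c.
Proof.
move=> s; apply: (@continuous_max _ _ (cst e) (fun s => Num.min 1 s)).
  exact: cvg_cst.
by apply: (@continuous_min _ _ (cst 1) id); [exact: cvg_cst|exact: cvg_id].
Qed.

Let H s t := f (W (c s) t).

Let continuous_W1 s : continuous (W s).
Proof. exact: (ccontD (@ccontC _ _) (ccontM (@ccontC _ _) (ccontB continuous_zeta (@ccontC _ _)))). Qed.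

Let continuous_W2 t : continuous (fun s => W (c s) t).
Proof. exact: (ccontD (@ccontC _ _) (ccontM (ccontR continuous_c) (@ccontC _ _))). Qed.

Let cont2_H : cont2 H.
Proof.
split=> [s|t].
- apply: (@ccont_comp _ f (W (c s)) (@continuous_W1 (c s))) => t.
  by apply: is_derive_continuous; apply: derivable_is; apply: df; exact: normc_W.
- apply: (@ccont_comp _ f (fun s => W (c s) t) (@continuous_W2 t)) => s.
  by apply: is_derive_continuous; apply: derivable_is; apply: df; exact: normc_W.
Qed.

Let lam s : R[i] := (c s)^-1%:C.

Let continuous_lam : continuous lam.
Proof.
apply: ccontR => s; apply: (@cvgV _ _ (nbhs s)); last exact: continuous_c.
by rewrite gt_eqF.
Qed.

Let ikap t := I * kap t.

Let continuous_ikap : continuous ikap.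
Proof. exact: (ccontM (@ccontC _ _) continuous_kap). Qed.

Let affine (A B w0 : R[i]) s t := A + B * (W (c s) t - w0).

Let cont2_affine A B w0 : cont2 (affine A B w0).
Proof.
split=> [s|t].
  exact: (ccontD (@ccontC _ _) (ccontM (@ccontC _ _) (ccontB (@continuous_W1 (c s)) (@ccontC _ _)))).
exact: (ccontD (@ccontC _ _) (ccontM (@ccontC _ _) (ccontB (@continuous_W2 t) (@ccontC _ _)))).
Qed.

(** Only differences between opposite sides enter: [A] cancels, the factors [zeta t - z] and [s]
    cancel the denominators of [kap] and [lam], and both pairs of sides yield
    [B * (x' - x) * (zeta y' - zeta y)]. *)
Let bint_affine A B w0 x x' y y' : e <= x -> x <= x' -> x' <= 1 -> 0 <= y -> y <= y' ->
  bint ikap lam (affine A B w0) x x' y y' = 0.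
Proof.
move=> ex xx x1 y0 yy.
have y1 := ltN1 y0; have y'1 := ltN1 (le_trans y0 yy).
have X1 := ltN1 (le_trans (ltW e0) ex).
have X'1 := ltN1 (le_trans (le_trans (ltW e0) ex) xx).
have cA := cont2_affine A B w0.
have cx : c x = x by rewrite c_id// ex (le_trans xx).
have cx' : c x' = x' by rewrite c_id// x1 (le_trans ex).
rewrite /bint -(cintB (@cont2_kap _ _ continuous_ikap _ x' cA) (@cont2_kap _ _ continuous_ikap _ x cA) y1 y'1).
rewrite -(cintB (@cont2_lam _ _ continuous_lam _ y' cA) (@cont2_lam _ _ continuous_lam _ y cA) X1 X'1).
rewrite (_ : (fun t => _ - _) = (fun t => (B * (x' - x)%:C * rho%:C) * (I * ucirc t))); last first.
  apply/funext => t; rewrite /affine cx cx' /ikap /kap /W rmorphB /=.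
  transitivity (B * (x'%:C - x%:C) * I * zeta t); last by rewrite /zeta; ring.
  by field; exact: zetaz0.
rewrite (_ : (fun s => _ - _) = (fun s => B * (zeta y' - zeta y))); last first.
  apply/funext => s; rewrite /affine /lam /W.
  rewrite (_ : (c s)^-1%:C = ((c s)%:C)^-1); last by rewrite fmorphV.
  field; apply/negP => /eqP /complexI /eqP; apply/negP; exact: lt0r_neq0.
rewrite (cintZ _ (ccontM (@ccontC _ _) continuous_ucirc) y1 y'1) cint_ucirc//.
by rewrite cint_cst// /zeta; ring.
Qed.

Let W_lip s t s' t' : 0 <= s <= 1 -> -1 < t -> -1 < t' ->
  normc (W s' t' - W s t) <= 2 * rho * (`|s' - s| + `|t' - t|).
Proof.
move=> /andP[s0 s1] t1 t'1.
rewrite /W (_ : _ - _ = (s' - s)%:C * (zeta t' - z) + s%:C * rho%:C * (ucirc t' - ucirc t)); last first.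
  by rewrite rmorphB /= /zeta; ring.
apply: le_trans (normcD_le _ _) _; rewrite !normcM !normcR mulrDr lerD//.
  by rewrite mulrC ler_wpM2r.
have h : normc (ucirc t' - ucirc t) <= `|t' - t|.
  have [tt|/ltW tt] := leP t t'.
    by rewrite ger0_norm ?subr_ge0//; exact: ucirc_lip.
  by rewrite normcBC distrC ger0_norm ?subr_ge0//; exact: ucirc_lip.
rewrite (ger0_norm s0) (gtr0_norm rho0) ler_pM ?normc_ge0 ?mulr_ge0 ?(ltW rho0)//.
by rewrite ler_pM2r// (le_trans s1)// ler1n.
Qed.

(** Bisection applies to the rectangle [[e, 1] x [0, 2 pi]]: near each point [f] is affine up to a
    small multiple of the distance, and the affine part integrates to [0]. The sides [t = 0] and
    [t = 2 pi] cancel by periodicity, which leaves the equality of the other two. *)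
Lemma cauchy_annulus :
  cint (fun t => f (W 1 t) * ikap t) 0 (pi *+ 2) = cint (fun t => f (W e t) * ikap t) 0 (pi *+ 2).
Proof.
have c1 : c 1 = 1 by rewrite c_id// e1 lexx.
have ce : c e = e by rewrite c_id// e1 lexx.
have : bint ikap lam H e 1 0 (pi *+ 2) = 0.
  apply: bisection_eq0 => //.
  - by move=> x m x' y y'; exact: bint_split1.
  - by move=> x x' y m y'; exact: bint_split2.
  - by rewrite mulrn_wge0// pi_ge0.
  move=> s t /andP[es s1] /andP[t0 t2] d d0.
    have s01 : 0 <= s <= 1 by rewrite s1 (le_trans (ltW e0) es).
  pose w0 := W s t; pose B := derive1 f w0.
  (* Chosen so that an approximation error of [d / C] per unit distance gives exactly [d * D ^ 2]
     through [bint_le]. *)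
  pose C := 2 * (2 * rho) * (K + e^-1).
  have K0 : 0 < K by rewrite divr_gt0// subr_gt0.
  have C0 : 0 < C by rewrite !mulr_gt0// addr_gt0// invr_gt0.
  have := df (normc_W t s01) => /derivable_is /cderivP /(_ _ (divr_gt0 d0 C0))[r r0 rH].
  (* [W] is Lipschitz with constant [2 * rho] in the sum of the two increments, so its image of the
     rectangle stays within [r] of [w0]. *)
  exists (r / (4 * rho)); first by rewrite divr_gt0// mulr_gt0.
  move=> x x' y y' ex /andP[xs sx'] x'1 y0 /andP[yt ty'] y'2 xr yr.
  pose D := (x' - x) + (y' - y).
  have D0 : 0 <= D by rewrite addr_ge0// subr_ge0 ?(le_trans xs)// (le_trans yt).
  have Dr : 2 * rho * D < r.
    rewrite -ltr_pdivlMl ?mulr_gt0// /D (_ : _^-1 * r = r / (4 * rho) + r / (4 * rho)) ?ltrD//.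
    by field; rewrite gt_eqF.
  have cA := cont2_affine (f w0) B w0.
  have xx : x <= x' by exact: le_trans sx'.
  have yy : y <= y' by exact: le_trans ty'.
  have y1 := ltN1 y0; have y'1 := ltN1 (le_trans y0 yy).
  have X1 := ltN1 (le_trans (ltW e0) ex).
  have X'1 := ltN1 (le_trans (le_trans (ltW e0) ex) xx).
  have -> : bint ikap lam H x x' y y' =
      bint ikap lam (fun s t => H s t - affine (f w0) B w0 s t) x x' y y'.
    by rewrite (bintB continuous_ikap continuous_lam cont2_H cA)// bint_affine// subr0.
  have cD : cont2 (fun s t => H s t - affine (f w0) B w0 s t).
    by split=> u; [exact: (ccontB (cont2_H.1 u) (cA.1 u))|exact: (ccontB (cont2_H.2 u) (cA.2 u))].
  have m0 : 0 <= d / C * (2 * rho * D) by rewrite !mulr_ge0// ?invr_ge0// ltW.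
  apply: le_trans (bint_le (K := K) (L := e^-1) continuous_ikap continuous_lam cD X1 xx y1 yy m0 _ _ _) _.
  - move=> u v /andP[xu ux'] /andP[yv vy']; rewrite /H /affine.
    have -> : c u = u by rewrite c_id// (le_trans ex xu) (le_trans ux').
    have Wle : normc (W u v - w0) <= 2 * rho * D.
      apply: le_trans (W_lip _ s01 (ltN1 t0) (ltN1 (le_trans y0 yv))) _.
      rewrite ler_pM2l ?mulr_gt0// lerD// ler_distlC.
        by apply/andP; split; lra.
      by apply/andP; split; lra.
    have := rH (W u v - w0) (le_lt_trans Wle Dr).
    rewrite [W s t + _]addrC subrK -/w0 -/B => hh.
    have -> : f (W u v) - (f w0 + B * (W u v - w0)) = f (W u v) - f w0 - B * (W u v - w0).
      by rewrite opprD addrA.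
    by apply: le_trans hh _; rewrite ler_wpM2l// ltW// divr_gt0.
  - by move=> v _; rewrite normcM normc_I mul1r.
  - move=> u /andP[xu ux']; rewrite /lam normcR c_id ?(le_trans ex xu) ?(le_trans ux')//.
    rewrite ger0_norm ?invr_ge0 ?(le_trans (ltW e0) (le_trans ex xu))//.
    by rewrite lef_pV2 ?posrE ?(le_trans ex xu)// (lt_le_trans e0 (le_trans ex xu)).
  rewrite -/D.
  have KD : K * (y' - y) + e^-1 * (x' - x) <= (K + e^-1) * D.
    rewrite -subr_ge0 /D (_ : _ - _ = K * (x' - x) + e^-1 * (y' - y)); last by ring.
    by rewrite addr_ge0// mulr_ge0 ?subr_ge0// ?invr_ge0 ltW.
  apply: le_trans (ler_wpM2l (mulr_ge0 (ler0n _ 2) m0) KD) _.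
  rewrite le_eqVlt; apply/orP; left; apply/eqP.
  have S0 : K + e^-1 != 0 by rewrite gt_eqF// addr_gt0// invr_gt0.
  by rewrite /C; move: (K + e^-1) S0 => S S0; field; rewrite S0 gt_eqF.
rewrite /bint /H ce c1 => /eqP; rewrite subr_eq0 => /eqP.
rewrite /W {3}/zeta ucirc_2pi subrr => /eqP; rewrite subr_eq0 => /eqP.
exact.
Qed.

End Annulus.
Let two_pi_ge0 : 0 <= pi *+ 2 :> R.
Proof. by rewrite mulrn_wge0// pi_ge0. Qed.

Let W1 t : W 1 t = zeta t.
Proof. by rewrite /W rmorph1 mul1r addrC subrK. Qed.

Let fW_cont e : 0 <= e <= 1 -> continuous (fun t => f (W e t)).
Proof.
move=> e01; apply: (@ccont_comp _ f (W e)).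
  exact: (ccontD (@ccontC _ _) (ccontM (@ccontC _ _) (ccontB continuous_zeta (@ccontC _ _)))).
by move=> t; apply: is_derive_continuous; apply: derivable_is; apply: df; exact: normc_W.
Qed.

(** In [cauchy_annulus] let [e] tend to [0]: [f (W e t)] tends to [f z] uniformly in [t]. The
    integral of the kernel is left as it is; [cavg_kernel] evaluates it. *)
Lemma cauchy_kernel :
  cint (fun t => f (rho%:C * ucirc t) * (rho%:C * ucirc t / (rho%:C * ucirc t - z))) 0 (pi *+ 2)
  = f z * cint (fun t => rho%:C * ucirc t / (rho%:C * ucirc t - z)) 0 (pi *+ 2).
Proof.
rewrite -/zeta -/kap; set A := cint _ _ _; set k := cint _ _ _.
have pi1 := ltN1 two_pi_ge0; have N1 := ltN1 (lexx 0).
have cI e : 0 <= e <= 1 -> continuous (fun t => f (W e t) * kap t).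
  by move=> e01; exact: (ccontM (@fW_cont e e01) continuous_kap).
have annulus e : 0 < e -> e <= 1 -> A = cint (fun t => f (W e t) * kap t) 0 (pi *+ 2).
  move=> e0 e1; have e01 : 0 <= e <= 1 by rewrite e1 ltW.
  have I0 : I != 0 by rewrite -normc_eq0 normc_I oner_eq0.
  have E u : 0 <= u <= 1 -> cint (fun t => f (W u t) * (I * kap t)) 0 (pi *+ 2) =
      I * cint (fun t => f (W u t) * kap t) 0 (pi *+ 2).
    move=> u01; rewrite -(cintZ I (cI u u01) N1 pi1).
    by congr (cint _ _ _); apply/funext => t; rewrite mulrCA.
  have := cauchy_annulus e0 e1; rewrite !E ?ler01 ?lexx// => /(mulfI I0) <-.
  by congr (cint _ _ _); apply/funext => t; rewrite W1.
have K0 : 0 < K by rewrite divr_gt0// subr_gt0.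
apply/eqP; rewrite -subr_eq0 -normc_eq0 eq_le normc_ge0 andbT.
apply/ler_addgt0Pl => /= d d0; rewrite addr0.
have d'0 : 0 < d / (K * (pi *+ 2) + 1).
  by rewrite divr_gt0// ltr_wpDl// mulr_ge0// ltW.
have fz : {for z, continuous f}.
  by apply: is_derive_continuous; apply: derivable_is; apply: df; exact: ltW.
have /nbhs_normcP[r r0 rH] : nbhs z [set w | normc (f w - f z) < d / (K * (pi *+ 2) + 1)].
  by move/continuous_normcP : fz => /(_ _ d'0).
(* As [normc (zeta t - z) <= 2 * rho], the point [W e t] lies within [r / 2] of [z]. *)
pose e := Num.min 1 (r / (4 * rho)).
have e0 : 0 < e by rewrite lt_min ltr01 divr_gt0// mulr_gt0.
have e1 : e <= 1 by rewrite ge_min lexx.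
have e01 : 0 <= e <= 1 by rewrite e1 ltW.
rewrite (annulus e e0 e1) /k -(cintZ (f z) continuous_kap N1 pi1).
rewrite -(cintB (cI e e01) (ccontM (@ccontC _ (f z)) continuous_kap) N1 pi1).
apply: le_trans (normc_cint_le (M := d / (K * (pi *+ 2) + 1) * K)
  (ccontB (cI e e01) (ccontM (@ccontC _ (f z)) continuous_kap)) N1 two_pi_ge0 _) _.
  move=> t _; rewrite -mulrBl normcM ler_pM ?normc_ge0//; apply: ltW; apply: rH.
  rewrite /W [z + _]addrC addrK normcM normcR (gtr0_norm e0).
  apply: le_lt_trans (ler_wpM2l (ltW e0) (zetaz_le t)) _.
  apply: le_lt_trans (_ : r / (4 * rho) * (2 * rho) < _).
    by rewrite ler_wpM2r ?mulr_ge0 ?(ltW rho0)// ge_min lexx orbT.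
  by rewrite (_ : _ * _ = r / 2); [lra|field; rewrite gt_eqF].
rewrite subr0 -mulrA mulrAC ler_pdivrMr ?ler_pM2l ?lerDl//.
by rewrite ltr_wpDl// mulr_ge0// ltW.
Qed.

End Cauchy.

(** * Means over circles and Cauchy's integral formula *)

Section CauchyFormula.
Context {R : realType}.
Implicit Types (s t x y rho M : R) (z w : R[i]) (g h : R -> R[i]) (f : R[i] -> R[i]).

Let two_pi_ge0 : 0 <= pi *+ 2 :> R.
Proof. by rewrite mulrn_wge0// pi_ge0. Qed.

Let two_pi_gt0 : 0 < pi *+ 2 :> R.
Proof. by rewrite mulrn_wgt0// pi_gt0. Qed.

Let N1 : -1 < 0 :> R. Proof. by rewrite ltrN10. Qed.

Let pi1 : -1 < pi *+ 2 :> R. Proof. exact: lt_le_trans two_pi_ge0. Qed.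

Definition cavg g : R[i] := (pi *+ 2)^-1%:C * cint g 0 (pi *+ 2).

Lemma cavgD g h : continuous g -> continuous h ->
  cavg (fun t => g t + h t) = cavg g + cavg h.
Proof. by move=> cg ch; rewrite /cavg (cintD cg ch N1 pi1) mulrDr. Qed.

Lemma cavgB g h : continuous g -> continuous h ->
  cavg (fun t => g t - h t) = cavg g - cavg h.
Proof. by move=> cg ch; rewrite /cavg (cintB cg ch N1 pi1) mulrBr. Qed.

Lemma cavgZ (k : R[i]) g : continuous g -> cavg (fun t => k * g t) = k * cavg g.
Proof. by move=> cg; rewrite /cavg (cintZ k cg N1 pi1) mulrCA. Qed.

Lemma cavg_cst (k : R[i]) : cavg (fun=> k) = k.
Proof.
rewrite /cavg (cint_cst k N1 pi1) subr0 mulrCA -rmorphM /= mulVf ?mulr1//.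
by rewrite gt_eqF.
Qed.

Lemma normc_cavg_le g M : continuous g ->
  (forall t, 0 <= t <= pi *+ 2 -> normc (g t) <= M) ->
  normc (cavg g) <= M.
Proof.
move=> cg gM; rewrite /cavg normcM normcR ger0_norm ?invr_ge0// mulrC.
rewrite ler_pdivrMr//; apply: le_trans (normc_cint_le (M := M) cg N1 two_pi_ge0 _) _ => //.
by rewrite subr0.
Qed.

Lemma Re_cavg_le g M : continuous g ->
  (forall t, 0 <= t <= pi *+ 2 -> Re (g t) <= M) -> Re (cavg g) <= M.
Proof.
move=> cg gM; rewrite /cavg (_ : Re _ = (pi *+ 2)^-1 * Re (cint g 0 (pi *+ 2))); last first.
  by case: (cint g 0 _) => a b /=; rewrite mul0r subr0.
rewrite mulrC ler_pdivrMr//; apply: le_trans (Re_cint_le (M := M) cg N1 two_pi_ge0 _) _ => //.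
by rewrite subr0.
Qed.

Definition circ rho t : R[i] := rho%:C * ucirc t.

Lemma continuous_circ rho : continuous (circ rho).
Proof. exact: (ccontM (@ccontC _ _) (@continuous_ucirc R)). Qed.

Lemma normc_circ rho t : 0 <= rho -> normc (circ rho t) = rho.
Proof. by move=> r0; rewrite normcM normc_ucirc mulr1 normcR ger0_norm. Qed.

Lemma circ_neq0 rho t : 0 < rho -> circ rho t != 0.
Proof. by move=> r0; rewrite -normc_gt0 normc_circ// ltW. Qed.

Lemma circB_ge rho z t : 0 <= rho -> rho - normc z <= normc (circ rho t - z).
Proof. by move=> r0; rewrite -{1}(normc_circ t r0) normcB_ge. Qed.

Lemma circB_neq0 rho z t : normc z < rho -> circ rho t - z != 0.
Proof.
move=> zr; rewrite -normc_gt0; apply: lt_le_trans (circB_ge _ _ _).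
  by rewrite subr_gt0.
by rewrite ltW// (le_lt_trans (normc_ge0 z)).
Qed.

(** On the circle the conjugate of [zeta] is [rho ^ 2 / zeta], so the conjugate of the kernel equals
    [g zeta], where [g] is holomorphic on the closed disc and [g 0 = 1]. Then [cauchy_kernel] for
    [g] at the centre, where its own kernel is the constant [1], gives the value. *)
Lemma cavg_kernel rho z : normc z < rho -> cavg (fun t => circ rho t / (circ rho t - z)) = 1.
Proof.
move=> zr; have r0 : 0 < rho by exact: le_lt_trans (normc_ge0 z) zr.
have rC : rho%:C != 0 :> R[i] by apply/eqP => /complexI /eqP; rewrite gt_eqF.
pose g w := rho%:C ^+ 2 / (rho%:C ^+ 2 - conjc z * w).
have g0 w : normc w <= rho -> rho%:C ^+ 2 - conjc z * w != 0.
  move=> wr; rewrite -normc_gt0; apply: lt_le_trans (normcB_ge _ _).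
  rewrite subr_gt0 normcM normc_conj normcX normcR ger0_norm ?(ltW r0)//.
  apply: le_lt_trans (ler_wpM2l (normc_ge0 z) wr) _.
  by rewrite expr2 ltr_pM2r.
have dg w : normc w <= rho -> derivable g w 1.
  move=> wr; apply: (@derivableM _ _ (cst (rho%:C ^+ 2)) (fun w => (rho%:C ^+ 2 - conjc z * w)^-1)).
    exact: derivable_cst.
  apply: (@derivableV _ _ (fun w => rho%:C ^+ 2 - conjc z * w)); first exact: g0.
  apply: (@derivableB _ _ _ (cst (rho%:C ^+ 2)) (fun w => conjc z * w)); first exact: derivable_cst.
  by apply: (@derivableM _ _ (cst (conjc z)) id); [exact: derivable_cst|exact: derivable_id].
have ck : continuous (fun t => circ rho t / (circ rho t - z)).
  apply: (ccontM (@continuous_circ rho)); apply: ccontV => [|t]; last exact: circB_neq0.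
  exact: (ccontB (@continuous_circ rho) (@ccontC _ z)).
have z0r : normc (0 : R[i]) < rho by rewrite normc0.
have := cauchy_kernel r0 dg z0r.
have E1 t : rho%:C * ucirc t / (rho%:C * ucirc t - 0) = 1.
  by rewrite subr0 divff// circ_neq0.
rewrite (_ : (fun t => g _ * _) = (fun t => conjc (circ rho t / (circ rho t - z)))); last first.
  apply/funext => t; rewrite E1 mulr1 -/(circ rho t) /g.
  have conj_quot (a b : R[i]) : conjc (a / (a - b)) = conjc a / (conjc a - conjc b).
    by rewrite rmorphM fmorphV rmorphB.
  rewrite conj_quot.
  have E : conjc (circ rho t) = rho%:C ^+ 2 / circ rho t.
    apply: (mulfI (circ_neq0 t r0)); rewrite mul_conj normc_circ ?(ltW r0)//.
    by rewrite mulrCA divff ?circ_neq0// mulr1 rmorphXn.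
  have cn0 := circ_neq0 t r0.
  have -> : conjc (circ rho t) - conjc z = (rho%:C ^+ 2 - conjc z * circ rho t) / circ rho t.
    by rewrite E mulrBl mulfK.
  by rewrite E invf_div [RHS]mulrA divfK.
rewrite (_ : (fun t => _ * _ / _) = fun=> 1); last by apply/funext => t; rewrite E1.
have g01 : g 0 = 1 by rewrite /g mulr0 subr0 divff// expf_neq0.
rewrite (cint_conj ck N1 pi1) (cint_cst _ N1 pi1) subr0 g01 !mul1r.
move=> /(congr1 conjc); rewrite conjcK conjc_real /cavg => ->.
by rewrite -rmorphM /= mulVf// gt_eqF.
Qed.

Theorem cauchy_formula rho f z : 0 < rho ->
  (forall w, normc w <= rho -> derivable f w 1) -> normc z < rho ->
  f z = cavg (fun t => f (circ rho t) * (circ rho t / (circ rho t - z))).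
Proof.
move=> r0 df zr; rewrite /cavg (cauchy_kernel r0 df zr) mulrCA.
by have := cavg_kernel zr; rewrite /cavg => ->; rewrite mulr1.
Qed.

End CauchyFormula.

(** * Rules of complex differentiation *)

Section ComplexDerivative.
Context {R : realType}.
Implicit Types (z k a b : R[i]) (f g : R[i] -> R[i]).

Lemma is_cderivD f g z a b : is_derive z 1 f a -> is_derive z 1 g b ->
  is_derive z 1 (fun w => f w + g w) (a + b).
Proof. by move=> df dg; exact: is_deriveD. Qed.

Lemma is_cderivB f g z a b : is_derive z 1 f a -> is_derive z 1 g b ->
  is_derive z 1 (fun w => f w - g w) (a - b).
Proof. by move=> df dg; exact: is_deriveB. Qed.

Lemma is_cderivM f g z a b : is_derive z 1 f a -> is_derive z 1 g b ->
  is_derive z 1 (fun w => f w * g w) (a * g z + f z * b).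
Proof.
move=> df dg; rewrite (_ : a * g z + f z * b = f z *: b + g z *: a).
  exact: is_deriveM.
by rewrite /GRing.scale/= addrC [a * _]mulrC.
Qed.

Lemma is_cderiv_cst k z : is_derive z 1 (fun=> k) 0.
Proof. exact: is_derive_cst. Qed.

Lemma is_cderiv_id z : is_derive z 1 (fun w => w) 1.
Proof. exact: is_derive_id. Qed.

Lemma is_cderivZ k f z a : is_derive z 1 f a -> is_derive z 1 (fun w => k * f w) (k * a).
Proof.
by move=> df; have := is_cderivM (is_cderiv_cst k z) df; rewrite mul0r add0r.
Qed.

Lemma is_cderivX n z : is_derive z 1 (fun w => w ^+ n.+1) (n.+1%:R * z ^+ n).
Proof.
elim: n => [|n IH]; first by rewrite expr0 mulr1; exact: is_cderiv_id.
have -> : (fun w => w ^+ n.+2) = (fun w => w * w ^+ n.+1) :> (R[i] -> R[i]).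
  by apply/funext => w; rewrite exprS.
have -> : n.+2%:R * z ^+ n.+1 = 1 * z ^+ n.+1 + z * (n.+1%:R * z ^+ n).
  by rewrite [n.+2%:R]mulrSr mulrDl addrC exprS; ring.
exact: (is_cderivM (is_cderiv_id z) IH).
Qed.

End ComplexDerivative.

(** * Power series *)

Section Taylor.
Context {R : realType}.
Implicit Types (s t x y rho M : R) (z w : R[i]) (g h : R -> R[i]) (f : R[i] -> R[i]).

Lemma continuous_bounded_0_2pi g : continuous g ->
  exists2 M, 0 < M & forall t, 0 <= t <= pi *+ 2 -> normc (g t) <= M.
Proof.
move=> cg; have cn : continuous (fun t => normc (g t)).
  move=> t; apply/cvgrPdist_lt => e e0; move: (cg t) => /continuous_normcP /(_ e e0).
  apply: filterS => s; apply: le_lt_trans; rewrite distrC ler_distlC.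
  have := normcB_ge (g s) (g t); have := normcB_ge (g t) (g s); rewrite normcBC => h1 h2.
  by apply/andP; split; lra.
have pi0 : 0 <= pi *+ 2 :> R by rewrite mulrn_wge0// pi_ge0.
have [c _ Hc] := EVT_max pi0 (continuous_subspaceT cn).
exists (normc (g c) + 1); first by rewrite ltr_wpDl ?normc_ge0.
by move=> t t2; apply: le_trans (Hc t _) _; rewrite ?in_itv//= lerDl.
Qed.

Lemma continuous_cker rho z : normc z < rho ->
  continuous (fun t => circ rho t / (circ rho t - z)).
Proof.
move=> zr; apply: (ccontM (@continuous_circ _ rho)); apply: ccontV => [|t].
  exact: (ccontB (@continuous_circ _ rho) (@ccontC _ z)).
exact: circB_neq0.
Qed.

Variables (rho : R) (rho0 : 0 < rho).

(** Cauchy transform of arbitrary data [g] on the circle, not only boundary values of a holomorphic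
    function: the same estimates then serve the remainders of the Taylor expansion. *)
Definition ctrans g z := cavg (fun t => g t * (circ rho t / (circ rho t - z))).

Definition ctrans' g z :=
  cavg (fun t => g t * (circ rho t / (circ rho t - z) / (circ rho t - z))).

Let continuous_g_ker g z : normc z < rho -> continuous g ->
  continuous (fun t => g t * (circ rho t / (circ rho t - z))).
Proof. by move=> zr cg; exact: (ccontM cg (continuous_cker zr)). Qed.

Let continuous_ker' z : normc z < rho ->
  continuous (fun t => circ rho t / (circ rho t - z) / (circ rho t - z)).
Proof.
move=> zr; apply: (ccontM (continuous_cker zr)); apply: ccontV => [|t].
  exact: (ccontB (@continuous_circ _ rho) (@ccontC _ z)).
exact: circB_neq0.
Qed.

Let circBV z t : normc z < rho -> normc (circ rho t - z)^-1 <= (rho - normc z)^-1.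
Proof.
move=> zr; rewrite normcV lef_pV2 ?posrE ?subr_gt0//; first exact: circB_ge (ltW _).
by rewrite normc_gt0 circB_neq0.
Qed.

Lemma normc_ctrans_le g M z : continuous g -> 
  (forall t, 0 <= t <= pi *+ 2 -> normc (g t) <= M) -> normc z < rho ->
  normc (ctrans g z) <= M * (rho / (rho - normc z)).
Proof.
move=> cg gM zr; apply: (normc_cavg_le (continuous_g_ker zr cg)) => t t2.
rewrite normcM ler_pM ?normc_ge0 ?gM// normcM normc_circ ?(ltW rho0)//.
by rewrite ler_pM2l// circBV.
Qed.

Lemma normc_ctrans'_le g M z : continuous g -> 
  (forall t, 0 <= t <= pi *+ 2 -> normc (g t) <= M) -> normc z < rho ->
  normc (ctrans' g z) <= M * (rho / (rho - normc z) / (rho - normc z)).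
Proof.
move=> cg gM zr; apply: (normc_cavg_le (ccontM cg (continuous_ker' zr))) => t t2.
rewrite normcM ler_pM ?normc_ge0 ?gM// normcM ler_pM ?normc_ge0 ?circBV//.
rewrite normcM normc_circ ?(ltW rho0)//.
by rewrite ler_pM2l// circBV.
Qed.

(** Differentiation under the integral: the first-order remainder of the integrand is [g * zeta * h
    ^ 2 / ((zeta - z - h) * (zeta - z) ^ 2)], of order [h ^ 2] uniformly on the circle. *)
Lemma is_derive_ctrans g M z : continuous g -> (forall t, 0 <= t <= pi *+ 2 -> normc (g t) <= M) ->
  normc z < rho -> is_derive z 1 (ctrans g) (ctrans' g z).
Proof.
move=> cg gM zr; apply/cderivP => e e0.
have M0 : 0 <= M.
  apply: le_trans (normc_ge0 (g 0)) (gM 0 _).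
  by rewrite lexx mulrn_wge0// pi_ge0.
pose d := rho - normc z; have d0 : 0 < d by rewrite subr_gt0.
(* For [normc h < d / 2] the point [z + h] keeps distance [d / 2] from the circle, whence [2 / d];
   the [+ 1] keeps [C] positive when [M = 0]. *)
pose C := M * rho * (2 / d) * d^-1 * d^-1 + 1.
have C0 : 0 < C by rewrite ltr_wpDl// !mulr_ge0 ?invr_ge0// ltW.
exists (Num.min (d / 2) (e / C)); first by rewrite lt_min !divr_gt0.
move=> h; rewrite lt_min => /andP[hd he].
have zh : normc (z + h) <= normc z + d / 2 by rewrite (le_trans (normcD_le _ _))// lerD2l ltW.
have zhr : normc (z + h) < rho by apply: le_lt_trans zh _; rewrite /d; lra.
rewrite /ctrans /ctrans' -(cavgB (continuous_g_ker zhr cg) (continuous_g_ker zr cg)).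
rewrite mulrC -(cavgZ h (ccontM cg (continuous_ker' zr))).
rewrite -(cavgB (ccontB (continuous_g_ker zhr cg) (continuous_g_ker zr cg))
  (ccontM (@ccontC _ h) (ccontM cg (continuous_ker' zr)))).
have E t : g t * (circ rho t / (circ rho t - (z + h))) - g t * (circ rho t / (circ rho t - z)) -
    h * (g t * (circ rho t / (circ rho t - z) / (circ rho t - z))) =
    g t * circ rho t * (circ rho t - (z + h))^-1 * (circ rho t - z)^-1 * (circ rho t - z)^-1 * h ^+ 2.
  have := circB_neq0 t zr; have := circB_neq0 t zhr.
  by move: (circ rho t) (g t) => c k n1 n2; field; rewrite n1 n2.
apply: le_trans (normc_cavg_le (M := (M * rho * (2 / d) * d^-1 * d^-1) * normc h ^+ 2) _ _) _.
- exact: (ccontB (ccontB (continuous_g_ker zhr cg) (continuous_g_ker zr cg))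
    (ccontM (@ccontC _ h) (ccontM cg (continuous_ker' zr)))).
- move=> t t2; rewrite E; move: (gM t t2) => gMt.
  rewrite normcM normcX ler_wpM2r ?exprn_ge0 ?normc_ge0//.
  have h2 : normc (circ rho t - (z + h))^-1 <= 2 / d.
    apply: le_trans (circBV t zhr) _; rewrite -[2 / d]invrK lef_pV2 ?posrE ?subr_gt0// ?invr_gt0 ?divr_gt0//.
    by rewrite invf_div; move: zh; rewrite /d; lra.
  do 3 (rewrite normcM ler_pM ?normc_ge0 ?circBV//).
  by rewrite normcM ler_pM ?normc_ge0// normc_circ// ltW.
rewrite expr2 mulrA ler_wpM2r ?normc_ge0//.
apply: le_trans (_ : C * normc h <= _); first by rewrite ler_wpM2r ?normc_ge0// lerDl.
by rewrite mulrC -ler_pdivlMr// ltW.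
Qed.

Lemma ctrans0 g : ctrans g 0 = cavg g.
Proof.
by congr cavg; apply/funext => t; rewrite subr0 divff ?mulr1// circ_neq0.
Qed.

(** One step of the geometric series, [zeta / (zeta - z) = 1 + (z / zeta) * (zeta / (zeta - z))]. *)
Lemma ctransS g z : continuous g -> normc z < rho ->
  ctrans g z = cavg g + z * ctrans (fun t => g t / circ rho t) z.
Proof.
move=> cg zr.
have cgV : continuous (fun t => g t / circ rho t).
  apply: (ccontM cg); apply: ccontV => [|t]; [exact: continuous_circ|exact: circ_neq0].
rewrite -(cavgZ z (continuous_g_ker zr cgV)).
rewrite -(cavgD cg (ccontM (@ccontC _ z) (continuous_g_ker zr cgV))).
congr cavg; apply/funext => t; have := circB_neq0 t zr; have := circ_neq0 t rho0.
by move: (circ rho t) => c n1 n2; field; rewrite n1 n2.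
Qed.

Variable (f : R[i] -> R[i]).
Hypothesis df : forall w, normc w <= rho -> derivable f w 1.

(** Its mean is the [n]-th Taylor coefficient of [f] at [0], and its Cauchy transform is the [n]-th
    remainder divided by [z ^ n]. *)
Let G n t := f (circ rho t) / circ rho t ^+ n.

Let cf : continuous (fun t => f (circ rho t)).
Proof.
apply: (@ccont_comp _ f (circ rho) (@continuous_circ _ rho)) => t.
apply: is_derive_continuous; apply: derivable_is; apply: df.
by rewrite normc_circ// ltW.
Qed.

Let cG n : continuous (G n).
Proof.
have cV : continuous (fun t => (circ rho t ^+ n)^-1).
  apply: (@ccontV _ (fun t => circ rho t ^+ n)) => [|t].
    exact: (@ccontX _ _ n (@continuous_circ _ rho)).
  by rewrite expf_neq0// circ_neq0.
exact: (@ccontM _ (fun t => f (circ rho t)) _ cf cV).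
Qed.

Lemma taylor_expansion n z : normc z < rho ->
  f z = \sum_(j < n) cavg (G j) * z ^+ j + z ^+ n * ctrans (G n) z.
Proof.
move=> zr; elim: n => [|n IH].
  rewrite big_ord0 add0r expr0 mul1r (cauchy_formula rho0 df zr).
  by congr cavg; apply/funext => t; rewrite /G expr0 divr1.
rewrite IH big_ord_recr /= -addrA; congr (_ + _).
have -> : G n.+1 = (fun t => G n t / circ rho t).
  by apply/funext => t; rewrite /G exprSr invfM mulrA.
by rewrite (ctransS (@cG n) zr) mulrDr [z ^+ n * cavg _]mulrC mulrA -exprSr.
Qed.

(** If all Taylor coefficients vanish, [f z] equals every remainder, which is at most a constant
    times [(normc z / rho) ^ n], hence [0]. Otherwise [n] is the least index of a nonzero
    coefficient and [k] is the Cauchy transform of [G n], so that its differentiability and bounds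
    are already known. *)
Lemma order_expansion :
  (forall z, normc z < rho -> f z = 0) \/
  exists n k, [/\ forall z, normc z < rho -> f z = z ^+ n * k z, k 0 != 0 &
    exists2 B, 0 < B & forall z, normc z <= rho / 2 ->
      [/\ derivable k z 1, normc (k z) <= B & normc (derive1 k z) <= B]].
Proof.
have [M M0 fM] := continuous_bounded_0_2pi cf.
have GM n t : 0 <= t <= pi *+ 2 -> normc (G n t) <= M / rho ^+ n.
  move=> t2; rewrite normcM normcV normcX normc_circ ?(ltW rho0)//.
  by rewrite ler_wpM2r ?invr_ge0 ?exprn_ge0 ?fM// ltW.
have [a0|] := pselect (forall n, cavg (G n) = 0).
  left=> z zr; apply/eqP; rewrite -normc_eq0 eq_le normc_ge0 andbT.
  pose C := M * (rho / (rho - normc z)); pose x := normc z / rho.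
  have C0 : 0 < C by rewrite mulr_gt0// divr_gt0// subr_gt0.
  have fzn n : normc (f z) <= C * x ^+ n.
    rewrite (taylor_expansion n zr) big1 ?add0r; last by move=> j _; rewrite a0 mul0r.
    rewrite normcM normcX.
    apply: le_trans (ler_wpM2l _ (normc_ctrans_le (@cG n) (GM n) zr)) _.
      by rewrite exprn_ge0// normc_ge0.
    rewrite /C /x expr_div_n le_eqVlt; apply/orP; left; apply/eqP.
    by field; rewrite expf_neq0 ?gt_eqF// subr_gt0.
  apply/ler_addgt0Pl => /= e e0; rewrite addr0.
  have x1 : `|x| < 1.
    by rewrite ger0_norm ?divr_ge0 ?normc_ge0 ?(ltW rho0)// ltr_pdivrMr// mul1r.
  have /cvgrPdist_lt /(_ e e0)[n _ /(_ n (leqnn _))] /= := cvg_geometric C x1.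
  rewrite sub0r normrN => H; apply: ltW; apply: le_lt_trans (fzn n) _.
  by apply: le_lt_trans H; rewrite /geometric /= ler_norm.
move=> /existsNP/cid[n0 an0]; right.
have ex : exists n, cavg (G n) != 0 by exists n0; apply/eqP.
have [n an nmin] := ex_minnP ex.
exists n, (ctrans (G n)); split.
- move=> z zr; rewrite (taylor_expansion n zr) big1 ?add0r// => j _.
  case: (eqVneq (cavg (G j)) 0) => [->|/nmin]; first by rewrite mul0r.
  by rewrite leqNgt ltn_ord.
- by rewrite ctrans0.
(* Both entries come from [rho - normc z >= rho / 2] on the half disc: one bounds [k], the other its
   derivative. *)
pose B := Num.max (M / rho ^+ n * (rho / (rho / 2))) (M / rho ^+ n * (rho / (rho / 2) / (rho / 2))).
have Mn : 0 < M / rho ^+ n by rewrite divr_gt0// exprn_gt0.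
have rho20 : 0 < rho / 2 by rewrite divr_gt0.
exists B; first by rewrite lt_max mulr_gt0// divr_gt0.
move=> z z2; have zr : normc z < rho by apply: le_lt_trans z2 _; rewrite ltr_pdivrMr// ltr_pMr// ltr1n.
have rz : (rho - normc z)^-1 <= (rho / 2)^-1.
  by rewrite lef_pV2 ?posrE ?subr_gt0 ?divr_gt0//; lra.
have rzV : 0 <= (rho - normc z)^-1 by rewrite invr_ge0 subr_ge0 ltW.
have dk := is_derive_ctrans (@cG n) (GM n) zr.
split; first by case: dk.
- apply: le_trans (normc_ctrans_le (@cG n) (GM n) zr) _.
  rewrite le_max; apply/orP; left; rewrite ler_wpM2l ?(ltW Mn)// ler_wpM2l//.
  exact: ltW.
- rewrite (derive1_is dk); apply: le_trans (normc_ctrans'_le (@cG n) (GM n) zr) _.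
  rewrite le_max; apply/orP; right; rewrite ler_wpM2l ?(ltW Mn)//.
  by rewrite ler_pM// ?mulr_ge0// ?(ltW rho0)// ler_wpM2l// ltW.
Qed.

End Taylor.

(** * Continuity of the derivative, open mapping theorem *)

Section Holomorphic.
Context {R : realType}.
Implicit Types (rho : R) (c z w : R[i]) (f g : R[i] -> R[i]).

Lemma is_derive_translate f c z d : is_derive (c + z) 1 f d ->
  is_derive z 1 (fun w => f (c + w)) d.
Proof.
by move=> /cderivP H; apply/cderivP => e /H[r r0 rH]; exists r => // h /rH; rewrite addrA.
Qed.

(** Subtracting the affine part at [c] leaves [g] with [g 0 = 0] and [g' 0 = 0]. By
    [order_expansion], [g] is [0] near [0] or has a zero of order at least [2]; in both cases
    [g' w], which is the increment of [f'], is at most a constant times [normc w]. *)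
Lemma derive1_continuous rho f c : 0 < rho ->
  (forall w, normc (w - c) <= rho -> derivable f w 1) -> {for c, continuous (derive1 f)}.
Proof.
move=> r0 df; pose g w := f (c + w) - f c - derive1 f c * w.
have dg w : normc w <= rho -> is_derive w 1 g (derive1 f (c + w) - derive1 f c).
  move=> wr; rewrite -[derive1 f (c + w)]subr0 -[X in _ - X]mulr1.
  apply: is_cderivB (is_cderivZ _ (is_cderiv_id w)).
  apply: is_cderivB (is_cderiv_cst _ w).
  apply: is_derive_translate; apply: derivable_is; apply: df.
  by rewrite addrAC subrr add0r.
have dg' w : normc w <= rho -> derivable g w 1 by move=> /dg[].
have g0 : g 0 = 0 by rewrite /g mulr0 subr0 addr0 subrr.
have dg0 : is_derive (0 : R[i]) 1 g 0.
  have := dg 0; rewrite normc0 addr0 subrr => /(_ (ltW r0)).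
  by [].
have r20 : 0 < rho / 2 by rewrite divr_gt0.
have dfE w d : normc w < rho -> is_derive w 1 g d -> derive1 f (c + w) - derive1 f c = d.
  by move=> /ltW wr /derive1_is <-; rewrite (derive1_is (dg w wr)).
apply/continuous_normcP => e e0.
have [gz|[n [k [gE k0 [B B0 kB]]]]] := order_expansion r0 dg'.
  apply/nbhs_normcP; exists rho => // y yr /=.
  have D0 : is_derive (y - c) 1 g 0.
    apply: (@is_derive_near R (fun=> 0) g _ _ _ (is_cderiv_cst 0 (y - c))).
    exists (rho - normc (y - c)); first by rewrite subr_gt0.
    move=> z zy; rewrite gz// -(subrK (y - c) z); apply: le_lt_trans (normcD_le _ _) _.
    by rewrite -ltrBrDr.
  by have := dfE (y - c) 0 yr D0; rewrite [c + _]addrC subrK => ->; rewrite normc0.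
(* Order [0] contradicts [g 0 = 0], order [1] contradicts [g' 0 = 0]. *)
have n1 : (1 < n)%N.
  case: n gE => [|[|//]] gE.
    by move: g0; rewrite gE ?normc0// expr0 mul1r => /eqP; rewrite (negPf k0).
  have /kB[dk _ _] : normc (0 : R[i]) <= rho / 2 by rewrite normc0 ltW.
  have : is_derive (0 : R[i]) 1 g (k 0).
    apply: (@is_derive_near R (fun z => z * k z)).
      by exists rho => // y; rewrite subr0 => yr; rewrite gE// expr1.
    have := is_cderivM (is_cderiv_id 0) (derivable_is dk).
    by rewrite mul1r mul0r addr0.
  by move=> /derive1_is; rewrite (derive1_is dg0) => /esym/eqP; rewrite (negPf k0).
case: n gE n1 => [//|[//|n]] gE _.
have near_g w : normc w <= rho / 2 ->
    is_derive w 1 g (n.+2%:R * w ^+ n.+1 * k w + w ^+ n.+2 * derive1 k w).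
  move=> w2; have [dk _ _] := kB w w2.
  have wr : normc w < rho by apply: le_lt_trans w2 _; rewrite ltr_pdivrMr// ltr_pMr// ltr1n.
  apply: (@is_derive_near R (fun z => z ^+ n.+2 * k z)).
    exists (rho - normc w); first by rewrite subr_gt0.
    move=> z zy; rewrite gE// -(subrK w z); apply: le_lt_trans (normcD_le _ _) _.
    by rewrite -ltrBrDr.
  exact: (is_cderivM (is_cderivX n.+1 w) (derivable_is dk)).
pose C := n.+2%:R * B + B; have C0 : 0 < C by rewrite addr_gt0// mulr_gt0.
apply/nbhs_normcP; exists (Num.min (Num.min 1 (rho / 2)) (e / C)).
  by rewrite !lt_min ltr01 r20 divr_gt0.
move=> y; rewrite !lt_min => /andP[/andP[y1 y2] ye] /=.
have y2' := ltW y2; have yr : normc (y - c) < rho.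
  by apply: lt_trans y2 _; rewrite ltr_pdivrMr// ltr_pMr// ltr1n.
have := dfE (y - c) _ yr (near_g _ y2'); rewrite [c + _]addrC subrK => ->.
have [_ kB1 kB2] := kB _ y2'; set x := y - c in y1 ye kB1 kB2 *.
have x0 := normc_ge0 x.
apply: le_lt_trans (_ : C * normc x < _); last by rewrite mulrC -ltr_pdivlMr.
apply: le_trans (normcD_le _ _) _.
rewrite (normcM _ (k x)) (normcM _ (x ^+ n.+1)) (normcM _ (derive1 k x)) !normcX.
have xn m : normc x ^+ m.+1 <= normc x.
  by rewrite exprS -[leRHS]mulr1 ler_wpM2l// exprn_ile1// ltW.
have nn : normc (n.+2%:R : R[i]) = n.+2%:R.
  by rewrite -(rmorph_nat (real_complex R)) normcR ger0_norm.
rewrite nn (_ : C * normc x = n.+2%:R * B * normc x + B * normc x); last exact: mulrDl.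
have aux (p q r t : R) : 0 <= p -> 0 <= r -> p <= q -> r <= t -> p * r <= t * q.
  by move=> p0 r0' pq rt; rewrite [t * q]mulrC ler_pM.
have xn0 m : 0 <= normc x ^+ m by rewrite exprn_ge0.
apply: lerD; last exact: (aux _ _ _ _ (xn0 _) (normc_ge0 _) (xn _) kB2).
by rewrite -!mulrA ler_wpM2l//; exact: (aux _ _ _ _ (xn0 _) (normc_ge0 _) (xn _) kB1).
Qed.

(* [1 / (f - v)] would violate the mean value bound if [f] missed [v]. *)
Lemma open_mapping rho m f c : 0 < rho -> 0 < m ->
  (forall w, normc (w - c) <= rho -> derivable f w 1) ->
  (forall w, normc (w - c) = rho -> m <= normc (f w - f c)) ->
  forall v, normc (v - f c) < m / 2 -> exists2 w, normc (w - c) < rho & f w = v.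
Proof.
move=> r0 m0 df fm v vm; apply/not_exists2P => H.
have nv w : normc (w - c) <= rho -> f w - v != 0.
  rewrite le_eqVlt => /predU1P[/fm wr|wr]; last first.
    by rewrite subr_eq0; apply/eqP => fwv; have [] := H w.
  rewrite -normc_gt0; have := normcB_ge (f w - f c) (v - f c).
  by rewrite opprB addrA subrK => h; lra.
pose g w := (f (c + w) - v)^-1.
have dg w : normc w <= rho -> derivable g w 1.
  move=> wr; have wr' : normc (c + w - c) <= rho by rewrite addrAC subrr add0r.
  apply: (@derivableV _ _ (fun w => f (c + w) - v)); first exact: nv.
  have := is_cderivB (is_derive_translate (derivable_is (df _ wr'))) (is_cderiv_cst v w).
  by case.
have z0 : normc (0 : R[i]) < rho by rewrite normc0.
have := cauchy_formula r0 dg z0.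
have -> : (fun t => g (circ rho t) * (circ rho t / (circ rho t - 0))) = (fun t => g (circ rho t)).
  by apply/funext => t; rewrite subr0 divff ?mulr1// circ_neq0.
move=> gE; have cg : continuous (fun t => g (circ rho t)).
  apply: (@ccont_comp _ g (circ rho) (@continuous_circ _ rho)) => t.
  apply: is_derive_continuous; apply: derivable_is; apply: dg.
  by rewrite normc_circ// ltW.
(* On the circle [normc (f w - v) >= m - m / 2], so [g] is at most [2 / m] there, while at the
   centre its modulus exceeds [2 / m]. *)
have := normc_cavg_le (M := 2 / m) cg; rewrite -gE /g addr0 normcV normcBC leNgt => h.
have fv : 0 < normc (v - f c).
  by rewrite normcBC normc_gt0 nv// subrr normc0 ltW.
move: h => /(_ _)/negP; apply.
  move=> t _; rewrite normcV -[2 / m]invrK lef_pV2 ?posrE ?invr_gt0 ?divr_gt0// ?invf_div.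
    have wr : normc (c + circ rho t - c) = rho by rewrite addrAC subrr add0r normc_circ// ltW.
    have := fm _ wr; have := normcB_ge (f (c + circ rho t) - f c) (v - f c).
    by rewrite opprB addrA subrK => h1 h2; lra.
  have wr : normc (c + circ rho t - c) <= rho by rewrite addrAC subrr add0r normc_circ// ltW.
  by rewrite normc_gt0 nv.
rewrite -[2 / m]invrK ltf_pV2 ?posrE ?invr_gt0 ?divr_gt0//.
by rewrite invf_div.
Qed.

End Holomorphic.

(** * Open mapping and the Schwarz lemma *)

Section Schwarz.
Context {R : realType}.
Implicit Types (rho : R) (z w l : R[i]) (f : R[i] -> R[i]) (g u v : R -> R[i]).

(** The factor [c] rotates the mean of [u] onto the nonnegative real axis. If that mean is [0],
    division by zero makes [c] equal to [0], and the argument uses only [normc c <= 1]. *)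
Lemma normc_cavg_le_Re u v : continuous u -> continuous v ->
  (forall t, 0 <= t <= pi *+ 2 -> normc (u t) <= Re (v t)) ->
  normc (cavg u) <= Re (cavg v).
Proof.
move=> cu cv uv; set U := cavg u; pose c := conjc U / (normc U)%:C.
have c1 : normc c <= 1.
  rewrite normcM normcV normc_conj normcR ger0_norm ?normc_ge0//.
  by have [->|n0] := eqVneq (normc U) 0; [rewrite mul0r|rewrite divff].
have UE : normc U = Re (c * U).
  rewrite /c mulrAC [conjc U * U]mulrC mul_conj.
  have -> : (normc U ^+ 2)%:C / (normc U)%:C = (normc U)%:C; last by [].
  have [->|n0] := eqVneq (normc U) 0; first by rewrite expr0n /= mul0r.
  rewrite expr2 rmorphM mulfK//; apply/eqP => /complexI /eqP.
  by rewrite (negPf n0).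
have ccu : continuous (fun t => c * u t) by exact: (ccontM (@ccontC _ c) cu).
rewrite UE -(cavgZ c cu) -subr_le0.
have -> : Re (cavg (fun t => c * u t)) - Re (cavg v) = Re (cavg (fun t => c * u t) - cavg v).
  by case: (cavg _) (cavg v) => a b [a' b'].
rewrite -(cavgB ccu cv); apply: (Re_cavg_le (ccontB ccu cv)) => t t2.
have -> : Re (c * u t - v t) = Re (c * u t) - Re (v t) by case: (c * u t) (v t) => a b [a' b'].
rewrite subr_le0; apply: le_trans (uv t t2); apply: le_trans (ler_norm _) _.
by apply: le_trans (abs_Re_le _) _; rewrite normcM ler_piMl ?normc_ge0.
Qed.

Lemma derive1_cavg rho f : 0 < rho -> (forall w, normc w <= rho -> derivable f w 1) ->
  derive1 f 0 = cavg (fun t => f (circ rho t) / circ rho t).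
Proof.
move=> r0 df; have cf : continuous (fun t => f (circ rho t)).
  apply: (@ccont_comp _ f (circ rho) (@continuous_circ _ rho)) => t.
  by apply: is_derive_continuous; apply: derivable_is; apply: df; rewrite normc_circ// ltW.
have [M _ fM] := continuous_bounded_0_2pi cf.
have z0 : normc (0 : R[i]) < rho by rewrite normc0.
have D := is_derive_ctrans r0 cf fM z0.
have : is_derive (0 : R[i]) 1 f (ctrans' rho (fun t => f (circ rho t)) 0).
  apply: (@is_derive_near _ _ f _ _ _ D); exists rho => // y; rewrite subr0 => yr.
  by rewrite (cauchy_formula r0 df yr).
move=> /derive1_is ->; congr cavg; apply/funext => t.
by rewrite subr0 divff ?circ_neq0// mul1r.
Qed.

(* Parseval: the mean of [|f - l z|^2] over the circle of radius [rho] is at most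
   [1 - |l|^2 rho^2], which tends to [0]. *)
Lemma schwarz_equality f : (forall z, normc z < 1 -> derivable f z 1) ->
  (forall z, normc z < 1 -> normc (f z) < 1) -> 1 <= normc (derive1 f 0) ->
  forall z, normc z < 1 -> f z = derive1 f 0 * z.
Proof.
move=> df f1; set l := derive1 f 0 => l1 z z1.
apply/eqP; rewrite -subr_eq0 -normc_eq0 eq_le normc_ge0 andbT.
pose d := 1 - normc z; have d0 : 0 < d by rewrite subr_gt0.
apply/ler_addgt0Pl => /= e' e'0; rewrite addr0.
pose e := Num.min 1 (e' * d / 2).
have e0 : 0 < e by rewrite lt_min ltr01 !mulr_gt0.
have e1 : e <= 1 by rewrite ge_min lexx.
have ee : e * (2 / d) <= e'.
  rewrite mulrA ler_pdivrMr// -ler_pdivlMr// ge_min; apply/orP; right.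
  exact: lexx.
(* The first entry gives [rho - normc z >= d / 2], the second [1 - rho ^ 2 <= e ^ 2]. *)
pose rho := Num.max ((1 + normc z) / 2) (1 - e ^+ 2 / 2).
have rho1 : rho < 1.
  rewrite gt_max; apply/andP; split; first by move: d0; rewrite /d; lra.
  by rewrite gtrBl divr_gt0// exprn_gt0.
have rhoz : (1 + normc z) / 2 <= rho by rewrite le_max lexx.
have rhoe : 1 - e ^+ 2 / 2 <= rho by rewrite le_max lexx orbT.
have nz := normc_ge0 z.
have r0 : 0 < rho by lra.
have zr : normc z < rho by move: d0; rewrite /d; lra.
have dfr w : normc w <= rho -> derivable f w 1.
  by move=> wr; apply: df; exact: le_lt_trans rho1.
have cf : continuous (fun t => f (circ rho t)).
  apply: (@ccont_comp _ f (circ rho) (@continuous_circ _ rho)) => t.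
  by apply: is_derive_continuous; apply: derivable_is; apply: dfr; rewrite normc_circ// ltW.
pose g w := f w - l * w.
have dg w : normc w <= rho -> derivable g w 1.
  move=> wr; have := is_cderivB (derivable_is (dfr w wr)) (is_cderivZ l (is_cderiv_id w)).
  by case.
have cV : continuous (fun t => (circ rho t)^-1).
  apply: (@ccontV _ (circ rho)) => [|t]; first exact: continuous_circ.
  exact: circ_neq0.
pose h t := f (circ rho t) / circ rho t.
have ch : continuous h by exact: (ccontM cf cV).
have lE : l = cavg h by exact: derive1_cavg.
(* [Re (s t)] dominates [|g|^2] on the circle. *)
pose s t := (1 + normc l ^+ 2 * rho ^+ 2)%:C - (2 * rho ^+ 2)%:C * (conjc l * h t).
have cs : continuous s.
  exact: (ccontB (@ccontC _ _) (ccontM (@ccontC _ _) (ccontM (@ccontC _ (conjc l)) ch))).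
(* As [l] is the mean of [h], the mean of [s] is [1 - normc l ^ 2 * rho ^ 2], at most
   [1 - rho ^ 2]. *)
have Re_s : Re (cavg s) <= e ^+ 2.
  rewrite (cavgB (@ccontC _ _) (ccontM (@ccontC _ _) (ccontM (@ccontC _ (conjc l)) ch))).
  rewrite cavg_cst (cavgZ _ (ccontM (@ccontC _ (conjc l)) ch)) (cavgZ _ ch) -lE.
  rewrite [conjc l * l]mulrC mul_conj -rmorphM -rmorphB /=.
  have : 1 <= normc l ^+ 2 by rewrite exprn_ege1.
  have : 0 <= rho ^+ 2 by rewrite exprn_ge0// ltW.
  have : 1 - e ^+ 2 <= rho ^+ 2.
    apply: le_trans (_ : (1 - e ^+ 2 / 2) ^+ 2 <= _).
      by rewrite -subr_ge0 (_ : _ - _ = (e ^+ 2 / 2) ^+ 2); [rewrite sqr_ge0|field].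
    rewrite ler_pXn2r ?nnegrE ?(ltW r0)// subr_ge0 ler_pdivrMr// mul1r.
    by apply: le_trans (_ : 1 <= _); [rewrite exprn_ile1// ltW|rewrite ler1n].
  by move: (normc l ^+ 2) (rho ^+ 2) (e ^+ 2) => L r e2 h1 h2 h3; nra.
have gs t : normc (g (circ rho t)) ^+ 2 <= Re (s t).
  have f1t : normc (f (circ rho t)) ^+ 2 <= 1.
    by rewrite exprn_ile1 ?normc_ge0// ltW// f1// normc_circ// ltW.
  have hE : f (circ rho t) = h t * circ rho t by rewrite /h divfK// circ_neq0.
  have nc : normc (circ rho t) ^+ 2 = rho ^+ 2 by rewrite normc_circ// ltW.
  have nf : normc (f (circ rho t)) ^+ 2 = normc (h t) ^+ 2 * rho ^+ 2.
    by rewrite hE normcM exprMn nc.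
  have -> : g (circ rho t) = (h t - l) * circ rho t by rewrite /g hE mulrBl.
  rewrite normcM exprMn nc.
  apply: le_trans (_ : 1 + normc l ^+ 2 * rho ^+ 2 - 2 * rho ^+ 2 * Re (conjc l * h t) <= _).
    move: f1t; rewrite nf !normc_sqr; case: (h t) (l) => a b [x y] /= f1t.
    rewrite -subr_ge0; apply: le_trans (_ : 1 - (a ^+ 2 + b ^+ 2) * rho ^+ 2 <= _).
      by rewrite subr_ge0.
    by rewrite le_eqVlt; apply/orP; left; apply/eqP; ring.
  rewrite /s le_eqVlt; apply/orP; left; apply/eqP.
  by case: (conjc l * h t) => a b /=; ring.
have ck := continuous_cker zr.
have cg : continuous (fun t => g (circ rho t)).
  exact: (ccontB cf (ccontM (@ccontC _ l) (@continuous_circ _ rho))).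
rewrite -/(g z) (cauchy_formula r0 dg zr).
(* By [2 * x <= x ^ 2 / e + e] and the bound [2 / d] on the kernel, [Re (v t)] dominates the Cauchy
   integrand of [g]. This passes from the mean of a square to a mean, in place of the Cauchy-Schwarz
   inequality. *)
pose v t := (d^-1)%:C * ((e^-1)%:C * s t + e%:C).
have cv : continuous v.
  exact: (ccontM (@ccontC _ _) (ccontD (ccontM (@ccontC _ _) cs) (@ccontC _ _))).
apply: le_trans (normc_cavg_le_Re (ccontM cg ck) cv _) _.
  move=> t _; rewrite normcM normcM normcV normc_circ ?(ltW r0)//.
  have -> : Re (v t) = d^-1 * (e^-1 * Re (s t) + e) by rewrite /v; case: (s t) => a b /=; ring.
  have k2 : rho / normc (circ rho t - z) <= 2 / d.
    apply: (@le_trans _ _ (1 / (d / 2))); last by rewrite invf_div mul1r.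
    rewrite ler_pM ?invr_ge0 ?normc_ge0 ?(ltW r0) ?(ltW rho1)// lef_pV2 ?posrE ?divr_gt0//.
      apply: le_trans (circB_ge _ _ (ltW r0)); rewrite /d; lra.
    by rewrite normc_gt0 circB_neq0.
  apply: le_trans (ler_wpM2l (normc_ge0 _) k2) _.
  rewrite mulrA [X in X <= _]mulrC ler_pM2l ?invr_gt0//.
  apply: le_trans (_ : e^-1 * normc (g (circ rho t)) ^+ 2 + e <= _); last first.
    by rewrite lerD2r ler_wpM2l// invr_ge0 ltW.
  move: (normc (g (circ rho t))) => x.
  rewrite -subr_ge0 (_ : _ - _ = e^-1 * (x - e) ^+ 2); last by field; rewrite gt_eqF.
  by rewrite mulr_ge0 ?sqr_ge0// invr_ge0 ltW.
rewrite (cavgZ _ (ccontD (ccontM (@ccontC _ _) cs) (@ccontC _ _))).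
rewrite (cavgD (ccontM (@ccontC _ _) cs) (@ccontC _ _)) (cavgZ _ cs) cavg_cst.
apply: le_trans ee.
apply: (@le_trans _ _ (d^-1 * (e^-1 * Re (cavg s) + e))).
  by rewrite le_eqVlt; apply/orP; left; apply/eqP; case: (cavg s) => a b /=; ring.
have -> : e * (2 / d) = d^-1 * (e^-1 * e ^+ 2 + e).
  by field; rewrite !gt_eqF.
by rewrite ler_pM2l ?invr_gt0// lerD2r ler_pM2l ?invr_gt0.
Qed.

End Schwarz.

(** * Area and rotations *)

Section PlaneMeasure.
Context {R : realType}.
Implicit Types (a b c d r : R) (z l : R[i]).

Local Notation leb := (@lebesgue_measure R).
Local Notation RR := (measurableTypeR R).
Local Notation plane := (measurableTypeR R * measurableTypeR R)%type.

Lemma normc_cplxB_le (w v : R * R) : normc (cplx w - cplx v) <= `|w.1 - v.1| + `|w.2 - v.2|.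
Proof. by case: w v => [x y] [x' y']; exact: normc_le_ReIm. Qed.

(** Openness is expressed with [normc], measurability in the product plane. The set is the countable
    union of the boxes it contains with rational centre and half-side [1 / (n + 1)]. *)
Lemma measurable_cplx_open (A : set R[i]) :
  (forall z, A z -> exists2 r : R, 0 < r & forall y, normc (y - z) < r -> A y) ->
  measurable [set w : plane | A (cplx w)].
Proof.
move=> oA.
pose box (p q : rat) (e : R) : set plane :=
  [set` `]ratr p - e, ratr p + e[%R] `*` [set` `]ratr q - e, ratr q + e[%R].
pose F p q n : set plane :=
  if `[< box p q n.+1%:R^-1 `<=` @cplx R @^-1` A >] then box p q n.+1%:R^-1 else set0.
(* The rational centre is within [e] of [w] in each coordinate, so the box stays within [2 * e] in
   each coordinate and [4 * e] in modulus. *)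
have boxP (w : plane) r e : (forall y, normc (y - cplx w) < r -> A y) -> 0 < e -> 4 * e < r ->
    exists p q, box p q e w /\ box p q e `<=` @cplx R @^-1` A.
  case: w => x y rA e0 er.
  have wn (u : R) : u - e < u + e by rewrite ltrD2l gt0_cp.
  have [p pw] := rat_in_itvoo (wn x); have [q qw] := rat_in_itvoo (wn y).
  exists p, q; move: pw qw; rewrite !in_itv /= => /andP[p1 p2] /andP[q1 q2].
  split; first by split => /=; rewrite in_itv /=; apply/andP; split; lra.
  move=> [u v] [/=]; rewrite !in_itv /= => /andP[v1 v2] /andP[v3 v4].
  apply: rA; apply: le_lt_trans (normc_cplxB_le _ _) _; apply: le_lt_trans er => /=.
  have h1 : `|u - x| <= 2 * e by rewrite ler_norml; apply/andP; split; lra.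
  have h2 : `|v - y| <= 2 * e by rewrite ler_norml; apply/andP; split; lra.
  by move: h1 h2; lra.
rewrite (_ : [set w | _] = \bigcup_p \bigcup_q \bigcup_n F p q n); last first.
  apply/seteqP; split=> [w /= Aw|w [p _ [q _ [n _]]]]; last first.
    by rewrite /F; case: asboolP => // H /H.
  have [r r0 rA] := oA _ Aw.
  have [n nr] : exists n, 4 * n.+1%:R^-1 < r :> R.
    have [n nr] : exists n, 4 / r < n%:R by exists (Num.bound (4 / r)); exact/archi_boundP/divr_ge0/ltW.
    exists n; rewrite ltr_pdivrMr// mulrC -ltr_pdivrMr//; apply: lt_trans nr _.
    by rewrite ltr_nat.
  have n0 : 0 < n.+1%:R^-1 :> R by rewrite invr_gt0.
  have [p [q [bw bA]]] := boxP w r _ rA n0 nr.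
  by exists p => //; exists q => //; exists n => //; rewrite /F asboolT.
apply: bigcupT_measurable_rat => p; apply: bigcupT_measurable_rat => q.
apply: bigcupT_measurable => n; rewrite /F; case: asboolP => // _.
by apply: measurableX; exact: measurable_itv.
Qed.

Lemma measurable_unit_disc : measurable [set w : plane | unit_disc (cplx w)].
Proof.
apply: (@measurable_cplx_open unit_disc) => z /unit_discE z1; exists (1 - normc z); first by rewrite subr_gt0.
move=> y yz; apply/unit_discE; rewrite -(subrK z y); apply: le_lt_trans (normcD_le _ _) _.
by rewrite -ltrBrDr.
Qed.

Lemma measurable_disc r : measurable ([set w : R * R | normc (cplx w) < r] : set plane).
Proof.
apply: (@measurable_cplx_open [set z | normc z < r]) => z /= z1; exists (r - normc z); first by rewrite subr_gt0.
move=> y yz /=; rewrite -(subrK z y); apply: le_lt_trans (normcD_le _ _) _.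
by rewrite -ltrBrDr.
Qed.

Lemma measurable_fun_cplx (D : set R[i]) (g : R[i] -> R) :
  (forall z, D z -> exists2 r : R, 0 < r & forall y, normc (y - z) < r -> D y) ->
  (forall z, D z -> {for z, continuous g}) ->
  measurable_fun ([set w : plane | D (cplx w)]) (fun w : plane => g (cplx w) : RR).
Proof.
move=> oD cg mD; apply: (measurability _ (measurable_realfun.RGenOInfty.measurableE R)) => //.
move=> _ [_ [x ->] <-]; rewrite (_ : _ `&` _ = [set w : R * R | D (cplx w) /\ x < g (cplx w)]); last first.
  by apply/seteqP; split=> w /=; rewrite in_itv /= andbT.
apply: (@measurable_cplx_open (D `&` [set z | x < g z])) => z [Dz /= xz]; have [r r0 rD] := oD z Dz.
have gx : 0 < g z - x by rewrite subr_gt0.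
have /cvgrPdist_lt /(_ _ gx) /nbhs_normcP[e e0 eH] := cg z Dz.
exists (Num.min r e); first by rewrite lt_min r0.
move=> y; rewrite lt_min => /andP[/rD Dy /eH /= H]; split => //=.
by move: H; rewrite ltr_norml => /andP[]; lra.
Qed.

(** The pushforward under the affine map, multiplied by [c], agrees with Lebesgue measure on
    half-open intervals, so the two measures coincide. *)
Lemma lebesgue_affine c d (A : set RR) : 0 < c -> measurable A ->
  leb ((fun y => c * y + d) @^-1` A) = (c^-1%:E * leb A)%E.
Proof.
move=> c0 mA; have c0' : 0 <= c by exact: ltW.
have mf : measurable_fun [set: RR] (fun y : RR => c * y + d : RR).
  by apply: measurable_funD => //; apply: measurable_funM.
have E : leb A = (c%:E * leb ((fun y => (c * y + d)%R) @^-1` A))%E.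
  transitivity (pushforward (mscale (NngNum c0') leb) (fun y : RR => c * y + d : RR) A); last by [].
  apply: lebesgue_measure_unique => //= _ [[x y]] xy <-.
  rewrite /pushforward /mscale /=.
  rewrite (_ : _ @^-1` _ = [set` `](x - d) / c, (y - d) / c]]); last first.
    apply/seteqP; split=> u /=; rewrite !in_itv /= ltr_pdivrMr// ler_pdivlMr// mulrC;
      by move=> /andP[h1 h2]; apply/andP; split; lra.
  rewrite !lebesgue_measure_itv /= !lte_fin.
  rewrite ltr_pM2r ?invr_gt0// ltrD2r; case: ifP => // _; last by rewrite mule0.
  rewrite -!EFinB -EFinM; congr EFin; field; exact: lt0r_neq0.
by rewrite E muleA -EFinM mulVf ?gt_eqF// mul1e.
Qed.

Local Notation leb2 := (leb \x leb)%E.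

Let shear1 a (w : plane) : plane := (w.1 + a * w.2, w.2).
Let shear2 a (w : plane) : plane := (w.1, w.2 + a * w.1).

Let measurable_lin (f g : plane -> RR) a : measurable_fun setT f -> measurable_fun setT g ->
  measurable_fun setT (fun w => f w + a * g w : RR).
Proof.
by move=> mf mg; apply: measurable_funD => //; apply: measurable_funM.
Qed.

Let measurable_shear1 a : measurable_fun setT (shear1 a).
Proof.
apply: measurable_fun_pair; last exact: measurable_snd.
by apply: measurable_lin; [exact: measurable_fst|exact: measurable_snd].
Qed.

Let measurable_shear2 a : measurable_fun setT (shear2 a).
Proof.
apply: measurable_fun_pair; first exact: measurable_fst.
by apply: measurable_lin; [exact: measurable_snd|exact: measurable_fst].
Qed.

Let measurable_preimage (f : plane -> plane) (E : set plane) :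
  measurable_fun setT f -> measurable E -> measurable (f @^-1` E).
Proof. by move=> mf mE; rewrite -[_ @^-1` _]setTI; exact: mf. Qed.

Let leb2_shear2 a (E : set plane) : measurable E -> leb2 (shear2 a @^-1` E) = leb2 E.
Proof.
move=> mE; rewrite /product_measure1; apply: eq_integral => x _ /=.
rewrite (_ : xsection _ x = (fun y => 1 * y + a * x) @^-1` (xsection E x)); last first.
  by apply/seteqP; split=> y; rewrite /xsection /= !inE /shear2 /= mul1r.
rewrite lebesgue_affine//; last exact: measurable_xsection.
by rewrite invr1 mul1e.
Qed.

(** A horizontal shear translates the horizontal sections, so its invariance is read off the other
    order of integration. *)
Let leb2_sym (E : set plane) : measurable E -> leb2 E = (leb \x^ leb)%E E.
Proof.
move=> mE; apply: product_measure_unique => //= A B mA mB.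
exact: product_measure2E.
Qed.

Let leb2_shear1 a (E : set plane) : measurable E -> leb2 (shear1 a @^-1` E) = leb2 E.
Proof.
move=> mE; rewrite !leb2_sym//; last exact: (measurable_preimage (measurable_shear1 a)).
rewrite /product_measure2; apply: eq_integral => y _ /=.
rewrite (_ : ysection _ y = (fun x => 1 * x + a * y) @^-1` (ysection E y)); last first.
  by apply/seteqP; split=> x; rewrite /ysection /= !inE /shear1 /= mul1r.
rewrite lebesgue_affine//; last exact: measurable_ysection.
by rewrite invr1 mul1e.
Qed.

Definition rot l (w : R * R) : R * R := let z := l * cplx w in (Re z, Im z).

Lemma cplx_rot l w : cplx (rot l w) = l * cplx w.
Proof. by rewrite /rot /cplx; case: (l * _). Qed.

Lemma rotM l m w : rot (l * m) w = rot l (rot m w).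
Proof. by rewrite {1 2}/rot cplx_rot mulrA. Qed.

Lemma measurable_rot l : measurable_fun setT (rot l : plane -> plane).
Proof.
case: l => a b; apply: measurable_fun_pair.
  rewrite (_ : (fun _ => _) = (fun w : plane => (0 + a * w.1) + - b * w.2 : RR)); last first.
    by apply/funext => -[x y] /=; ring.
  apply: measurable_lin; last exact: measurable_snd.
  by apply: (@measurable_lin (cst 0)); [exact: measurable_cst|exact: measurable_fst].
rewrite (_ : (fun _ => _) = (fun w : plane => (0 + a * w.2) + b * w.1 : RR)); last first.
  by apply/funext => -[x y] /=; ring.
apply: measurable_lin; last exact: measurable_fst.
by apply: (@measurable_lin (cst 0)); [exact: measurable_cst|exact: measurable_snd].
Qed.

(* For [Im l != 0] the rotation is a product of three shears. *)
Let leb2_rot_Im l (E : set plane) : normc l = 1 -> Im l != 0 -> measurable E ->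
  leb2 (rot l @^-1` E) = leb2 E.
Proof.
case: l => c s l1 /= s0 mE.
have cs : c ^+ 2 + s ^+ 2 = 1 by rewrite -[LHS](normc_sqr (c +i* s)) l1 expr1n.
(* Minus the tangent of half the angle of rotation. *)
pose a := (c - 1) / s.
rewrite (_ : _ @^-1` _ = shear1 a @^-1` (shear2 s @^-1` (shear1 a @^-1` E))).
  have m1 := measurable_preimage (measurable_shear1 a) mE.
  have m2 := measurable_preimage (measurable_shear2 s) m1.
  by rewrite (leb2_shear1 a m2) (leb2_shear2 s m1) (leb2_shear1 a mE).
have E1 w : rot (c +i* s) w = shear1 a (shear2 s (shear1 a w)).
  case: w => x y; rewrite /rot /shear1 /shear2 /cplx /=.
  have sa : s * a = c - 1 by rewrite mulrC divfK.
  congr pair; last first.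
    by rewrite mulrDr mulrA sa; ring.
  have sc : a * (1 + c) = - s.
    rewrite /a mulrAC (_ : (c - 1) * (1 + c) = - s * s); first by rewrite mulfK.
    by rewrite -[LHS]addr0 -(subrr (s ^+ 2)); move: cs; nra.
  rewrite (_ : x + a * y + a * _ = (1 + s * a) * x + a * (1 + (1 + s * a)) * y); last by ring.
  by rewrite sa (addrCA 1) subrr addr0 sc; ring.
by apply/seteqP; split=> w /=; rewrite E1.
Qed.

(** A real [l] factors as [i * (- i * l)], two unimodular numbers with nonzero imaginary part, so
    the shear case applies twice. *)
Lemma leb2_rot l (E : set plane) : normc l = 1 -> measurable E ->
  leb2 (rot l @^-1` E) = leb2 E.
Proof.
move=> l1 mE; have [l0|] := eqVneq (Im l) 0; last by move=> h; exact: leb2_rot_Im.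
pose i : R[i] := 0 +i* 1; pose m := - i * l.
have i1 : normc i = 1 by rewrite /normc /= expr0n/= expr1n add0r sqrtr1.
have lE : l = i * m.
  by rewrite /m mulNr mulrN mulrA; case: (l) => x y; apply/eqP; rewrite eq_complex /=; apply/andP; split; apply/eqP; ring.
have m1 : normc m = 1 by rewrite /m normcM normcN i1 l1 mulr1.
have m0 : Im m != 0.
  have -> : Im m = - Re l by rewrite /m; case: (l) => x y /=; ring.
  rewrite oppr_eq0; apply/eqP => r0; move: l1; case: (l) l0 r0 => x y /= -> ->.
  by rewrite expr0n addr0 sqrtr0 => /esym/eqP; rewrite oner_eq0.
rewrite lE (_ : _ @^-1` _ = rot m @^-1` (rot i @^-1` E)); last first.
  by apply/seteqP; split=> w /=; rewrite rotM.
have mE' : measurable (rot i @^-1` E) by exact: measurable_preimage (measurable_rot i) mE.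
by rewrite (leb2_rot_Im m1 m0 mE') leb2_rot_Im//= oner_eq0.
Qed.

Lemma area_rot l (E : set plane) : normc l = 1 -> measurable E ->
  area (rot l @^-1` E) = area E.
Proof. by move=> l1 mE; rewrite /area /mscale /=; congr (_ * _)%E; exact: leb2_rot. Qed.

Local Notation D := [set w : plane | unit_disc (cplx w)].

Lemma integral_rot l (F : plane -> \bar R) : normc l = 1 -> measurable_fun D F ->
  (forall w, D w -> (0 <= F w)%E) ->
  (\int[area]_(w in D) F w = \int[area]_(w in D) F (rot l w))%E.
Proof.
move=> l1 mF F0.
transitivity (\int[pushforward area (rot l : plane -> plane)]_(w in D) F w)%E.
  apply: eq_measure_integral; first exact: measurable_rot.
  by move=> ? A mA _; exact/esym/(area_rot l1).
rewrite (ge0_integral_pushforward (measurable_rot l))//; first last.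
- by move=> w; rewrite inE; exact: F0.
- exact: measurable_unit_disc.
rewrite (_ : rot l @^-1` D = D)//; apply/seteqP; split=> w /= /unit_discE H; apply/unit_discE;
  by move: H; rewrite cplx_rot normcM l1 mul1r.
Qed.

Let leb_scale r (A : set RR) : 0 < r -> measurable A ->
  leb ((fun y => r^-1 * y) @^-1` A) = (r%:E * leb A)%E.
Proof.
move=> r0 mA; have := @lebesgue_affine r^-1 0 A; rewrite invr_gt0 invrK => /(_ r0 mA) <-.
by congr leb; apply/seteqP; split=> y /=; rewrite addr0.
Qed.

(** One variable at a time: the sections scale by [r], then the outer integral does. The area of the
    unit disc stays symbolic, since it cancels from the final inequality. *)
Lemma area_disc_scale r : 0 < r ->
  area ([set w : plane | normc (cplx w) < r]) =
  ((r ^+ 2)%:E * area ([set w : plane | (normc (cplx w) < 1)%R]))%E.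
Proof.
move=> r0; set A1 := [set w : plane | normc (cplx w) < 1].
have mA1 : measurable A1 by exact: measurable_disc.
rewrite /area /mscale /= muleCA; congr (_ * _)%E; rewrite /product_measure1.
have h1 : measurable_fun [set: RR] (leb \o xsection A1) by exact: measurable_fun_xsection.
have h0 (x : RR) : (0 <= leb (xsection A1 x))%E by exact: measure_ge0.
have rinv : measurable_fun [set: RR] (fun x : RR => r^-1 * x : RR).
  by apply: measurable_funM.
have scaleE x y : (normc (cplx (x, y)) < r) = (normc (cplx (r^-1 * x, r^-1 * y)) < 1).
  rewrite (_ : cplx (r^-1 * x, r^-1 * y) = r^-1%:C * cplx (x, y)).
    by rewrite normcM normcR gtr0_norm ?invr_gt0// ltr_pdivrMl// mulr1.
  by rewrite /cplx /=; apply/eqP; rewrite eq_complex /= !mul0r subr0 addr0 !eqxx.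
transitivity (\int[leb]_x (r%:E * (leb \o xsection A1) (r^-1 * x)%R))%E.
  apply: eq_integral => x _ /=.
  rewrite -leb_scale//; last exact: measurable_xsection.
  congr leb; apply/seteqP; split=> y; rewrite /xsection /= !inE => H.
    by change (is_true (normc (cplx (r^-1 * x, r^-1 * y)) < 1)); rewrite -scaleE; exact: H.
  by change (is_true (normc (cplx (x, y)) < r)); rewrite scaleE; exact: H.
rewrite (@ge0_integralZl_EFin _ _ _ leb setT measurableT (fun x : RR => (leb \o xsection A1) (r^-1 * x)%R)
  (fun x _ => h0 _) (measurableT_comp h1 rinv) r (ltW r0)).
rewrite expr2 EFinM -muleA; congr (_ * _)%E.
transitivity (\int[pushforward leb (fun x : RR => r^-1 * x : RR)%R]_x (leb \o xsection A1) x)%E.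
  by rewrite (ge0_integral_pushforward rinv leb measurableT h1) ?preimage_setT.
transitivity (\int[mscale (NngNum (ltW r0)) leb]_x (leb \o xsection A1) x)%E.
  by apply: eq_measure_integral => A mA _; exact: (leb_scale r0 mA).
exact: (ge0_integral_mscale leb measurableT (NngNum (ltW r0)) h1 (fun x _ => h0 x)).
Qed.

Lemma area_box (A B : set RR) : measurable A -> measurable B ->
  area (A `*` B : set plane) = ((pi^-1)%:E * (leb A * leb B))%E.
Proof.
move=> mA mB; rewrite /area /mscale /=; congr (_ * _)%E.
exact: (product_measure1E leb leb mA mB).
Qed.

Lemma area_disc_gt0 z r : 0 < r -> (0 < area ([set w : plane | (normc (cplx w - z) < r)%R]))%E.
Proof.
move=> r0; have r4 : 0 < r / 4 by rewrite divr_gt0.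
pose B : set plane := [set` `](Re z - r / 4), (Re z + r / 4)[%R] `*`
                      [set` `](Im z - r / 4), (Im z + r / 4)[%R].
have mB : measurable B by apply: measurableX; exact: measurable_itv.
have mA : measurable [set w : plane | normc (cplx w - z) < r].
  apply: (@measurable_cplx_open [set y | normc (y - z) < r]) => y /= yz.
  exists (r - normc (y - z)); first by rewrite subr_gt0.
  move=> u uy /=; have -> : u - z = (u - y) + (y - z) by rewrite addrA subrK.
  apply: le_lt_trans (normcD_le _ _) _.
  by rewrite -ltrBrDr.
apply: (@lt_le_trans _ _ (area B)); last first.
  apply: le_measure; rewrite ?inE// => -[x y] [/=].
  rewrite !in_itv /= => /andP[h1 h2] /andP[h3 h4].
  have := normc_cplxB_le (x, y) (Re z, Im z).
  rewrite (_ : cplx (Re z, Im z) = z) /=; last by case: (z).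
  move=> h; apply: le_lt_trans h _.
  have k1 : `|x - Re z| <= r / 4 by rewrite ler_norml; apply/andP; split; lra.
  have k2 : `|y - Im z| <= r / 4 by rewrite ler_norml; apply/andP; split; lra.
  by move: k1 k2; lra.
rewrite area_box; [|exact: measurable_itv..].
rewrite mule_gt0// ?lte_fin ?invr_gt0 ?pi_gt0//.
have lt x : x - r / 4 < x + r / 4 by rewrite ltrD2l gt0_cp.
rewrite !lebesgue_measure_itv /= !lte_fin !lt -!EFinB -EFinM lte_fin.
by rewrite mulr_gt0// subr_gt0.
Qed.

Lemma area_disc_lty r : (area ([set w : plane | (normc (cplx w) < r)%R]) < +oo)%E.
Proof.
pose B : set plane := [set` `](- r), r[%R] `*` [set` `](- r), r[%R].
have mB : measurable B by apply: measurableX; exact: measurable_itv.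
apply: (@le_lt_trans _ _ (area B)).
  apply: le_measure; rewrite ?inE//; first exact: measurable_disc.
  move=> [x y] /= xy; split; rewrite /= in_itv /= -ltr_norml.
    by apply: le_lt_trans xy; exact: (abs_Re_le (x +i* y)).
  by apply: le_lt_trans xy; exact: (abs_Im_le (x +i* y)).
rewrite area_box; [|exact: measurable_itv..].
rewrite !lebesgue_measure_itv /= !lte_fin; case: ifP => _; last by rewrite mule0 mule0 ltry.
by rewrite -!EFinB -!EFinM ltry.
Qed.

End PlaneMeasure.

(** * Moments and sublevel sets *)

Section Moments.
Context {R : realType}.

Lemma bernoulli_ineq (y : R) n : -1 <= y -> 1 + n%:R * y <= (1 + y) ^+ n.
Proof.
move=> y1; elim: n => [|n IH]; first by rewrite mul0r addr0 expr0.
rewrite exprS; apply: le_trans (_ : (1 + y) * (1 + n%:R * y) <= _); last first.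
  by rewrite ler_wpM2l//; lra.
rewrite -natr1 -subr_ge0 (_ : _ - _ = n%:R * y ^+ 2); last by ring.
by rewrite mulr_ge0// sqr_ge0.
Qed.

(* The polynomials [(1 - x ^ n) ^ (k ^ n)] of the Brosowski-Deutsch proof of the
   Weierstrass theorem: on [[0, 1]] they tend to [1] below [1 / k] and to [0] above. *)
Definition bdpoly (k n : nat) : {poly R} := (1 - 'X^n) ^+ (k ^ n).

Lemma bdpolyE k n x : (bdpoly k n).[x] = (1 - x ^+ n) ^+ (k ^ n).
Proof. by rewrite horner_exp !hornerE. Qed.

Lemma bdpoly01 k n x : 0 <= x <= 1 -> 0 <= (bdpoly k n).[x] <= 1.
Proof.
move=> /andP[x0 x1]; rewrite bdpolyE.
have h0 : 0 <= 1 - x ^+ n by rewrite subr_ge0 exprn_ile1.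
by rewrite exprn_ge0//= exprn_ile1// gerBl exprn_ge0.
Qed.

(** Bernoulli's inequality gives the lower bound [1 - (k * x) ^ n]. *)
Lemma bdpoly_cvg1 k x : 0 <= x <= 1 -> k%:R * x < 1 ->
  (bdpoly k n).[x] @[n --> \oo] --> (1 : R).
Proof.
move=> x01 kx; have /andP[x0 x1] := x01.
apply: (@squeeze_cvgr _ _ _ _ (fun n => 1 - (k%:R * x) ^+ n) (fun=> 1)).
- near=> n; have /andP[_ ->] := bdpoly01 k n x01; rewrite andbT bdpolyE.
  apply: le_trans (bernoulli_ineq (y := - x ^+ n) _ _).
    by rewrite exprMn natrX mulrN.
  by rewrite lerN2 exprn_ile1.
- rewrite -[X in _ --> X]subr0; apply: cvgB; first exact: cvg_cst.
  by apply: cvg_expr; rewrite ger0_norm// mulr_ge0.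
- exact: cvg_cst.
Unshelve. all: by end_near. Qed.

(** Multiply by [(1 + x ^ n) ^ (k ^ n)]: the product is at most [1], and by Bernoulli the factor is
    at least [(k * x) ^ n]. *)
Lemma bdpoly_cvg0 k x : 0 <= x <= 1 -> 1 < k%:R * x ->
  (bdpoly k n).[x] @[n --> \oo] --> (0 : R).
Proof.
move=> x01 kx; have /andP[x0 x1] := x01.
have kx0 : 0 < k%:R * x by exact: lt_trans kx.
apply: (@squeeze_cvgr _ _ _ _ (fun=> 0) (fun n => ((k%:R * x)^-1) ^+ n)).
- near=> n; have /andP[-> _] := bdpoly01 k n x01; rewrite /= bdpolyE.
  have xn0 : 0 <= x ^+ n by rewrite exprn_ge0.
  have xn1 : x ^+ n <= 1 by rewrite exprn_ile1.
  rewrite exprVn -[leRHS]mul1r ler_pdivlMr ?exprn_gt0//.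
  apply: le_trans (_ : (1 - x ^+ n) ^+ (k ^ n) * (1 + x ^+ n) ^+ (k ^ n) <= _).
    rewrite ler_wpM2l ?exprn_ge0 ?subr_ge0//.
    apply: le_trans (bernoulli_ineq (k ^ n) (le_trans (lerN10 R) xn0)).
    by rewrite exprMn natrX lerDr.
  rewrite -exprMn (_ : _ * _ = 1 - (x ^+ n) ^+ 2); last by ring.
  rewrite exprn_ile1 ?subr_ge0 ?exprn_ile1//.
  by rewrite gerBl exprn_ge0.
- exact: cvg_cst.
- by apply: cvg_expr; rewrite ger0_norm ?invr_ge0 ?(ltW kx0)// invf_lt1.
Unshelve. all: by end_near. Qed.

Context d (T : measurableType d) (mu : {measure set T -> \bar R}) (D : set T).
(** In the application [X] is [|phi| ^ p] with density [u = |phi'| ^ p (1 - |z| ^ 2) ^ (p - 2)], and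
    [Y] is [|z| ^ p] with density [v = (1 - |z| ^ 2) ^ (p - 2)]. *)
Variables (X Y u v : T -> R).
Hypotheses (mD : measurable D)
  (mX : measurable_fun D X) (mY : measurable_fun D Y)
  (mu_ : measurable_fun D u) (mv : measurable_fun D v)
  (X01 : forall w, D w -> 0 <= X w <= 1) (Y01 : forall w, D w -> 0 <= Y w <= 1)
  (u0 : forall w, D w -> 0 <= u w) (v0 : forall w, D w -> 0 <= v w)
  (iu : mu.-integrable D (EFin \o u)) (iv : mu.-integrable D (EFin \o v)).
Hypothesis XY : forall n, (\int[mu]_(w in D) (X w ^+ n * u w)%:E =
                           \int[mu]_(w in D) (Y w ^+ n * v w)%:E)%E.

Let imono (Z s : T -> R) n : measurable_fun D Z -> measurable_fun D s ->
  (forall w, D w -> 0 <= Z w <= 1) -> mu.-integrable D (EFin \o s) ->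
  mu.-integrable D (fun w => (Z w ^+ n * s w)%:E).
Proof.
move=> mZ ms Z01 is_; apply: (le_integrable mD _ _ is_).
  by apply/measurable_EFinP; apply: measurable_funM => //; exact: measurable_funX.
move=> w Dw; rewrite /= lee_fin normrM; have /andP[Z0 Z1] := Z01 w Dw.
by rewrite ler_piMl// ger0_norm ?exprn_ge0// exprn_ile1.
Qed.

Lemma moments_poly (P : {poly R}) :
  (\int[mu]_(w in D) (P.[X w] * u w)%:E = \int[mu]_(w in D) (P.[Y w] * v w)%:E)%E.
Proof.
(* The extra factor [X ^ n] lets the induction pass through [P * 'X + c]. *)
suff H n : [/\ mu.-integrable D (fun w => (X w ^+ n * P.[X w] * u w)%:E),
    mu.-integrable D (fun w => (Y w ^+ n * P.[Y w] * v w)%:E) &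
    (\int[mu]_(w in D) (X w ^+ n * P.[X w] * u w)%:E =
     \int[mu]_(w in D) (Y w ^+ n * P.[Y w] * v w)%:E)%E].
  have [_ _] := H 0%N; under eq_integral do rewrite expr0 mul1r.
  by move=> ->; apply: eq_integral => w _; rewrite expr0 mul1r.
elim/poly_ind: P n => [|P c IH] n.
  have E (Z s : T -> R) : (fun w => (Z w ^+ n * (0 : {poly R}).[Z w] * s w)%:E) = cst 0%E.
    by apply/funext => w; rewrite horner0 mulr0 mul0r.
  by rewrite !E; split => //; exact: integrable0.
have E (Z s : T -> R) : (fun w => (Z w ^+ n * (P * 'X + c%:P).[Z w] * s w)%:E) =
    (fun w => (Z w ^+ n.+1 * P.[Z w] * s w)%:E + c%:E * (Z w ^+ n * s w)%:E)%E.
  by apply/funext => w; rewrite !hornerE -EFinM -EFinD exprS; congr EFin; ring.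
have [h1 h2 h3] := IH n.+1.
have k1 := imono n mX mu_ X01 iu; have k2 := imono n mY mv Y01 iv.
have l1 := integrableZl mD c k1; have l2 := integrableZl mD c k2.
rewrite !E; split; [exact: integrableD|exact: integrableD|].
by rewrite (integralD mD h1 l1) (integralD mD h2 l2) h3 !(integralZl mD)// XY.
Qed.

Let iq (Z s : T -> R) k n : measurable_fun D Z -> measurable_fun D s ->
  (forall w, D w -> 0 <= Z w <= 1) -> mu.-integrable D (EFin \o s) ->
  mu.-integrable D (fun w => ((bdpoly k n).[Z w] * s w)%:E).
Proof.
move=> mZ ms Z01 is_; apply: (le_integrable mD _ _ is_).
  apply/measurable_EFinP; apply: measurable_funM => //.
  rewrite (_ : (fun _ => _) = (fun w => (1 - Z w ^+ n) ^+ (k ^ n))); last first.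
    by apply/funext => w; rewrite bdpolyE.
  apply: measurable_funX; apply: measurable_funB => //; exact: measurable_funX.
move=> w Dw; rewrite /= lee_fin normrM; have /andP[q0 q1] := bdpoly01 k n (Z01 w Dw).
by rewrite ler_piMl// ger0_norm.
Qed.

(** Dominated convergence: the polynomials stay in [[0, 1]] on the range of [Z], so the absolute
    value of [s] dominates. *)
Let limit_part (Z s : T -> R) k (a : R) (A : set T) :
  measurable_fun D Z -> measurable_fun D s ->
  (forall w, D w -> 0 <= Z w <= 1) -> mu.-integrable D (EFin \o s) ->
  measurable A -> A `<=` D ->
  (forall w, A w -> (bdpoly k n).[Z w] @[n --> \oo] --> a) ->
  (\int[mu]_(w in A) ((bdpoly k n).[Z w] * s w)%:E @[n --> \oo] -->
   \int[mu]_(w in A) (a * s w)%:E)%E.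
Proof.
move=> mZ ms Z01 is_ mA AD lim.
have iqA n : mu.-integrable A (fun w => ((bdpoly k n).[Z w] * s w)%:E).
  exact: (integrableS mD mA AD (iq k n mZ ms Z01 is_)).
have isA := integrableS mD mA AD is_.
have [] := @dominated_convergence _ _ _ mu A mA
  (fun n w => ((bdpoly k n).[Z w] * s w)%:E) (fun w => (a * s w)%:E) (fun w => `|s w|%:E).
- by move=> n; have /integrableP[] := iqA n.
- apply/measurable_EFinP; apply: measurable_funM => //.
  exact: (measurable_funS mD AD).
- apply: aeW => w Aw; apply: cvg_EFin; first exact: nearW.
  by apply: cvgM; [exact: lim|exact: cvg_cst].
- by have /integrable_abse := isA.
- apply: aeW => w n Aw; rewrite /= lee_fin normrM.
  have /andP[q0 q1] := bdpoly01 k n (Z01 w (AD _ Aw)).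
  by rewrite ler_piMl// ger0_norm.
by [].
Qed.

(** The integral of [bdpoly k n] over [A] is at most its integral over [D], which the moments carry
    to the side of [X]. There [D] splits into [C], where the polynomial is at most [1], and [B],
    where it tends to [0]. The level [k * X = 1], at which no limit is claimed, is put into [C]:
    hence a strict inequality on the left and a large one on the right. *)
Lemma moments_sublevel (k : nat) :
  (\int[mu]_(w in D `&` [set w | (k%:R * Y w < 1)%R]) (v w)%:E <=
   \int[mu]_(w in D `&` [set w | (k%:R * X w <= 1)%R]) (u w)%:E)%E.
Proof.
set A := D `&` _; set C := D `&` _; pose B := D `&` [set w | (1 < k%:R * X w)%R].
have mlt (f g : T -> R) : measurable_fun D f -> measurable_fun D g ->
    measurable (D `&` [set w | (f w < g w)%R]).
  by move=> mf mg; exact: (measurable_fun_ltr mf mg mD (Y := [set true])).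
have mle (f g : T -> R) : measurable_fun D f -> measurable_fun D g ->
    measurable (D `&` [set w | (f w <= g w)%R]).
  by move=> mf mg; exact: (measurable_fun_ler mf mg mD (Y := [set true])).
have mkZ (Z : T -> R) : measurable_fun D Z -> measurable_fun D (fun w => k%:R * Z w).
  by move=> mZ; apply: measurable_funM.
have mA : measurable A by apply: (mlt _ (cst 1)) => //; exact: mkZ.
have mC : measurable C by apply: (mle _ (cst 1)) => //; exact: mkZ.
have mB : measurable B by apply: (mlt (cst 1)) => //; exact: mkZ.
have AD : A `<=` D by exact: subIsetl.
have CD : C `<=` D by exact: subIsetl.
have BD : B `<=` D by exact: subIsetl.
have DE : D = C `|` B.
  apply/seteqP; split=> w; last by case=> [[]|[]].
  by move=> Dw; have [h|h] := leP (k%:R * X w) 1; [left|right].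
have CB : [disjoint C & B].
  by apply/disj_setPS => w [[_ /= h1] [_ /= h2]]; move: h1; rewrite leNgt h2.
have LA := limit_part mY mv Y01 iv mA AD
  (fun w (Aw : A w) => bdpoly_cvg1 (Y01 (AD _ Aw)) Aw.2).
have LB := limit_part mX mu_ X01 iu mB BD
  (fun w (Bw : B w) => bdpoly_cvg0 (X01 (BD _ Bw)) Bw.2).
have u0' w : D w -> (0 <= (u w)%:E)%E by move=> Dw; rewrite lee_fin u0.
have qu0 n w : D w -> (0 <= ((bdpoly k n).[X w] * u w)%:E)%E.
  by move=> Dw; rewrite lee_fin mulr_ge0 ?u0//; have /andP[] := bdpoly01 k n (X01 Dw).
have qv0 n w : D w -> (0 <= ((bdpoly k n).[Y w] * v w)%:E)%E.
  by move=> Dw; rewrite lee_fin mulr_ge0 ?v0//; have /andP[] := bdpoly01 k n (Y01 Dw).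
have mqu n : measurable_fun D (fun w => ((bdpoly k n).[X w] * u w)%:E).
  by have /integrableP[] := iq k n mX mu_ X01 iu.
have mqv n : measurable_fun D (fun w => ((bdpoly k n).[Y w] * v w)%:E).
  by have /integrableP[] := iq k n mY mv Y01 iv.
have le_n n : (\int[mu]_(w in A) ((bdpoly k n).[Y w] * v w)%:E <=
    \int[mu]_(w in C) (u w)%:E + \int[mu]_(w in B) ((bdpoly k n).[X w] * u w)%:E)%E.
  apply: le_trans (ge0_subset_integral mu mA mD (mqv n) (qv0 n) AD) _.
  rewrite -moments_poly [in leLHS]DE.
  rewrite (ge0_integral_setU mu mC mB) //; [|by rewrite -DE|by rewrite -DE; exact: qu0].
  rewrite leeD2r// ge0_le_integral//.
  - by move=> w /CD; exact: qu0.
  - exact: measurable_funS (mqu n).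
  - by apply/measurable_EFinP; exact: measurable_funS mu_.
  - move=> w /CD Dw; rewrite lee_fin ler_piMl ?u0//.
    by have /andP[] := bdpoly01 k n (X01 Dw).
have Cfin : (\int[mu]_(w in C) (u w)%:E)%E \is a fin_num.
  exact: (integrable_fin_num mC (integrableS mD mC CD iu)).
have B0 : (\int[mu]_(w in B) (0 * u w)%:E = 0)%E.
  by apply: integral0_eq => w _; rewrite mul0r.
have A1 : (\int[mu]_(w in A) (1 * v w)%:E = \int[mu]_(w in A) (v w)%:E)%E.
  by apply: eq_integral => w _; rewrite mul1r.
rewrite B0 in LB; rewrite A1 in LA.
have LC : (\int[mu]_(w in C) (u w)%:E + \int[mu]_(w in B) ((bdpoly k n).[X w] * u w)%:E
    @[n --> \oo] --> \int[mu]_(w in C) (u w)%:E)%E.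
  rewrite -[X in _ --> X]adde0; apply: cvgeD; [|exact: cvg_cst|exact: LB].
  by rewrite fin_num_adde_defr.
rewrite -(cvg_lim _ LA)// -[leRHS](cvg_lim _ LC)//.
by apply: lee_lim; [exact: cvgP LA|exact: cvgP LC|exact: nearW].
Qed.

End Moments.

(** * Preimages of small values *)

Section Counting.
Import finmap.

Lemma counting_neq1 (R : realType) (T : choiceType) (A : set T) x y : A x -> A y -> x != y ->
  counting A <> 1%E :> \bar R.
Proof.
move=> Ax Ay xy; rewrite /counting; case: asboolP => // fA [] /eqP.
rewrite pnatr_eq1 => /cardfs1P[a Aa].
have xa : x \in fset_set A by rewrite in_fset_set//; exact/mem_set.
have ya : y \in fset_set A by rewrite in_fset_set//; exact/mem_set.
by move: xa ya xy; rewrite Aa !in_fset1 => /eqP -> /eqP ->; rewrite eqxx.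
Qed.

End Counting.

Section Preimages.
Context {R : realType}.
Implicit Types (z w : R[i]) (phi : R[i] -> R[i]).

Lemma is_derive_order n (k f : R[i] -> R[i]) rho w d : normc w < rho ->
  (forall z, normc z < rho -> f z = z ^+ n.+1 * k z) -> is_derive w 1 k d ->
  is_derive w 1 f (n.+1%:R * w ^+ n * k w + w ^+ n.+1 * d).
Proof.
move=> wr fE dk; apply: (@is_derive_near R (fun z => z ^+ n.+1 * k z)).
  exists (rho - normc w); first by rewrite subr_gt0.
  move=> z zy; rewrite fE// -(subrK w z); apply: le_lt_trans (normcD_le _ _) _.
  by rewrite -ltrBrDr.
exact: (is_cderivM (is_cderivX n w) dk).
Qed.

(* A preimage of a small value away from [0] at which [phi' != 0] would, by the open
   mapping theorem, produce an open set of values with two preimages. *)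
Lemma preimage_near0 phi (U : set R[i]) (c d : R) m :
  analytic phi -> phi 0 = 0 -> nbhs (0 : R[i]) U ->
  {ae @area R, forall w : R * R, U (cplx w) -> card_preimage phi (cplx w) = 1%E} ->
  0 < c -> 0 < d -> d < 1 ->
  (forall z, normc z <= d -> c * normc z ^+ m <= normc (phi z)) ->
  exists2 e : R, 0 < e & forall z, unit_disc z -> derive1 phi z != 0 ->
    normc (phi z) < e -> normc z < d.
Proof.
move=> an phi0 /nbhs_normcP[eU eU0 UH] ae c0 d0 d1 cphi.
have dphi z : normc z < 1 -> derivable phi z 1 by move=> z1; apply: an; exact/unit_discE.
have d20 : 0 < d / 2 by rewrite divr_gt0.
(* A lower bound for [normc (phi w)] on the circle of radius [d / 2], so every value of modulus less
   than [M / 2] is taken inside it. *)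
pose M := c * (d / 2) ^+ m; have M0 : 0 < M by rewrite mulr_gt0// exprn_gt0.
have near0 v : normc v < M / 2 -> exists2 w, normc w < d / 2 & phi w = v.
  move=> vM; have [|||w wd <-] := @open_mapping R (d / 2) M phi 0 d20 M0 _ _ v.
  - move=> w; rewrite subr0 => wd; apply: dphi; lra.
  - move=> w; rewrite subr0 phi0 subr0 => wd; rewrite /M -wd; apply: cphi; lra.
  - by rewrite phi0 subr0.
  - by exists w; rewrite ?subr0 in wd *.
pose e := Num.min eU (M / 2).
have e0 : 0 < e by rewrite lt_min eU0 divr_gt0.
have eM : e <= M / 2 by rewrite ge_min lexx orbT.
exists e => // z /unit_discE z1 dz ze; rewrite ltNge; apply/negP => dz'.
set l := derive1 phi z in dz.
have l0 : 0 < normc l by rewrite normc_gt0.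
have l20 : 0 < normc l / 2 by rewrite divr_gt0.
have := derivable_is (dphi z z1) => /cderivP /(_ _ l20)[r1 r10 rH].
(* Within [r] of [z] the linear approximation holds, points stay in the unit disc and, as
   [d <= normc z], farther than [d / 2] from [0]: preimages found there differ from those found near
   [0]. *)
pose r := Num.min (r1 / 2) (Num.min (d / 2) ((1 - normc z) / 2)).
have r0 : 0 < r by rewrite !lt_min !divr_gt0// subr_gt0.
have rr1 : r < r1 by apply: le_lt_trans (_ : r1 / 2 < _); [rewrite ge_min lexx|lra].
have rd : r <= d / 2 by rewrite !ge_min lexx !orbT.
have rz : r <= (1 - normc z) / 2 by rewrite !ge_min lexx !orbT.
(* On the circle of radius [r] about [z] the error takes at most half of the linear term
   [normc l * r]. *)
pose N := normc l / 2 * r; have N0 : 0 < N by rewrite mulr_gt0.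
have nearz v : normc (v - phi z) < N / 2 -> exists2 w, normc (w - z) < r & phi w = v.
  apply: (@open_mapping R r N phi z r0 N0).
    move=> w wr; apply: dphi; rewrite -(subrK z w); apply: le_lt_trans (normcD_le _ _) _; lra.
  move=> w wr; have := rH (w - z); rewrite wr => /(_ rr1); rewrite [z + _]addrC subrK -/l => h.
  have h1 : normc (l * (w - z)) = normc l * r by rewrite normcM wr.
  have := normcB_ge (l * (w - z)) (l * (w - z) - (phi w - phi z)).
  rewrite subKr h1 (normcBC (l * (w - z)) (phi w - phi z)) => h2; rewrite /N; lra.
pose s := Num.min (N / 2) (e - normc (phi z)).
have s0 : 0 < s by rewrite lt_min divr_gt0// subr_gt0.
have [Z [mZ Z0 ZH]] := ae.
(* Each point of the disc of radius [s] about [phi z] lies in [U] and has two preimages, so a disc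
   of positive area would sit inside the null set [Z]. *)
have := area_disc_gt0 (phi z) s0; rewrite ltNge => /negP; apply.
rewrite -Z0; apply: le_measure; rewrite ?inE//.
  apply: (@measurable_cplx_open R [set y | normc (y - phi z) < s]) => y /= yz.
  exists (s - normc (y - phi z)); first by rewrite subr_gt0.
  move=> u uy /=; have -> : u - phi z = (u - y) + (y - phi z) by rewrite addrA subrK.
  by apply: le_lt_trans (normcD_le _ _) _; rewrite -ltrBrDr.
move=> w /= ws; apply: ZH => /= H.
have vN : normc (cplx w - phi z) < N / 2 by apply: lt_le_trans ws _; rewrite ge_min lexx.
have ve : normc (cplx w) < e.
  rewrite -(subrK (phi z) (cplx w)); apply: le_lt_trans (normcD_le _ _) _.
  by rewrite -ltrBrDr; apply: lt_le_trans ws _; rewrite ge_min lexx orbT.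
have vU : U (cplx w).
  by apply: UH; rewrite subr0; apply: lt_le_trans ve _; rewrite ge_min lexx.
have [w1 w1d w1E] := near0 _ (lt_le_trans ve eM).
have [w2 w2z w2E] := nearz _ vN.
have w2d : d / 2 < normc w2.
  have := normcB_ge z (z - w2); rewrite subKr (normcBC z w2) => h; lra.
have w2r : normc w2 < 1.
  by rewrite -(subrK z w2); apply: le_lt_trans (normcD_le _ _) _; lra.
have := H vU; rewrite /card_preimage; apply: (@counting_neq1 R _ _ w1 w2).
- by split => //; apply/unit_discE; lra.
- by split => //; apply/unit_discE.
- by apply/eqP => w12; move: w2d; rewrite -w12; lra.
Qed.

End Preimages.

(** * Test functions in the Besov space *)

Section Besov.
Context {R : realType}.
Variables (p : R) (hp : 2 < p).
Implicit Types (z l c : R[i]) (f phi : R[i] -> R[i]).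

Local Notation RR := (measurableTypeR R).
Local Notation plane := (measurableTypeR R * measurableTypeR R)%type.
Local Notation D := [set w : plane | unit_disc (cplx w)].

Let p0 : 0 < p. Proof. by apply: lt_trans hp. Qed.
Let p20 : 0 < p - 2. Proof. by rewrite subr_gt0. Qed.

Let wt (w : plane) : R := (1 - normc (cplx w) ^+ 2) `^ (p - 2).

Let open_unit_disc z : unit_disc z ->
  exists2 r : R, 0 < r & forall y, normc (y - z) < r -> unit_disc y.
Proof.
move=> /unit_discE z1; exists (1 - normc z); first by rewrite subr_gt0.
move=> y yz; apply/unit_discE; rewrite -(subrK z y); apply: le_lt_trans (normcD_le _ _) _.
by rewrite -ltrBrDr.
Qed.

Lemma continuous_normc (f : R[i] -> R[i]) z : {for z, continuous f} ->
  {for z, continuous (fun y => normc (f y))}.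
Proof.
move=> /continuous_normcP H A /nbhs_ballP[e /= e0 eA]; have /nbhs_normcP[r r0 rH] := H e e0.
apply/nbhs_normcP; exists r => // y /rH /= h; apply: eA; rewrite -ball_normE /=.
apply: le_lt_trans h; rewrite distrC ler_distl.
have := normcB_ge (f y) (f z); have := normcB_ge (f z) (f y); rewrite normcBC => h1 h2.
by apply/andP; split; lra.
Qed.

Let measurable_powR_normc f : (forall z, unit_disc z -> {for z, continuous f}) ->
  measurable_fun D (fun w => normc (f (cplx w)) `^ p).
Proof.
move=> cf; have mn : measurable_fun D (fun w => normc (f (cplx w)) : RR).
  apply: (@measurable_fun_cplx R unit_disc (fun z => normc (f z)) open_unit_disc) => z z1.
  by apply: continuous_normc; exact: cf.
exact: (measurableT_comp (measurable_powR p) mn).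
Qed.

Let measurable_wt : measurable_fun D wt.
Proof.
have cn : measurable_fun D (fun w => normc (cplx w) : RR).
  apply: (@measurable_fun_cplx R unit_disc (@normc R) open_unit_disc) => z _.
  by apply: (@continuous_normc id) => A.
have cm : measurable_fun D (fun w => 1 - normc (cplx w) ^+ 2 : RR).
  by apply: measurable_funB => //; exact: measurable_funX.
exact: (measurableT_comp (measurable_powR (p - 2)) cm).
Qed.

Let derive1_cont f : analytic f -> forall z, unit_disc z -> {for z, continuous (derive1 f)}.
Proof.
move=> af z /unit_discE z1; apply: (@derive1_continuous R ((1 - normc z) / 2)).
  by rewrite divr_gt0// subr_gt0.
move=> w wz; apply: af; apply/unit_discE; rewrite -(subrK z w).
by apply: le_lt_trans (normcD_le _ _) _; lra.
Qed.

Let besov_measurable f : analytic f ->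
  measurable_fun D (fun w => (normc (derive1 f (cplx w)) `^ p * wt w)%:E).
Proof.
move=> af; apply/measurable_EFinP; apply: measurable_funM => //.
exact: (@measurable_powR_normc (derive1 f) (derive1_cont af)).
Qed.

(** As [l] is unimodular, the integrand of the composite at [w] is that of [f] at [rot l w]. *)
Lemma rotation_besov_isometry phi : is_rotation phi -> besov_isometry p (comp_op phi).
Proof.
move=> [l [l1 phiE]] f [af fI]; have nl : normc l = 1.
  by move: l1; case: (l) => a b [].
have dfl z : unit_disc z -> is_derive z 1 (comp_op phi f) (derive1 f (l * z) * l).
  move=> z1; have lz : unit_disc (l * z) by apply/unit_discE; rewrite normcM nl mul1r; apply/unit_discE.
  have [r r0 rH] := open_unit_disc z1.
  apply: (@is_derive_near R (f \o (fun w => l * w))).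
    by exists r => // y /rH y1; rewrite /comp_op /= phiE.
  apply: is_derive_comp; last exact: derivable_is (af _ lz).
  by have := is_cderivZ l (is_cderiv_id z); rewrite mulr1.
have IE : besov_integral p (comp_op phi f) = besov_integral p f.
  have F0 w : D w -> (0 <= (normc (derive1 f (cplx w)) `^ p * wt w)%:E)%E.
    by move=> _; rewrite lee_fin mulr_ge0 ?powR_ge0.
  have E := integral_rot nl (besov_measurable af) F0.
  apply: etrans (esym E); apply: eq_integral => w; rewrite inE => w1.
  by rewrite /wt cplx_rot (derive1_is (dfl _ w1)) !normcM nl mulr1 mul1r.
split; first by split; [move=> z /dfl[]|rewrite IE].
have d0 : unit_disc (0 : R[i]) by apply/unit_discE; rewrite normc0; exact: ltr01.
have phi0 : phi 0 = 0 by have := phiE 0 d0; rewrite mulr0.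
rewrite /besov_norm /besov_seminorm IE.
by congr (normc (f _) + _); exact: phi0.
Qed.

(** Normalized to have derivative [z ^ n]; the constant [c] moves the value at [0] and leaves the
    seminorm alone. *)
Let testf n c z : R[i] := n.+1%:R^-1 * z ^+ n.+1 + c.

Let is_derive_testf n c z : is_derive z 1 (testf n c) (z ^+ n).
Proof.
have := is_cderivD (is_cderivZ n.+1%:R^-1 (is_cderivX n z)) (is_cderiv_cst c z).
by rewrite addr0 mulrA mulVf ?mul1r// pnatr_eq0.
Qed.

Let powR_le1 (x r : R) : 0 <= r -> 0 <= x -> x <= 1 -> x `^ r <= 1.
Proof.
move=> r0 x0 x1; have e : 1 `^ r = 1 :> R by rewrite powR1.
by rewrite -[leRHS]e; apply: ge0_ler_powR; rewrite ?nnegrE.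
Qed.

Let wt_ge0 w : 0 <= wt w. Proof. exact: powR_ge0. Qed.

Let wt_le1 w : D w -> wt w <= 1.
Proof.
move=> /unit_discE w1; apply: powR_le1; first exact: ltW.
  by rewrite subr_ge0 exprn_ile1 ?normc_ge0// ltW.
by rewrite gerBl exprn_ge0 ?normc_ge0.
Qed.

Let powR_normcX z n : normc (z ^+ n) `^ p = (normc z `^ p) ^+ n.
Proof.
rewrite normcX; move: (normc z) (normc_ge0 z) => x x0.
rewrite -(powR_mulrn n x0) -(powR_mulrn n (powR_ge0 x p)); exact: powRAC.
Qed.

Let powR_normc01 z : normc z <= 1 -> 0 <= normc z `^ p <= 1.
Proof.
by move=> z1; rewrite powR_ge0 powR_le1 ?normc_ge0// ltW.
Qed.

Let integral_testf n c : (besov_integral p (testf n c) =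
  \int[area]_(w in D) ((normc (cplx w) `^ p) ^+ n * wt w)%:E)%E.
Proof.
apply: eq_integral => w _.
by rewrite (derive1_is (is_derive_testf n c _)) powR_normcX.
Qed.

Let besov_testf n c : besov p (testf n c).
Proof.
split; first by move=> z _; have [] := is_derive_testf n c z.
rewrite integral_testf; apply: (@le_lt_trans _ _ (\int[area]_(w in D) (cst 1%E) w)%E).
  apply: ge0_le_integral => //.
  - exact: measurable_unit_disc.
  - by move=> w _; rewrite lee_fin mulr_ge0 ?exprn_ge0 ?powR_ge0.
  - apply/measurable_EFinP; apply: measurable_funM => //; apply: measurable_funX.
    by apply: (@measurable_powR_normc id) => z _ A.
  - move=> w w1; rewrite lee_fin mulr_ile1 ?exprn_ge0 ?powR_ge0 ?wt_le1//.
    have /andP[h1 h2] := powR_normc01 (ltW (proj1 (unit_discE _) w1)).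
    by rewrite exprn_ile1.
rewrite integral_cst ?mul1e; last exact: measurable_unit_disc.
apply: (@le_lt_trans _ _ (area ([set w : plane | (normc (cplx w) < 1)%R]))); last exact: area_disc_lty.
apply: le_measure; rewrite ?inE; [exact: measurable_unit_disc|exact: measurable_disc|].
by move=> w /unit_discE.
Qed.

Let powR_invK (x : R) : 0 <= x -> (x `^ p^-1) `^ p = x.
Proof. by move=> x0; rewrite -powRrM mulVf ?powRr1// gt_eqF. Qed.

Let I0 f : (0 <= besov_integral p f)%E.
Proof. by apply: integral_ge0 => w _; rewrite lee_fin mulr_ge0 ?powR_ge0. Qed.

Local Notation disc r := [set w : plane | (normc (cplx w) < r)%R].

(** On the left the set contains the disc of radius [r], where the weight is at least
    [(1 - r ^ 2) ^ (p - 2)]. On the right the points with nonzero derivative lie in the disc of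
    radius [rho], where the density is at most [K ^ p]. Both areas are multiples of that of the unit
    disc. *)
Lemma sublevel_ineq phi (k : nat) (r rho K : R) : analytic phi ->
  (\int[area]_(w in D `&` [set w | (k%:R * normc (cplx w) `^ p < 1)%R]) (wt w)%:E <=
   \int[area]_(w in D `&` [set w | (k%:R * normc (phi (cplx w)) `^ p <= 1)%R])
     (normc (derive1 phi (cplx w)) `^ p * wt w)%:E)%E ->
  (0 < k)%N -> 0 < r < 1 -> r `^ p = k%:R^-1 -> 0 < rho -> 0 <= K ->
  (forall z, unit_disc z -> derive1 phi z != 0 -> normc (phi z) <= r ->
     normc z < rho /\ normc (derive1 phi z) <= K) ->
  (1 - r ^+ 2) `^ (p - 2) * r ^+ 2 <= K `^ p * rho ^+ 2.
Proof.
move=> an + k0 /andP[r0 r1] rk rho0 K0 small.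
set A := _ `&` [set w | (_ < _)%R]; set C := _ `&` [set w | (_ <= _)%R] => AC.
have kr : k%:R * r `^ p = 1 by rewrite rk mulfV// pnatr_eq0 -lt0n.
have k0R : 0 < k%:R :> R by rewrite ltr0n.
have mD := @measurable_unit_disc R.
have mk (Z : plane -> RR) : measurable_fun D Z -> measurable_fun D (fun w => k%:R * Z w : RR).
  by move=> mZ; apply: measurable_funM => //; exact: measurable_cst.
have mY : measurable_fun D (fun w => normc (cplx w) `^ p : RR).
  by apply: (@measurable_powR_normc id) => z _ Z.
have mX : measurable_fun D (fun w => normc (phi (cplx w)) `^ p : RR).
  apply: measurable_powR_normc => z z1.
  by apply: is_derive_continuous; apply: derivable_is; exact: an.
have mlt (f g : plane -> RR) : measurable_fun D f -> measurable_fun D g ->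
    measurable (D `&` [set w | (f w < g w)%R]).
  by move=> mf mg; exact: (measurable_fun_ltr mf mg mD (Y := [set true])).
have mle (f g : plane -> RR) : measurable_fun D f -> measurable_fun D g ->
    measurable (D `&` [set w | (f w <= g w)%R]).
  by move=> mf mg; exact: (measurable_fun_ler mf mg mD (Y := [set true])).
have m1 : measurable_fun D (fun=> 1 : RR) by exact: measurable_cst.
have mA : measurable A by exact: (mlt _ _ (mk _ mY) m1).
have mC : measurable C by exact: (mle _ _ (mk _ mX) m1).
have AD : A `<=` D by exact: subIsetl.
have CD : C `<=` D by exact: subIsetl.
have mr := @measurable_disc R r; have mrho := @measurable_disc R rho.
have rA : disc r `<=` A.
  move=> w /= wr; split; first by apply/unit_discE; exact: lt_trans r1.
  rewrite /= -[ltRHS]kr ltr_pM2l//.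
  by apply: gt0_ltr_powR; rewrite // nnegrE ?normc_ge0// ltW.
have mwt : measurable_fun D (fun w => (wt w)%:E) by exact/measurable_EFinP.
have lower : (((1 - r ^+ 2) `^ (p - 2))%:E * area (disc r) <= \int[area]_(w in A) (wt w)%:E)%E.
  rewrite -(integral_cst area mr ((1 - r ^+ 2) `^ (p - 2))%:E).
  apply: (@le_trans _ _ (\int[area]_(w in disc r) (wt w)%:E)%E).
    apply: ge0_le_integral; first exact: mr.
    - by move=> w _; rewrite lee_fin powR_ge0.
    - exact: measurable_cst.
    - exact: (measurable_funS mD (subset_trans rA AD) mwt).
    - move=> w /= wr; rewrite lee_fin; apply: ge0_ler_powR; first exact: ltW.
      + by rewrite nnegrE subr_ge0 exprn_ile1 ?ltW.
      + by rewrite nnegrE subr_ge0 exprn_ile1 ?normc_ge0// ltW// (lt_trans wr).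
      + by rewrite lerD2l lerN2 lerXn2r ?nnegrE ?normc_ge0 ?ltW.
  apply: ge0_subset_integral; [exact: mr|exact: mA| |by move=> w _; rewrite lee_fin|exact: rA].
  exact: (measurable_funS mD AD mwt).
have upper : (\int[area]_(w in C) (normc (derive1 phi (cplx w)) `^ p * wt w)%:E <=
    (K `^ p)%:E * area (disc rho))%E.
  have mI : measurable_fun C (fun w : plane => (\1_(disc rho) w : R)%:E).
    by apply/measurable_EFinP; apply: measurable_funTS; exact: measurable_indic.
  apply: (@le_trans _ _ (\int[area]_(w in C) ((K `^ p)%:E * (\1_(disc rho) w : R)%:E))%E).
    apply: ge0_le_integral; first exact: mC.
    - by move=> w _; rewrite lee_fin mulr_ge0 ?powR_ge0.
    - exact: (measurable_funS mD CD (besov_measurable an)).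
    - exact: (measurable_funeM _ mI).
    - move=> w [w1 /= wk]; rewrite -EFinM lee_fin.
      (* Since [0 ^ p = 0], critical points of [phi] contribute nothing, wherever they lie. *)
      have [d0|dn0] := eqVneq (derive1 phi (cplx w)) 0.
        by rewrite d0 normc0 powR0 ?gt_eqF// mul0r mulr_ge0 ?powR_ge0.
      have wr : normc (phi (cplx w)) <= r.
        rewrite leNgt; apply/negP => rw; move: wk; rewrite -[leRHS]kr ler_pM2l// leNgt => /negP; apply.
        by apply: gt0_ltr_powR; rewrite // nnegrE ?normc_ge0// ltW.
      have [zrho dK] := small _ w1 dn0 wr.
      rewrite indicE mem_set//= ler_pM ?powR_ge0 ?wt_le1//.
      by apply: ge0_ler_powR; rewrite ?nnegrE ?normc_ge0// ltW.
  rewrite (ge0_integralZl_EFin area mC _ mI (powR_ge0 K p)); last first.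
    by move=> w _; rewrite lee_fin.
  rewrite integral_indic//; apply: lee_wpmul2l; first by rewrite lee_fin powR_ge0.
  by apply: le_measure; rewrite ?inE//; (exact: measurableI || exact: subIsetl).
have := le_trans lower (le_trans AC upper).
rewrite (area_disc_scale r0) (area_disc_scale rho0).
have aoo := @area_disc_lty R 1.
have a0 : (0 < area (disc 1))%E.
  have := @area_disc_gt0 R 0 1 ltr01; rewrite (_ : [set w : plane | _] = disc 1)//.
  by congr mkset; apply/funext => w; rewrite subr0.
move: a0 aoo; case: (area _) => [a| |] // + _; rewrite lte_fin => a0.
by rewrite -!EFinM lee_fin !mulrA ler_pM2r.
Qed.

Let measurable_density f : analytic f ->
  measurable_fun D (fun w => normc (derive1 f (cplx w)) `^ p * wt w).
Proof. by move=> an; apply/measurable_EFinP; exact: besov_measurable. Qed.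

Let integral_wt : besov_integral p (testf 0 0) = (\int[area]_(w in D) (wt w)%:E)%E.
Proof. by rewrite integral_testf; apply: eq_integral => w _; rewrite expr0 mul1r. Qed.

Let integrable_of_finite (s : plane -> R) : measurable_fun D s -> (forall w, 0 <= s w) ->
  (\int[area]_(w in D) (s w)%:E < +oo)%E -> area.-integrable D (EFin \o s).
Proof.
move=> ms s0 sf; apply/integrableP; split; first exact/measurable_EFinP.
rewrite (_ : (fun _ => _) = (fun w => (s w)%:E))//.
by apply/funext => w /=; rewrite ger0_norm.
Qed.

Section Isometry.
Variable phi : R[i] -> R[i].
Hypotheses (aphi : analytic phi) (phi1 : forall z, unit_disc z -> unit_disc (phi z))
  (iso : besov_isometry p (comp_op phi)).

Let integral_testf_comp n c : (besov_integral p (comp_op phi (testf n c)) =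
  \int[area]_(w in D) ((normc (phi (cplx w)) `^ p) ^+ n *
    (normc (derive1 phi (cplx w)) `^ p * wt w))%:E)%E.
Proof.
apply: eq_integral => w; rewrite inE /= => w1.
have := is_derive_comp (derivable_is (aphi w1)) (is_derive_testf n c _).
by move=> /derive1_is ->; rewrite normcM powRM ?normc_ge0// powR_normcX mulrA.
Qed.

(** Seminorms do not see [c], so both are written at [c = 0] while the values at the origin still
    vary with [c]. *)
Let seminorm_eq n c : normc (testf n c (phi 0)) +
    besov_seminorm p (comp_op phi (testf n 0)) = normc c + besov_seminorm p (testf n 0).
Proof.
have [_] := iso (besov_testf n c); rewrite /besov_norm /besov_seminorm.
rewrite !integral_testf !integral_testf_comp /comp_op => ->.
by rewrite /testf expr0n /= mulr0 add0r.
Qed.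

(** With [c = 0] the modulus of [phi 0] is added to the seminorm of the composite, with
    [c = - phi 0] to the other one; subtracting gives [2 * normc (phi 0) = 0]. *)
Lemma isometry_fixes0 : phi 0 = 0.
Proof.
have t c : testf 0 c (phi 0) = phi 0 + c by rewrite /testf expr1 invr1 mul1r.
have h1 := seminorm_eq 0 0; have h2 := seminorm_eq 0 (- phi 0).
rewrite (t 0) addr0 normc0 add0r in h1; rewrite (t (- phi 0)) subrr normc0 add0r normcN in h2.
apply/eqP; rewrite -normc_eq0; apply/eqP.
move: (normc (phi 0)) (besov_seminorm p (comp_op phi (testf 0 0)))
  (besov_seminorm p (testf 0 0)) h1 h2 => x y z; lra.
Qed.

Lemma isometry_moments n :
  (\int[area]_(w in D) ((normc (phi (cplx w)) `^ p) ^+ n *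
    (normc (derive1 phi (cplx w)) `^ p * wt w))%:E =
   \int[area]_(w in D) ((normc (cplx w) `^ p) ^+ n * wt w)%:E)%E.
Proof.
have [_ f1] := besov_testf n 0; have [[_ f2] _] := iso (besov_testf n 0).
(* The seminorm goes through [fine], which sends [+oo] to [0]: equality of seminorms gives equality
   of integrals only once both are known to be finite. *)
have k1 : besov_integral p (testf n 0) \is a fin_num.
  by rewrite (ge0_fin_numE (I0 _)); exact: f1.
have k2 : besov_integral p (comp_op phi (testf n 0)) \is a fin_num.
  by rewrite (ge0_fin_numE (I0 _)); exact: f2.
have t : testf n 0 (phi 0) = 0 by rewrite /testf isometry_fixes0 expr0n /= mulr0 addr0.
have h : besov_seminorm p (comp_op phi (testf n 0)) = besov_seminorm p (testf n 0).
  move: (seminorm_eq n 0); rewrite t normc0.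
  by move: (besov_seminorm p (comp_op phi (testf n 0))) (besov_seminorm p (testf n 0)) => x y;
    rewrite !add0r.
have E : fine (besov_integral p (comp_op phi (testf n 0))) = fine (besov_integral p (testf n 0)).
  rewrite -[LHS](powR_invK (fine_ge0 (I0 _))) -[RHS](powR_invK (fine_ge0 (I0 _))).
  exact: (congr1 (fun x => x `^ p) h).
apply: (etrans (esym (integral_testf_comp n 0))); apply: (etrans _ (integral_testf n 0)).
exact: (etrans (esym (fineK k2)) (etrans (congr1 EFin E) (fineK k1))).
Qed.

Let measurable_phi z : unit_disc z -> {for z, continuous phi}.
Proof. by move=> z1; apply: is_derive_continuous; apply: derivable_is; exact: aphi. Qed.

Let integral_density : besov_integral p (comp_op phi (testf 0 0)) =
  (\int[area]_(w in D) (normc (derive1 phi (cplx w)) `^ p * wt w)%:E)%E.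
Proof. by rewrite integral_testf_comp; apply: eq_integral => w _; rewrite expr0 mul1r. Qed.

Let integrable_density :
  area.-integrable D (EFin \o (fun w => normc (derive1 phi (cplx w)) `^ p * wt w)).
Proof.
apply: integrable_of_finite; first exact: measurable_density.
  by move=> w; rewrite mulr_ge0 ?powR_ge0.
by rewrite -integral_density; have [[_ f] _] := iso (besov_testf 0 0); exact: f.
Qed.

Let integrable_wt : area.-integrable D (EFin \o wt).
Proof.
apply: integrable_of_finite; [exact: measurable_wt|exact: wt_ge0|].
by rewrite -integral_wt; have [_ f] := besov_testf 0 0; exact: f.
Qed.

Lemma isometry_sublevel (k : nat) :
  (\int[area]_(w in D `&` [set w | (k%:R * normc (cplx w) `^ p < 1)%R]) (wt w)%:E <=
   \int[area]_(w in D `&` [set w | (k%:R * normc (phi (cplx w)) `^ p <= 1)%R])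
     (normc (derive1 phi (cplx w)) `^ p * wt w)%:E)%E.
Proof.
apply: (@moments_sublevel R _ _ area D (fun w => normc (phi (cplx w)) `^ p)
  (fun w => normc (cplx w) `^ p) (fun w => normc (derive1 phi (cplx w)) `^ p * wt w) wt).
- exact: measurable_unit_disc.
- by apply: measurable_powR_normc; exact: measurable_phi.
- by apply: (@measurable_powR_normc id) => z _ A.
- exact: measurable_density.
- exact: measurable_wt.
- by move=> w w1; apply: powR_normc01; apply: ltW; apply/unit_discE; exact: phi1.
- by move=> w w1; apply: powR_normc01; apply: ltW; apply/unit_discE; exact: w1.
- by move=> w _; rewrite mulr_ge0 ?powR_ge0.
- by move=> w _; exact: wt_ge0.
- exact: integrable_density.
- exact: integrable_wt.
- exact: isometry_moments.
Qed.

End Isometry.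
End Besov.

(** * The derivative at the origin *)

Section Conclusion.
Context {R : realType}.
Variables (p : R) (hp : 2 < p).
Implicit Types (z : R[i]).

Let p0 : 0 < p. Proof. by apply: lt_trans hp. Qed.
Let p20 : 0 < p - 2. Proof. by rewrite subr_gt0. Qed.

Let powR_split (x : R) : 0 < x -> x `^ p = x `^ (p - 2) * x ^+ 2.
Proof.
move=> x0; rewrite -powR_mulrn ?ltW// -powRD; last by apply/implyP => _; rewrite gt_eqF.
by rewrite subrK.
Qed.

(** Take [r = k ^ (- 1 / p)] with [k > t ^ (- p)]. *)
Let exists_small_radius (t : R) : 0 < t ->
  exists k r, [/\ (0 < k)%N, 0 < r < t & r `^ p = k%:R^-1].
Proof.
move=> t0; have tp : 0 < t `^ p by exact: powR_gt0.
pose k := (Num.bound ((t `^ p)^-1)).+1; exists k, (k%:R^-1 `^ p^-1).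
have k0 : 0 < k%:R^-1 :> R by rewrite invr_gt0.
have pK (x : R) : 0 <= x -> (x `^ p^-1) `^ p = x.
  by move=> x0; rewrite -powRrM mulVf ?powRr1// gt_eqF.
have Kp (x : R) : 0 <= x -> (x `^ p) `^ p^-1 = x.
  by move=> x0; rewrite -powRrM mulfV ?powRr1// gt_eqF.
split => //; last by rewrite pK// ltW.
rewrite powR_gt0//= -[ltRHS](Kp t (ltW t0)); apply: gt0_ltr_powR.
- by rewrite invr_gt0.
- by rewrite nnegrE ltW.
- by rewrite nnegrE ltW.
rewrite -[ltRHS]invrK ltf_pV2 ?posrE ?invr_gt0//.
apply: lt_trans (_ : (Num.bound ((t `^ p)^-1))%:R < _); last by rewrite ltr_nat.
by apply: archi_boundP; rewrite invr_ge0 ltW.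
Qed.

Variables (phi : R[i] -> R[i]) (U : set R[i]).
Hypotheses (aphi : analytic phi) (phi0 : phi 0 = 0)
  (U_nbhs : nbhs (0 : R[i]) U)
  (n_phi : {ae @area R, forall w : R * R, U (cplx w) -> card_preimage phi (cplx w) = 1%E}).

(** The local form in which the comparison of measures reaches the origin; [sublevel_ineq] supplies
    it. *)
Hypothesis ineq : forall (k : nat) (r rho K : R),
  (0 < k)%N -> 0 < r < 1 -> r `^ p = k%:R^-1 -> 0 < rho -> 0 <= K ->
  (forall z, unit_disc z -> derive1 phi z != 0 -> normc (phi z) <= r ->
     normc z < rho /\ normc (derive1 phi z) <= K) ->
  (1 - r ^+ 2) `^ (p - 2) * r ^+ 2 <= K `^ p * rho ^+ 2.

Let dphi z : normc z < 1 -> derivable phi z 1.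
Proof. by move=> z1; apply: aphi; apply/unit_discE. Qed.

(** If [phi] were identically [0], so would be [phi'], and [ineq] with [K = 0] would bound a
    positive number by [0]. The order is a successor because [phi 0 = 0]. *)
Let order0 : exists rho m k B, [/\ 0 < rho < 1, 0 < B, k 0 != 0,
  forall z, normc z < rho -> phi z = z ^+ m.+1 * k z &
  forall z, normc z <= rho / 2 -> 
    [/\ derivable k z 1, normc (k z) <= B & normc (derive1 k z) <= B]].
Proof.
apply/not_existsP => H.
have zero z : normc z < 1 -> phi z = 0.
  move=> z1; pose rho := (1 + normc z) / 2.
  have nz := normc_ge0 z.
  have r0 : 0 < rho by rewrite /rho; lra.
  have r1 : rho < 1 by rewrite /rho; lra.
  have zr : normc z < rho by rewrite /rho; lra.
  have dr w : normc w <= rho -> derivable phi w 1.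
    by move=> wr; apply: dphi; exact: le_lt_trans r1.
  have [h|[n [k [kE k0 [B B0 kB]]]]] := order_expansion r0 dr; first exact: h.
  case: n kE => [|n] kE.
    move: k0; have := kE 0; rewrite normc0 => /(_ r0); rewrite phi0 expr0 mul1r => <-.
    by rewrite eqxx.
  by case: (H rho); exists n, k, B; split => //; rewrite r0.
have d0 z : unit_disc z -> derive1 phi z = 0.
  move=> /unit_discE z1; apply: derive1_is.
  apply: (@is_derive_near R (fun=> 0) phi _ _ _ (is_cderiv_cst 0 z)).
  exists (1 - normc z); first by rewrite subr_gt0.
  move=> y yz; rewrite zero// -(subrK z y); apply: le_lt_trans (normcD_le _ _) _.
  by rewrite -ltrBrDr.
have [k [r [k0 r01 rk]]] := exists_small_radius (@ltr01 R).
have /andP[r0 r1] := r01.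
have small z : unit_disc z -> derive1 phi z != 0 -> normc (phi z) <= r ->
    normc z < 1 /\ normc (derive1 phi z) <= 0.
  by move=> /d0 ->; rewrite eqxx.
have := ineq k0 r01 rk (@ltr01 R) (lexx 0) small.
rewrite powR0 ?gt_eqF// mul0r leNgt => /negP; apply; rewrite mulr_gt0 ?exprn_gt0//.
by apply: powR_gt0; rewrite subr_gt0 exprn_ilt1 ?ltW.
Qed.

(** A value less than [1] is refuted separately for a simple zero and for a zero of higher order,
    with [ineq] at a small radius [r] each time. In the first case the constants must approach
    [normc (phi' 0)]; in the second crude constants do, since a power of the radius tends to [0]. *)
Lemma derive1_0_ge1 : 1 <= normc (derive1 phi 0).
Proof.
rewrite leNgt; apply/negP => l1.
have [rho [m [k [B [/andP[rho0 rho1] B0 k0 phiE kB]]]]] := order0.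
have rho20 : 0 < rho / 2 by rewrite divr_gt0.
have rho2r : rho / 2 < rho by rewrite ltr_pdivrMr// ltr_pMr// ltr1n.
have dE z : normc z <= rho / 2 ->
    derive1 phi z = m.+1%:R * z ^+ m * k z + z ^+ m.+1 * derive1 k z.
  move=> zr; have [dk _ _] := kB z zr; apply: derive1_is.
  exact: (is_derive_order (le_lt_trans zr rho2r) phiE (derivable_is dk)).
have z0 : normc (0 : R[i]) <= rho / 2 by rewrite normc0 ltW.
have ck : {for 0, continuous k}.
  by have [dk _ _] := kB 0 z0; apply: is_derive_continuous; exact: derivable_is dk.
have l0 : 0 < normc (k 0) by rewrite normc_gt0.
(* [preimage_near0] first confines [z] to the disc of radius [d], where the expansion of [phi] is
   available; the lower bound [c * normc z ^ m.+1] for the modulus of [phi z] then sharpens this to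
   [normc z < s]. *)
have localise c d : 0 < c -> 0 < d -> d < rho -> (forall z, normc z <= d -> c < normc (k z)) ->
    exists2 e : R, 0 < e & forall z r, unit_disc z -> derive1 phi z != 0 -> normc (phi z) <= r ->
      r < e -> normc z < d /\ forall s, 0 < s -> c * s ^+ m.+1 = r -> normc z < s.
  move=> c0 d0 dr ckz.
  have lower z : normc z <= d -> c * normc z ^+ m.+1 <= normc (phi z).
    move=> zd; rewrite phiE ?(le_lt_trans zd)// normcM normcX mulrC.
    by rewrite ler_wpM2l ?exprn_ge0 ?normc_ge0// ltW// ckz.
  have [e e0 eH] := preimage_near0 aphi phi0 U_nbhs n_phi c0 d0 (lt_trans dr rho1) lower.
  exists e => // z r z1 dz zr re; have zd := eH z z1 dz (le_lt_trans zr re).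
  split => // s s0 sr; rewrite ltNge; apply/negP => sz.
  have nz : 0 < normc z by exact: lt_le_trans sz.
  have : c * normc z ^+ m.+1 < normc (phi z).
    rewrite phiE ?(lt_trans zd)// normcM normcX mulrC ltr_pM2l ?exprn_gt0//.
    by apply: ckz; exact: ltW.
  rewrite ltNge => /negP; apply; apply: le_trans zr _; rewrite -sr ler_wpM2l ?(ltW c0)//.
  by rewrite lerXn2r// nnegrE ltW.
case: m phiE dE localise => [|m] phiE dE localise.
  have d0k : derive1 phi 0 = k 0 by rewrite dE// expr0 expr1 mul0r addr0 !mul1r.
  rewrite d0k in l1; set l := normc (k 0) in l0 l1 *.
  have lp : l `^ p < l ^+ 2.
    rewrite (powR_split l0) gtr_pMl ?exprn_gt0//.
    have e1 : 1 `^ (p - 2) = 1 :> R by rewrite powR1.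
    by rewrite -[ltRHS]e1; apply: gt0_ltr_powR; rewrite // nnegrE ?ltW.
  (* These cut [[l ^ p, l ^ 2]] into thirds. With [C ^ p = t1] and [c ^ 2 = t2] one has [c < l < C],
     so near [0] [c] bounds [normc (k z)] below and [C] bounds the derivative above, while
     [C ^ p / c ^ 2 = t1 / t2 < 1]. *)
  pose t1 := (2 * l `^ p + l ^+ 2) / 3; pose t2 := (l `^ p + 2 * l ^+ 2) / 3.
  have lp0 : 0 < l `^ p by exact: powR_gt0.
  have t10 : 0 < t1 by rewrite /t1; lra.
  have t12 : t1 < t2 by rewrite /t1 /t2; lra.
  have t20 : 0 < t2 by exact: lt_trans t12.
  have lt1 : l `^ p < t1 by rewrite /t1; lra.
  have t2l : t2 < l ^+ 2 by rewrite /t2; lra.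
  pose C := t1 `^ p^-1; pose c := Num.sqrt t2.
  have Cp : C `^ p = t1 by rewrite /C -powRrM mulVf ?gt_eqF// powRr1// ltW.
  have c2 : c ^+ 2 = t2 by rewrite sqr_sqrtr// ltW.
  have c0 : 0 < c by rewrite sqrtr_gt0.
  have C0 : 0 < C by exact: powR_gt0.
  have cl : c < l by rewrite -(@ltr_pXn2r _ 2)// ?nnegrE ?ltW// c2.
  have lC : l < C.
    rewrite ltNge; apply/negP => Cl.
    have h : C `^ p <= l `^ p by apply: ge0_ler_powR; rewrite ?nnegrE// ltW.
    by move: h; rewrite Cp leNgt lt1.
  have lc : 0 < l - c by rewrite subr_gt0.
  have Cl : 0 < C - l by rewrite subr_gt0.
  have /continuous_normcP /(_ _ lc) /nbhs_normcP[r1 r10 H1] := ck.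
  have cd : {for 0, continuous (derive1 phi)}.
    have dw w : normc (w - 0) <= rho / 2 -> derivable phi w 1.
      by rewrite subr0 => wr; apply: dphi; apply: le_lt_trans wr _; exact: lt_trans rho1.
    exact: derive1_continuous rho20 dw.
  have /continuous_normcP /(_ _ Cl) /nbhs_normcP[r2 r20 H2] := cd.
  pose d := Num.min (rho / 2) (Num.min (r1 / 2) (r2 / 2)).
  have d0 : 0 < d by rewrite !lt_min rho20 !divr_gt0.
  have dr : d < rho by apply: le_lt_trans rho2r; rewrite ge_min lexx.
  have dr1 : d < r1 by apply: le_lt_trans (_ : r1 / 2 < _); [rewrite !ge_min lexx orbT|lra].
  have dr2 : d < r2 by apply: le_lt_trans (_ : r2 / 2 < _); [rewrite !ge_min lexx !orbT|lra].
  have kc z : normc z <= d -> c < normc (k z).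
    move=> zd; have := H1 z; rewrite subr0 => /(_ (le_lt_trans zd dr1)) /= h.
    have := normcB_ge (k 0) (k 0 - k z); rewrite subKr (normcBC (k 0)) -/l => h'; lra.
  have dC z : normc z <= d -> normc (derive1 phi z) <= C.
    move=> zd; have := H2 z; rewrite subr0 => /(_ (le_lt_trans zd dr2)) /= h.
    have := normcB_ge (derive1 phi z) (derive1 phi 0); rewrite d0k -/l => h'.
    by move: h; rewrite d0k => h; lra.
  have [e e0 eH] := localise c d c0 d0 dr kc.
  (* [q] lies halfway between [t1 / t2] and [1]. From [r < 1 - y] follows [y <= 1 - r ^ 2], so the
     weight is at least [y ^ (p - 2) = q > t1 / t2], against [ineq]. *)
  pose q := (t1 / t2 + 1) / 2; pose y := q `^ (p - 2)^-1.
  have t12' : t1 / t2 < 1 by rewrite ltr_pdivrMr// mul1r.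
  have t120 : 0 < t1 / t2 by rewrite divr_gt0.
  have q0 : 0 < q by rewrite /q; lra.
  have q1 : q < 1 by rewrite /q; lra.
  have tq : t1 / t2 < q by rewrite /q; lra.
  have y0 : 0 < y by exact: powR_gt0.
  have yq : y `^ (p - 2) = q by rewrite /y -powRrM mulVf ?gt_eqF// powRr1// ltW.
  have y1 : y < 1.
    have e1 : 1 `^ (p - 2)^-1 = 1 :> R by rewrite powR1.
    by rewrite -[ltRHS]e1; apply: gt0_ltr_powR; rewrite ?invr_gt0// nnegrE ?ltW.
  have tau0 : 0 < Num.min e (1 - y) by rewrite lt_min e0 subr_gt0.
  have [n [r [n0 /andP[r0]]]] := exists_small_radius tau0.
  rewrite lt_min => /andP[re ry] rn.
  have r11 : r < 1 by apply: lt_trans ry _; rewrite ltrBlDr ltrDl.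
  have s0 : 0 < r / c by rewrite divr_gt0.
  have sr : c * (r / c) ^+ 1 = r by rewrite expr1 mulrC divfK// gt_eqF.
  have r01 : 0 < r < 1 by rewrite r0.
  have small z : unit_disc z -> derive1 phi z != 0 -> normc (phi z) <= r ->
      normc z < r / c /\ normc (derive1 phi z) <= C.
    move=> z1 dz zr; have [zd zs] := eH z r z1 dz zr re.
    by split; [exact: zs s0 sr|exact: dC (ltW zd)].
  have := ineq n0 r01 rn s0 (ltW C0) small.
  rewrite Cp expr_div_n c2 (mulrA t1) (mulrAC t1) ler_pM2r ?exprn_gt0// leNgt => /negP; apply.
  apply: (lt_le_trans tq).
  rewrite -yq; apply: ge0_ler_powR; rewrite ?nnegrE ?(ltW p20) ?(ltW y0)//.
    by rewrite subr_ge0 exprn_ile1 ?ltW.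
  rewrite lerBrDr -lerBrDl; apply: le_trans (ltW ry).
  by rewrite expr2 ger_pMr// ltW.
(* Zero of order [m.+2]. With [c * s ^ m.+2 = r], after cancelling [s ^ 2] and up to constants,
   [ineq] reads [(s ^ m.+1) ^ 2 <= (s ^ m.+1) ^ p], false for small [s]. *)
have half : 1 - 2^-1 = 2^-1 :> R by field.
pose l := normc (k 0); pose c := l / 2; have c0 : 0 < c by rewrite divr_gt0.
(* The two terms of the derivative of [z ^ m.+2 * k z]; [normc z <= 1] reduces the second to the
   power [m.+1]. *)
pose C := m.+2%:R * B + B; have C0 : 0 < C by rewrite addr_gt0// mulr_gt0// ltr0n.
have /continuous_normcP /(_ _ c0) /nbhs_normcP[r1 r10 H1] := ck.
pose d := Num.min (rho / 2) (r1 / 2).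
have d0 : 0 < d by rewrite !lt_min rho20 !divr_gt0.
have drho2 : d <= rho / 2 by rewrite ge_min lexx.
have dr : d < rho by apply: le_lt_trans rho2r.
have dr1 : d < r1 by apply: le_lt_trans (_ : r1 / 2 < _); [rewrite !ge_min lexx orbT|lra].
have kc z : normc z <= d -> c < normc (k z).
  move=> zd; have := H1 z; rewrite subr0 => /(_ (le_lt_trans zd dr1)) /= h.
  have := normcB_ge (k 0) (k 0 - k z); rewrite subKr (normcBC (k 0)) -/l => h'.
  by move: h h'; rewrite /c; lra.
have dC z : normc z <= d -> normc (derive1 phi z) <= C * normc z ^+ m.+1.
  move=> zd; have [_ k1 k2] := kB z (le_trans zd drho2); rewrite dE ?(le_trans zd)//.
  have nz := normc_ge0 z; have nzm := exprn_ge0 m.+1 nz.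
  have nn : normc (m.+2%:R : R[i]) = m.+2%:R.
    by rewrite -(rmorph_nat (real_complex R)) normcR ger0_norm.
  apply: le_trans (normcD_le _ _) _.
  rewrite (normcM _ (k z)) (normcM _ (z ^+ m.+1)) (normcM _ (derive1 k z)) !normcX nn.
  rewrite (_ : C * _ = m.+2%:R * normc z ^+ m.+1 * B + normc z ^+ m.+1 * B); last first.
    by rewrite /C mulrDl mulrAC (mulrC B).
  apply: lerD; first by rewrite ler_wpM2l// mulr_ge0.
  apply: ler_pM => //; [exact: exprn_ge0|exact: normc_ge0|].
  by rewrite [leLHS]exprS ler_piMl// (le_trans zd)// (le_trans (ltW dr))// ltW.
have [e e0 eH] := localise c d c0 d0 dr kc.
(* A lower bound for the weight as soon as [r < 1 / 2]. *)
pose h := (2^-1 : R) `^ (p - 2); have h0 : 0 < h by exact: powR_gt0.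
have Cp0 : 0 < C `^ p by exact: powR_gt0.
(* Threshold: [ineq] fails once [(s ^ m.+1) ^ (p - 2) < q]. *)
pose q := c ^+ 2 * h / C `^ p; have q0 : 0 < q by rewrite divr_gt0// mulr_gt0// exprn_gt0.
(* From [s < y <= 1] follows [s ^ m.+1 <= s < q ^ (1 / (p - 2))]; the requirement [r < c * y ^ m.+2]
   below ensures [s < y]. *)
pose y := Num.min 1 (q `^ (p - 2)^-1).
have y0 : 0 < y by rewrite lt_min ltr01 powR_gt0.
have tau0 : 0 < Num.min e (Num.min 2^-1 (c * y ^+ m.+2)).
  by rewrite !lt_min e0 invr_gt0 ltr0n mulr_gt0// exprn_gt0.
have [n [r [n0 /andP[r0]]]] := exists_small_radius tau0.
rewrite !lt_min => /and3P[re r2 ry] rn.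
have r01 : 0 < r < 1 by rewrite r0/=; apply: lt_trans r2 _; rewrite invf_lt1// ltr1n.
pose s := (r / c) `^ (m.+2%:R^-1).
have s0 : 0 < s by apply: powR_gt0; rewrite divr_gt0.
have sE : s ^+ m.+2 = r / c.
  by rewrite -powR_mulrn ?ltW// /s -powRrM mulVf ?pnatr_eq0// powRr1// ltW// divr_gt0.
have sr : c * s ^+ m.+2 = r by rewrite sE mulrC divfK// gt_eqF.
have sy : s < y.
  rewrite -(@ltr_pXn2r _ m.+2)// ?nnegrE ?(ltW s0) ?(ltW y0)//.
  by rewrite sE ltr_pdivrMr// mulrC.
have sm0 : 0 < s ^+ m.+1 by exact: exprn_gt0.
have K0 : 0 <= C * s ^+ m.+1 by rewrite mulr_ge0// ltW.
have small z : unit_disc z -> derive1 phi z != 0 -> normc (phi z) <= r ->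
    normc z < s /\ normc (derive1 phi z) <= C * s ^+ m.+1.
  move=> z1 dz zr; have [zd zs] := eH z r z1 dz zr re; have {}zs := zs _ s0 sr.
  split => //; apply: le_trans (dC z (ltW zd)) _; rewrite ler_wpM2l ?(ltW C0)//.
  by rewrite lerXn2r ?nnegrE ?normc_ge0// ltW.
have hw : h <= (1 - r ^+ 2) `^ (p - 2).
  apply: ge0_ler_powR; rewrite ?nnegrE ?invr_ge0 ?(ltW p20)//.
    by rewrite subr_ge0 exprn_ile1 ?ltW//; have /andP[] := r01.
  rewrite lerBrDr -lerBrDl half; apply: le_trans (ltW r2); rewrite expr2 ger_pMr//.
  by apply: ltW; have /andP[] := r01.
have rE : r ^+ 2 = c ^+ 2 * (s ^+ m.+1) ^+ 2 * s ^+ 2.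
  by rewrite -sr [s ^+ m.+2]exprSr !exprMn mulrA.
have smy : s ^+ m.+1 < q `^ (p - 2)^-1.
  apply: (@le_lt_trans _ _ s); last by apply: lt_le_trans sy _; rewrite ge_min lexx orbT.
  rewrite exprS ler_piMr ?(ltW s0)// exprn_ile1 ?(ltW s0)//.
  by apply: ltW; apply: lt_le_trans sy _; rewrite ge_min lexx.
have : (s ^+ m.+1) `^ (p - 2) < (q `^ (p - 2)^-1) `^ (p - 2).
  by apply: gt0_ltr_powR; rewrite // nnegrE ?powR_ge0// ltW.
rewrite -powRrM mulVf ?gt_eqF// powRr1 ?(ltW q0)// /q ltr_pdivlMr// mulrC => lt.
have := ineq n0 r01 rn s0 K0 small; rewrite leNgt => /negP; apply.
move: hw; set w := (1 - r ^+ 2) `^ (p - 2) => hw.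
rewrite rE (mulrA w) ltr_pM2r ?exprn_gt0// powRM ?(ltW C0) ?(ltW sm0)//.
rewrite (powR_split sm0) (mulrA (C `^ p)) (mulrA w) ltr_pM2r ?exprn_gt0//.
apply: lt_le_trans lt _; rewrite mulrC ler_wpM2r ?exprn_ge0 ?(ltW c0)//.
Qed.

End Conclusion.

Theorem theorem3p9 (R : realType) (p : R) (phi : R[i] -> R[i]) (U : set R[i])
  (hp : 2 < p)
  (phi_analytic : analytic phi)
  (phi_disc : forall z : R[i], unit_disc z -> unit_disc (phi z))
  (U_disc : U `<=` unit_disc)
  (U_nbhs : nbhs (0 : R[i]) U)
  (n_phi : {ae @area R, forall w : R * R, U (cplx w) -> card_preimage phi (cplx w) = 1%E}) :
  besov_isometry p (comp_op phi) <-> is_rotation phi.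
Proof.
split; last exact: rotation_besov_isometry.
move=> iso.
have phi0 : phi 0 = 0 := isometry_fixes0 hp phi_analytic iso.
have l1 : 1 <= normc (derive1 phi 0).
  apply: (derive1_0_ge1 hp phi_analytic phi0 U_nbhs n_phi) => k r rho K.
  exact: (sublevel_ineq hp phi_analytic (isometry_sublevel hp phi_analytic phi_disc iso k)).
have dphi z : normc z < 1 -> derivable phi z 1.
  by move=> z1; apply: phi_analytic; apply/unit_discE.
have phi1 z : normc z < 1 -> normc (phi z) < 1.
  by move=> z1; apply/unit_discE; apply: phi_disc; apply/unit_discE.
have phiE := schwarz_equality dphi phi1 l1.
exists (derive1 phi 0); split; last by move=> z /unit_discE; exact: phiE.
(* Were the modulus greater than [1], the inverse of [phi' 0] would be a point of the disc that
   [phi] maps to [1]. *)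
rewrite normr_normc (_ : normc _ = 1)//; apply/eqP; rewrite eq_le l1 andbT leNgt; apply/negP => l2.
have l0 : derive1 phi 0 != 0 by rewrite -normc_gt0 (lt_le_trans _ l1).
have z1 : normc (derive1 phi 0)^-1 < 1 by rewrite normcV invf_lt1// (lt_le_trans _ l1).
by have := phi1 _ z1; rewrite phiE// mulfV// normc1 ltxx.
Qed.
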